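(* The following hold. 1. There exist (families of) total Boolean functions $f$ with $\mathrm{QS}(f)=\widetilde{\Omega}(\mathrm{Adv}(f)^2)$. 2. There exist (families of) total Boolean functions $g$ with $\mathrm{QS}(g)\ge \widetilde{\deg}(g)^{4-o(1)}$. 3. For each $n$ there exists an $n$-bit partial Boolean function $h$ with $\mathrm{QS}(h)=\widetilde{\Omega}(n^{1/3})$ and $\mathrm{Adv}(h)=O(\log n)$.
   Context: Query model: for $x\in\{0,1\}^n$ the oracle $O_x$ acts by $O_x|i,b\rangle=|i,b\oplus x_i\rangle$. A $T$-query quantum algorithm applies input-independent unitaries $U_0,\dots,U_T$ interleaved with $O_x$ to $|0^m\rangle$, producing $|\psi_x\rangle=U_TO_x\cdots O_xU_0|0^m\rangle$, and may output the state obtained by tracing out a fixed subset of qubits. The trace distance is $\|\rho-\sigma\|_{tr}=\tfrac12\|\rho-\sigma\|_1$. $\mathrm{QS}(f)$, for a partial function $f:D\to\{0,1\}$ with $D\subseteq\{0,1\}^n$, is the smallest $k$ such that some $k$-query algorithm outputs states $\rho_x$ ($x\in D$) with $\|\rho_x-\rho_y\|_{tr}\ge1/6$ whenever $f(x)\ne f(y)$. $\mathrm{Adv}(f)$ is the positive-weights adversary bound: the maximum, over nonzero symmetric matrices $\Gamma$ with nonnegative entries indexed by $D\times D$ and with $\Gamma[x,y]=0$ whenever $f(x)=f(y)$, of $\|\Gamma\|/\max_{i\in[n]}\|\Gamma\circ D_i\|$. Here $\|\cdot\|$ is the spectral norm, $\circ$ is the entrywise product, and $D_i[x,y]=1$ if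 $x_i\ne y_i$ and $0$ otherwise. $\widetilde{\deg}(f)$ (approximate degree) is the minimum degree of a real polynomial $p$ in the input variables with $|f(x)-p(x)|\le1/3$ for all $x\in D$. The notation $\widetilde{\Omega}(g)$ means $\Omega(g/\log^c g)$ for some constant $c$. *)

(* Defs.v *)
From HB Require Import structures.
From mathcomp Require Import all_boot all_order all_algebra.
From mathcomp Require Import all_classical all_reals all_analysis.
From mathcomp Require Import Rstruct Rstruct_topology.
From mathcomp Require Import complex.
From mathcomp Require mpoly.

Set Implicit Arguments.
Unset Strict Implicit.
Unset Printing Implicit Defensive.

Import Order.TTheory GRing.Theory Num.Theory.
Local Open Scope ring_scope.
Local Open Scope classical_set_scope.

Notation RR := Rdefinitions.R.
Notation CC := (complex Rdefinitions.R).

Definition bits (n : nat) := {ffun 'I_n -> bool}.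

Definition adjmx (k : nat) (A : 'M[CC]_k) : 'M[CC]_k := map_mx Num.conj A^T.

(* singular values of A: square roots of the eigenvalues (with multiplicity)
   of the normal (Hermitian psd) matrix A^* A, given by the spectral theorem. *)
Definition singvals (k : nat) (A : 'M[CC]_k) : 'rV[CC]_k :=
  map_mx sqrtC (spectral_diag (adjmx A *m A)).

Definition spec_norm (k : nat) (A : 'M[CC]_k) : RR :=
  \big[Num.max/0]_(i < k) complex.Re (singvals A 0 i).

Definition trace_norm (k : nat) (A : 'M[CC]_k) : RR :=
  complex.Re (\sum_(i < k) singvals A 0 i).

Definition trace_dist (k : nat) (rho sigma : 'M[CC]_k) : RR :=
  trace_norm (rho - sigma) / 2.

Definition CofR (k : nat) (A : 'M[RR]_k) : 'M[CC]_k :=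
  map_mx (fun r : RR => Complex r 0) A.

(* Computational basis of the state space: query register i in [n],
   answer bit b, and a workspace register of arbitrary dimension w. *)
Definition qbasis (n w : nat) := ('I_n * bool * 'I_w)%type.
Definition qdim (n w : nat) := #|{: qbasis n w}|.

Definition oracle_map (n w : nat) (x : bits n) (s : qbasis n w) : qbasis n w :=
  let: (i, b, z) := s in (i, xorb b (x i), z).

Definition oracle (n w : nat) (x : bits n) : 'M[CC]_(qdim n w) :=
  \matrix_(r, c) ((enum_val r == oracle_map x (enum_val c)) %:R).

(* A T-query algorithm: input-independent unitaries U_0, ..., U_T, a fixed
   initial basis state, and a fixed splitting of the state space into a
   kept register (dimension qa_keep) and a traced-out register
   (dimension qa_trash), i.e. a bijection of basis states. *)
Record qalg (n T : nat) := QAlg {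
  qa_w : nat;
  qa_U : nat -> 'M[CC]_(qdim n qa_w);
  qa_unitary : forall t, (t <= T)%N -> qa_U t \is unitarymx;
  qa_start : qbasis n qa_w;
  qa_keep : nat;
  qa_trash : nat;
  qa_split : qbasis n qa_w -> ('I_qa_keep * 'I_qa_trash)%type;
  qa_split_bij : bijective qa_split }.

Arguments qa_w {n T} q : rename.
Arguments qa_U {n T} q _ : rename.
Arguments qa_start {n T} q : rename.
Arguments qa_keep {n T} q : rename.
Arguments qa_trash {n T} q : rename.
Arguments qa_split {n T} q _ : rename.

Fixpoint qa_state_rec (n T : nat) (A : qalg n T) (x : bits n) (t : nat)
  : 'cV[CC]_(qdim n (qa_w A)) :=
  match t with
  | 0 => qa_U A 0 *m delta_mx (enum_rank (qa_start A)) 0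
  | t'.+1 => qa_U A t *m (oracle (qa_w A) x *m qa_state_rec A x t')
  end.

Definition qa_state (n T : nat) (A : qalg n T) (x : bits n) :=
  qa_state_rec A x T.

(* Output state: partial trace of |psi_x><psi_x| over the traced-out register. *)
Definition qa_output (n T : nat) (A : qalg n T) (x : bits n)
  : 'M[CC]_(qa_keep A) :=
  \matrix_(a, a')
    \sum_(s : qbasis n (qa_w A))
      \sum_(s' : qbasis n (qa_w A) |
              [&& (qa_split A s).1 == a, (qa_split A s').1 == a'
                & (qa_split A s).2 == (qa_split A s').2])
        qa_state A x (enum_rank s) 0 * Num.conj (qa_state A x (enum_rank s') 0).

Definition qa_separates (n T : nat) (D : {set bits n}) (f : bits n -> bool)
  (A : qalg n T) : Prop :=
  forall x y, x \in D -> y \in D -> f x != f y ->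
    1 / 6 <= trace_dist (qa_output A x) (qa_output A y).

Definition QS (n : nat) (D : {set bits n}) (f : bits n -> bool) : RR :=
  inf [set r : RR | exists T : nat, r = T%:R /\
                    exists A : qalg n T, qa_separates D f A].

Definition dpt (n : nat) (D : {set bits n}) (p : 'I_#|D|) : bits n :=
  enum_val p.

Definition Dmx (n : nat) (D : {set bits n}) (i : 'I_n) : 'M[RR]_#|D| :=
  \matrix_(p, q) ((dpt p i != dpt q i) %:R).

Definition adv_matrix (n : nat) (D : {set bits n}) (f : bits n -> bool)
  (G : 'M[RR]_#|D|) : Prop :=
  [/\ G != 0, G^T = G, (forall p q, 0 <= G p q)
    & (forall p q, f (dpt p) = f (dpt q) -> G p q = 0)].

Definition adv_ratio (n : nat) (D : {set bits n}) (G : 'M[RR]_#|D|) : RR :=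
  spec_norm (CofR G) /
  \big[Num.max/0]_(i < n)
     spec_norm (CofR (\matrix_(p, q) (G p q * Dmx D i p q))).

Definition Adv (n : nat) (D : {set bits n}) (f : bits n -> bool) : RR :=
  sup [set r : RR | exists G : 'M[RR]_#|D|, @adv_matrix n D f G /\ r = @adv_ratio n D G].

Definition adeg (n : nat) (D : {set bits n}) (f : bits n -> bool) : RR :=
  inf [set r : RR | exists (d : nat) (p : mpoly.mpoly n RR),
         r = d%:R /\ (\max_(m <- mpoly.msupp p) mpoly.mdeg m <= d)%N /\
         forall x, x \in D ->
           `| (f x)%:R - mpoly.meval (fun i => (x i)%:R) p | <= 1 / 3].

(* Main.v *)
(** Parts 1 and 3 use a Reed-Solomon codeword together with a table of |F| bits;
    the function reads the table at the leading coefficient of the codeword.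
    Amplitudes after u queries are polynomials of degree u, and few symbols of a
    codeword carry no information on its leading coefficient, so that with fewer
    queries than half the degree the mass on the addressed cell averages to 1/|F|.
    By the hybrid argument T^2 >= |F|/144. The positive adversary bound is small,
    because distinct codewords differ in many positions: spreading the weight
    evenly over the symbols and putting weight 1 on the addressed cell is enough.

    Part 2 uses two levels of k-sum with m values per coordinate. Each of the km
    columns b of the inner level is a k-sum instance, whose solutions unlock a
    symbol u_b in the table Z_b; the symbols u_b form the outer instance, whose
    first solution S names a cell. The cell has to list a solution of every
    column. Validity of a cell is then the vanishing of an integer of size about
    m which is a polynomial of polylogarithmic degree in the input, and
    a Chebyshev polynomial gives approximate degree about sqrt m. Finding S takes
    about m queries in each of about m columns: in Zhandry's compressed oracle
    representation, recording an inner solution requires about m recorded symbols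
    of the column, and recording an outer one about m unlocked columns, up to
    amplitudes which are exponentially small in k. Thus QS is about m^2. *)
Require Import Defs.
From HB Require Import structures.
From mathcomp Require Import all_boot all_order all_algebra.
From mathcomp Require Import all_classical all_reals all_analysis.
From mathcomp Require Import Rstruct Rstruct_topology.
From mathcomp Require Import complex.
From mathcomp Require Import perm ring lra zify.
From mathcomp Require finfield mpoly.
Import Order.TTheory GRing.Theory Num.Theory.
Local Open Scope ring_scope.

Set Implicit Arguments.
Unset Strict Implicit.
Unset Printing Implicit Defensive.

(** * Norms, singular values and the adversary bound *)

(** The separation of output states is used only on pairs of inputs that agree outside one cell.
    Output distance is bounded through the purifications, so no measurement is analysed; [1 / 12] is
    the threshold [1 / 6] over the factor 2 of the hybrid argument. The analysed runs are always on
    blank inputs, and the point is that such a run cannot put query mass on the right cell. One code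
    function serves two claims. On codewords alone the uniform squared weight [2 / s] suffices; on
    all inputs a codeword must also be separated from words next to it, and balancing this against
    distant pairs raises the cost to about [sqrt s], up to a logarithm. For the k-sum function the
    obstacle is that the approximating polynomial has to behave on every input, not only on typical
    ones. The targets [tau] are therefore chosen so that no input at all has many solutions, while
    most random inputs still have one in every instance. The group has slightly fewer than
    [m ^ (k - 1)] elements: random instances then have somewhat more than m expected solutions, yet
    m / 4 recorded symbols complete one only with amplitude exponentially small in k. *)

Section L2.
Context {R : rcfType} {T : finType}.
Implicit Types a b h : T -> R.

Definition l2 h : R := Num.sqrt (\sum_t h t ^+ 2).

Lemma sumsq_ge0 h : 0 <= \sum_t h t ^+ 2.
Proof. by apply: sumr_ge0 => t _; rewrite sqr_ge0. Qed.

Lemma l2_ge0 h : 0 <= l2 h. Proof. exact: sqrtr_ge0. Qed.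

Lemma l2_sq h : l2 h ^+ 2 = \sum_t h t ^+ 2.
Proof. by rewrite sqr_sqrtr // sumsq_ge0. Qed.

Lemma eq_l2 a b : a =1 b -> l2 a = l2 b.
Proof. by move=> e; congr Num.sqrt; apply: eq_bigr => t _; rewrite e. Qed.

Lemma l2_le h c : 0 <= c -> \sum_t h t ^+ 2 <= c ^+ 2 -> l2 h <= c.
Proof. by move=> c0 H; rewrite -(ger0_norm c0) -sqrtr_sqr ler_sqrt // sqr_ge0. Qed.

Lemma CauchySchwarz_sum a b : \sum_t a t * b t <= l2 a * l2 b.
Proof.
(* Weighted arithmetic-geometric mean inequality. Positive upper bounds [x], [y] replace the norms,
   which may vanish; the slack [d] added to them below is sent to 0. *)
have key x y : l2 a <= x -> l2 b <= y -> 0 < x -> 0 < y -> \sum_t a t * b t <= x * y.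
  move=> ax bx x0 y0.
  have H t : a t * b t <= (a t ^+ 2 * (y / x) + b t ^+ 2 * (x / y)) / 2.
    have : 0 <= (a t * y - b t * x) ^+ 2 / (x * y).
      by rewrite divr_ge0 ?sqr_ge0 // mulr_ge0 // ltW.
    have -> : (a t * y - b t * x) ^+ 2 / (x * y) =
      a t ^+ 2 * (y / x) + b t ^+ 2 * (x / y) - 2 * (a t * b t).
      by field; rewrite !gt_eqF.
    lra.
  apply: (le_trans (ler_sum _ (fun t _ => H t))).
  rewrite -mulr_suml big_split /= -!mulr_suml -!l2_sq.
  have a2 : l2 a ^+ 2 * (y / x) <= x * y.
    rewrite mulrCA (_ : x * y = y * (x ^+ 2 / x)); last by field; rewrite gt_eqF.
    apply: ler_wpM2l; first exact: ltW.
    by rewrite ler_pM2r ?invr_gt0 // lerXn2r ?nnegrE ?l2_ge0 // ltW.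
  have b2 : l2 b ^+ 2 * (x / y) <= x * y.
    rewrite mulrCA (_ : x * y = x * (y ^+ 2 / y)); last by field; rewrite gt_eqF.
    apply: ler_wpM2l; first exact: ltW.
    by rewrite ler_pM2r ?invr_gt0 // lerXn2r ?nnegrE ?l2_ge0 // ltW.
  lra.
apply/ler_addgt0Pr => e e0.
pose d := Num.min 1 (e / (l2 a + l2 b + 1)).
have s0 : 0 < l2 a + l2 b + 1 by rewrite ltr_wpDl ?addr_ge0 ?l2_ge0.
have d0 : 0 < d by rewrite lt_min ltr01 divr_gt0.
have d1 : d <= 1 by rewrite ge_min lexx.
have de : d * (l2 a + l2 b + 1) <= e by rewrite -ler_pdivlMr // ge_min lexx orbT.
have := key (l2 a + d) (l2 b + d); rewrite !lerDl !(ltW d0) => /(_ isT isT).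
have -> : 0 < l2 a + d by rewrite ltr_wpDl ?l2_ge0.
have -> : 0 < l2 b + d by rewrite ltr_wpDl ?l2_ge0.
move=> /(_ isT isT) H; apply: (le_trans H); have := l2_ge0 a; have := l2_ge0 b; nra.
Qed.

Lemma l2D a b : l2 (fun t => a t + b t) <= l2 a + l2 b.
Proof.
apply: l2_le; first by rewrite addr_ge0 ?l2_ge0.
have -> : \sum_t (a t + b t) ^+ 2 =
   \sum_t a t ^+ 2 + (\sum_t a t * b t) *+ 2 + \sum_t b t ^+ 2.
  by rewrite -sumrMnl -!big_split /=; apply: eq_bigr => t _; rewrite sqrrD.
rewrite sqrrD -!l2_sq lerD2r lerD2l lerMn2r /=; exact: CauchySchwarz_sum.
Qed.

Lemma l2_mono a b : (forall t, a t ^+ 2 <= b t ^+ 2) -> l2 a <= l2 b.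
Proof. by move=> H; rewrite ler_sqrt ?sumsq_ge0 //; apply: ler_sum. Qed.
End L2.

Definition cn2 (z : CC) : RR := complex.Re z ^+ 2 + complex.Im z ^+ 2.

Lemma cn2_ge0 z : 0 <= cn2 z.
Proof. by rewrite addr_ge0 ?sqr_ge0. Qed.

Lemma cn2E z : z * Num.conj z = Complex (cn2 z) 0.
Proof. by rewrite /cn2; case: z => a b /=; congr Complex; ring. Qed.

Lemma cn2_Re z : cn2 z = complex.Re (z * Num.conj z). Proof. by rewrite cn2E. Qed.

Lemma cn2M y z : cn2 (y * z) = cn2 y * cn2 z.
Proof. by rewrite /cn2; case: y => a b; case: z => c d /=; ring. Qed.

Lemma cn2N z : cn2 (- z) = cn2 z.
Proof. by rewrite /cn2; case: z => a b /=; ring. Qed.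

Lemma cn20 : cn2 0 = 0. Proof. by rewrite /cn2 /= !expr0n addr0. Qed.
Lemma cn21 : cn2 1 = 1. Proof. by rewrite /cn2 /= expr1n expr0n addr0. Qed.

Lemma Re_sum (T : Type) (r : seq T) (P : pred T) (F : T -> CC) :
  complex.Re (\sum_(i <- r | P i) F i) = \sum_(i <- r | P i) complex.Re (F i).
Proof. by apply: (@big_morph _ _ (@complex.Re RR) 0 +%R 0 +%R) => // -[a b] [c d]. Qed.

Lemma Im_sum (T : Type) (r : seq T) (P : pred T) (F : T -> CC) :
  complex.Im (\sum_(i <- r | P i) F i) = \sum_(i <- r | P i) complex.Im (F i).
Proof. by apply: (@big_morph _ _ (@complex.Im RR) 0 +%R 0 +%R) => // -[a b] [c d]. Qed.

Section CL2.
Context {T : finType}.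
Implicit Types f g : T -> CC.

(** Viewing a complex vector as a real one over [T * bool] transfers the real inequalities. The
    compressed-oracle part also uses the two components as separate real functions. *)
Definition split_re f (p : T * bool) : RR :=
  if p.2 then complex.Re (f p.1) else complex.Im (f p.1).

Definition cl2 f : RR := l2 (split_re f).

Lemma sum_split_re f g :
  \sum_p split_re f p * split_re g p =
  \sum_t (complex.Re (f t) * complex.Re (g t) + complex.Im (f t) * complex.Im (g t)).
Proof.
rewrite -(pair_bigA _ (fun t b => split_re f (t, b) * split_re g (t, b))) /=.
by apply: eq_bigr => t _; rewrite big_bool.
Qed.

Lemma cl2_sq f : cl2 f ^+ 2 = \sum_t cn2 (f t).
Proof.
rewrite l2_sq -(pair_bigA _ (fun t b => split_re f (t, b) ^+ 2)) /=.
by apply: eq_bigr => t _; rewrite big_bool.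
Qed.

Lemma cl2_ge0 f : 0 <= cl2 f. Proof. exact: l2_ge0. Qed.

Lemma cl2E f : cl2 f = Num.sqrt (\sum_t cn2 (f t)).
Proof. by rewrite -cl2_sq sqrtr_sqr ger0_norm ?cl2_ge0. Qed.

Lemma eq_cl2 f g : f =1 g -> cl2 f = cl2 g.
Proof. by move=> e; apply: eq_l2 => -[t b]; rewrite /split_re /= e. Qed.

Lemma cl2D f g : cl2 (fun t => f t + g t) <= cl2 f + cl2 g.
Proof.
apply: le_trans (l2D _ _); apply: l2_mono => -[t b].
by rewrite /split_re /=; case: (f t) => ? ?; case: (g t) => ? ?; case: b.
Qed.

Lemma cl2N f : cl2 (fun t => - f t) = cl2 f.
Proof. by rewrite !cl2E; congr Num.sqrt; apply: eq_bigr => t _; rewrite cn2N. Qed.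

Lemma cl2B f g : cl2 (fun t => f t - g t) <= cl2 f + cl2 g.
Proof. by rewrite -(cl2N g) cl2D. Qed.

Lemma cl2_le f c : 0 <= c -> \sum_t cn2 (f t) <= c ^+ 2 -> cl2 f <= c.
Proof. by move=> c0 H; rewrite cl2E -(ger0_norm c0) -sqrtr_sqr ler_sqrt ?sqr_ge0. Qed.

Lemma cCauchySchwarz f g :
  complex.Re (\sum_t f t * Num.conj (g t)) <= cl2 f * cl2 g.
Proof.
apply: le_trans (CauchySchwarz_sum _ _); rewrite sum_split_re Re_sum.
by apply: ler_sum => t _; case: (f t) => ? ?; case: (g t) => ? ? /=; rewrite mulrN opprK.
Qed.
End CL2.

Lemma complexr_sum (T : Type) (r : seq T) (P : pred T) (F : T -> RR) :
  Complex (\sum_(i <- r | P i) F i) 0 = \sum_(i <- r | P i) Complex (F i) 0 :> CC.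
Proof.
apply: (@big_morph _ _ (fun x : RR => Complex x 0 : CC) 0 +%R 0 +%R) => // x y.
by apply/eqP; rewrite eq_complex /= addr0 !eqxx.
Qed.

Section Matrices.
Definition dag m n (A : 'M[CC]_(m, n)) : 'M[CC]_(n, m) := map_mx Num.conj A^T.

Lemma dagM m n p (A : 'M[CC]_(m, n)) (B : 'M[CC]_(n, p)) : dag (A *m B) = dag B *m dag A.
Proof. by rewrite /dag trmx_mul map_mxM. Qed.

Lemma dagE m n (A : 'M[CC]_(m, n)) i j : dag A i j = Num.conj (A j i).
Proof. by rewrite !mxE. Qed.

Lemma dagK m n (A : 'M[CC]_(m, n)) : dag (dag A) = A.
Proof. by apply/matrixP => i j; rewrite !mxE conjCK. Qed.

Lemma dagB m n (A B : 'M[CC]_(m, n)) : dag (A - B) = dag A - dag B.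
Proof. by rewrite /dag linearB map_mxB. Qed.

Lemma unitary_dag n (U : 'M[CC]_n) : U \is unitarymx -> dag U *m U = 1%:M.
Proof. by move=> /unitarymxP/mulmx1C. Qed.

Lemma unitary_dagr n (U : 'M[CC]_n) : U \is unitarymx -> U *m dag U = 1%:M.
Proof. by move=> /unitarymxP. Qed.

Definition fro m n (A : 'M[CC]_(m, n)) : RR := cl2 (fun p : 'I_m * 'I_n => A p.1 p.2).

Lemma fro_sq_sum m n (A : 'M[CC]_(m, n)) : fro A ^+ 2 = \sum_j \sum_i cn2 (A i j).
Proof.
by rewrite cl2_sq -(pair_bigA _ (fun i j => cn2 (A i j))) exchange_big.
Qed.

Lemma fro_sq m n (A : 'M[CC]_(m, n)) : fro A ^+ 2 = complex.Re (\tr (dag A *m A)).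
Proof.
rewrite fro_sq_sum /mxtrace Re_sum; apply: eq_bigr => j _.
rewrite mxE Re_sum; apply: eq_bigr => i _.
by rewrite !mxE cn2_Re mulrC.
Qed.

Lemma fro_ge0 m n (A : 'M[CC]_(m, n)) : 0 <= fro A. Proof. exact: cl2_ge0. Qed.

Lemma fro_unitary m n (U : 'M[CC]_m) (A : 'M[CC]_(m, n)) :
  dag U *m U = 1%:M -> fro (U *m A) = fro A.
Proof.
move=> UU; apply/eqP; rewrite -(@eqrXn2 _ 2) ?fro_ge0 // !fro_sq dagM.
by rewrite -mulmxA (mulmxA (dag U)) UU mul1mx.
Qed.

Lemma fro_dag m n (A : 'M[CC]_(m, n)) : fro (dag A) = fro A.
Proof.
by apply/eqP; rewrite -(@eqrXn2 _ 2) ?fro_ge0 // !fro_sq dagK mxtrace_mulC.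
Qed.

Lemma fro_tr m n (A B : 'M[CC]_(m, n)) : complex.Re (\tr (dag B *m A)) <= fro A * fro B.
Proof.
have -> : \tr (dag B *m A) =
   \sum_(p : 'I_m * 'I_n) A p.1 p.2 * Num.conj (B p.1 p.2).
  rewrite -(pair_bigA _ (fun i j => A i j * Num.conj (B i j))) exchange_big.
  by apply: eq_bigr => j _; rewrite mxE; apply: eq_bigr => i _; rewrite !mxE mulrC.
exact: cCauchySchwarz.
Qed.

(** The hypothesis makes [V *m dag V] a projection, and this is Pythagoras for it. *)
Lemma fro_contract_defect k l m (V : 'M[CC]_(k, l)) (X : 'M[CC]_(k, m)) :
  V *m (dag V *m V) *m dag V = V *m dag V ->
  fro (X - V *m (dag V *m X)) ^+ 2 = fro X ^+ 2 - fro (dag V *m X) ^+ 2.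
Proof.
move=> VVV; pose Y := V *m (dag V *m X).
have YE : dag Y = dag X *m (V *m dag V) by rewrite /Y !dagM dagK mulmxA.
have YY : dag Y *m Y = dag Y *m X.
  by rewrite YE /Y -[in RHS]VVV !mulmxA.
have XY : dag X *m Y = dag Y *m X by rewrite YE /Y !mulmxA.
rewrite -/Y 3!fro_sq dagB mulmxBl !mulmxBr YY subrr subr0 XY linearB raddfB.
by congr (_ - complex.Re (\tr _)); rewrite YE dagM dagK !mulmxA.
Qed.

Section Spectral.
Variables (k : nat) (A : 'M[CC]_k).

Definition svd_basis : 'M[CC]_k := dag (spectralmx (adjmx A *m A)).
Definition sigma i : RR := cl2 (fun j => (A *m svd_basis) j i).

Lemma svd_unitary : dag svd_basis *m svd_basis = 1%:M.
Proof. by rewrite /svd_basis dagK unitary_dagr // spectral_unitarymx. Qed.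

Lemma svd_unitaryr : svd_basis *m dag svd_basis = 1%:M.
Proof. exact/mulmx1C/svd_unitary. Qed.

Lemma svd_gram : dag (A *m svd_basis) *m (A *m svd_basis) =
  diag_mx (spectral_diag (adjmx A *m A)).
Proof.
set H := adjmx A *m A; set P := spectralmx H.
have Hn : H \is normalmx.
  apply/normalmxP; suff -> : map_mx Num.conj H^T = H by [].
  by rewrite -[LHS]/(dag H) /H dagM -[adjmx A]/(dag A) dagK.
have /orthomx_spectralP := Hn.
rewrite invmx_unitary ?spectral_unitarymx // => HE.
have HE' : H = dag P *m diag_mx (spectral_diag H) *m P by exact: HE.
have PP : P *m dag P = 1%:M by rewrite unitary_dagr ?spectral_unitarymx.
rewrite /svd_basis -/H -/P dagM dagK -mulmxA (mulmxA (dag A)) -[dag A *m A]/H.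
rewrite [in LHS]HE' -!mulmxA PP mulmx1 !mulmxA PP mul1mx.
by [].
Qed.

Lemma svd_gramE i j : complex.Re ((dag (A *m svd_basis) *m (A *m svd_basis)) i j) =
  if i == j then sigma i ^+ 2 else 0.
Proof.
case: eqP => [<-|/eqP ij]; last by rewrite svd_gram mxE (negbTE ij) mulr0n.
rewrite cl2_sq mxE Re_sum; apply: eq_bigr => l _.
by rewrite cn2_Re ![dag _ _ _]mxE mulrC !mxE.
Qed.

(** The eigenvalue is the squared norm of a column of [A *m svd_basis], so its complex square root
    is the nonnegative real norm. From here on singular values are handled as such norms. *)
Lemma singvalsE i : singvals A 0 i = Complex (sigma i) 0.
Proof.
rewrite mxE.
have -> : spectral_diag (adjmx A *m A) 0 i = Complex (sigma i) 0 ^+ 2.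
  have := congr1 (fun X : 'M[CC]_k => X i i) svd_gram.
  rewrite [in RHS]mxE eqxx mulr1n => <-.
  have -> : Complex (sigma i) 0 ^+ 2 = Complex (sigma i ^+ 2) 0.
    by rewrite !expr2; congr Complex; rewrite !(mul0r, mulr0, subr0, addr0).
  rewrite cl2_sq mxE.
  rewrite complexr_sum.
  by apply: eq_bigr => l _; rewrite -cn2E [dag _ _ _]mxE mxE mulrC.
by rewrite sqrCK // lecE /= eqxx cl2_ge0.
Qed.

Lemma spec_normE : spec_norm A = \big[Num.max/0]_(i < k) sigma i.
Proof. by apply: eq_bigr => i _; rewrite singvalsE. Qed.

Lemma trace_normE : trace_norm A = \sum_i sigma i.
Proof. by rewrite /trace_norm Re_sum; apply: eq_bigr => i _; rewrite singvalsE. Qed.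

Lemma sigma_le_spec i : sigma i <= spec_norm A.
Proof. by rewrite spec_normE (bigD1 i) //= le_max lexx. Qed.

Lemma spec_norm_ge0 : 0 <= spec_norm A.
Proof.
rewrite spec_normE; elim/big_rec: _ => // i x _ x0.
by rewrite le_max x0 orbT.
Qed.

Lemma fro_svd m (V : 'M[CC]_(k, m)) :
  fro (A *m svd_basis *m V) ^+ 2 = \sum_j \sum_i sigma i ^+ 2 * cn2 (V i j).
Proof.
rewrite fro_sq dagM -mulmxA (mulmxA (dag (A *m _))) svd_gram.
rewrite /mxtrace Re_sum; apply: eq_bigr => j _.
rewrite mxE Re_sum; apply: eq_bigr => i _.
rewrite mul_diag_mx mxE [dag _ _ _]mxE mxE mulrCA [_ * V i j]mulrC cn2E.
have := svd_gramE i i; rewrite svd_gram mxE !eqxx mulr1n => <-.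
by case: (spectral_diag _ _ _) => a b /=; rewrite mulr0 subr0.
Qed.

Lemma spec_norm_bound (v : 'cV_k) : fro (A *m v) <= spec_norm A * fro v.
Proof.
rewrite -[in X in fro X](mul1mx v) -svd_unitaryr -(mulmxA svd_basis) mulmxA.
have -> : fro v = fro (dag svd_basis *m v).
  by rewrite fro_unitary // dagK svd_unitaryr.
rewrite -ler_sqr ?nnegrE ?fro_ge0 ?mulr_ge0 ?spec_norm_ge0 ?fro_ge0 //.
rewrite exprMn fro_svd fro_sq_sum mulr_sumr; apply: ler_sum => j _.
rewrite mulr_sumr; apply: ler_sum => i _; apply: ler_wpM2r; first exact: cn2_ge0.
by rewrite ler_sqr ?nnegrE ?cl2_ge0 ?spec_norm_ge0 // sigma_le_spec.
Qed.

Lemma spec_norm_le c : 0 <= c -> (forall v : 'cV_k, fro (A *m v) <= c * fro v) ->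
  spec_norm A <= c.
Proof.
move=> c0 H; rewrite spec_normE; elim/big_ind: _ => [//|x y|i _].
  by rewrite ge_max => -> ->.
have := H (col i svd_basis).
have -> : fro (col i svd_basis) = 1.
  apply/eqP; rewrite -(@eqrXn2 _ 2) ?fro_ge0 // fro_sq_sum big_ord1 expr1n; apply/eqP.
  have := congr1 (fun X : 'M[CC]_k => complex.Re (X i i)) svd_unitary.
  rewrite [in RHS]mxE eqxx mulr1n /= => <-; rewrite mxE Re_sum.
  by apply: eq_bigr => l _; rewrite !mxE cn2_Re mulrC.
rewrite mulr1; apply: le_trans.
have -> : A *m col i svd_basis = col i (A *m svd_basis).
  by apply/matrixP => a b; rewrite !mxE; apply: eq_bigr => l _; rewrite !mxE.
by rewrite -ler_sqr ?nnegrE ?fro_ge0 ?cl2_ge0 // fro_sq_sum big_ord1 cl2_sq;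
  apply: ler_sum => l _; rewrite [in leRHS]mxE.
Qed.

(* The columns of [A *m svd_basis] are orthogonal; normalising the nonzero
   ones turns the trace norm into a trace against a partial isometry. *)
Definition svd_left : 'M[CC]_k :=
  \matrix_(j, i) (Complex (sigma i)^-1 0 * (A *m svd_basis) j i).

Lemma svd_left_gram : dag svd_left *m svd_left =
  diag_mx (\row_i (sigma i != 0)%:R).
Proof.
have E : svd_left = A *m svd_basis *m diag_mx (\row_i Complex (sigma i)^-1 0).
  by apply/matrixP => i j; rewrite mul_mx_diag !mxE mulrC.
rewrite E dagM -mulmxA (mulmxA (dag (A *m _))) svd_gram.
apply/matrixP => i j; rewrite mxE (bigD1 i) //= big1 ?addr0; last first.
  by move=> l li; rewrite !mxE (negbTE li) mulr0n conjC0 mul0r.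
rewrite mul_diag_mx !mxE; have [ij|ij] := eqVneq i j; last by rewrite !mulr0n !mulr0.
rewrite ?eqxx !mulr1n {ij}.
have -> : spectral_diag (adjmx A *m A) 0 i = Complex (sigma i ^+ 2) 0.
  have := singvalsE i; rewrite mxE => /(congr1 (fun x => x ^+ 2)); rewrite sqrtCK => ->.
  by rewrite !expr2; congr Complex; rewrite !(mul0r, mulr0, subr0, addr0).
have [->|s0] := eqVneq (sigma i) 0; first by rewrite invr0 !mulr0.
by apply/eqP; rewrite eq_complex /= !(mul0r, mulr0, subr0, addr0, oppr0) eqxx andbT; apply/eqP; field.
Qed.

Lemma svd_left_contract m (X : 'M[CC]_(k, m)) : fro (dag svd_left *m X) <= fro X.
Proof.
set V := svd_left; set E := diag_mx (\row_i (sigma i != 0)%:R : 'rV[CC]_k).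
have VE : V *m E = V.
  apply/matrixP => i j; rewrite mul_mx_diag !mxE.
  by have [->|_] := eqVneq (sigma j) 0; rewrite ?mulr1 // invr0 mulr0 (_ : Complex 0 0 = 0) // mul0r.
have VVV : V *m (dag V *m V) *m dag V = V *m dag V by rewrite svd_left_gram -/E VE.
rewrite -ler_sqr ?nnegrE ?fro_ge0 // -subr_ge0 -(fro_contract_defect _ VVV) sqr_ge0 //.
Qed.

Lemma trace_norm_pairing : trace_norm A = complex.Re (\tr (dag svd_left *m A *m svd_basis)).
Proof.
rewrite trace_normE /mxtrace Re_sum; apply: eq_bigr => i _.
rewrite -mulmxA mxE.
have -> : \sum_j dag svd_left i j * (A *m svd_basis) j i =
   Complex (sigma i)^-1 0 * Complex (sigma i ^+ 2) 0.
  rewrite cl2_sq.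
  rewrite complexr_sum.
  rewrite mulr_sumr; apply: eq_bigr => j _; rewrite -cn2E [dag _ _ _]mxE mxE [svd_left _ _]mxE.
  rewrite rmorphM /= -mulrA; congr (_ * _); first by congr Complex; rewrite oppr0.
  exact: mulrC.
have [->|s0] := eqVneq (sigma i) 0; first by rewrite invr0 /= !mul0r subr0.
by rewrite /= !mulr0 subr0; field.
Qed.
End Spectral.

(** The difference equals [(X - Y) *m dag X + Y *m dag (X - Y)]; each summand, paired with a partial
    isometry and a unitary, is bounded by Cauchy-Schwarz for the trace inner product. With [X], [Y]
    purifications this compares reduced states. *)
Lemma trace_norm_gram_diff k m (X Y : 'M[CC]_(k, m)) :
  trace_norm (X *m dag X - Y *m dag Y) <= fro (X - Y) * (fro X + fro Y).
Proof.
set A := _ - _; rewrite trace_norm_pairing.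
set V := svd_left A; set U := svd_basis A.
have -> : A = (X - Y) *m dag X + Y *m dag (X - Y).
  by rewrite dagB mulmxBl mulmxBr addrA subrK.
rewrite mulmxDr mulmxDl linearD raddfD /=.
have UU : dag (dag U) *m dag U = 1%:M by rewrite dagK svd_unitaryr.
have H (P Q : 'M[CC]_(k, m)) :
    complex.Re (\tr (dag V *m (P *m dag Q) *m U)) <= fro P * fro Q.
  rewrite !mulmxA -mulmxA mxtrace_mulC.
  have -> : dag Q *m U = dag (dag U *m Q) by rewrite dagM dagK.
  apply: (le_trans (fro_tr _ _)); rewrite (fro_unitary Q UU).
  by apply: ler_wpM2r; [exact: fro_ge0|exact: svd_left_contract].
by rewrite mulrDr [fro (X - Y) * fro Y]mulrC lerD.
Qed.
End Matrices.

Definition cabs (z : CC) : RR := Num.sqrt (cn2 z).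

Lemma cabs_sq z : cabs z ^+ 2 = cn2 z. Proof. by rewrite sqr_sqrtr ?cn2_ge0. Qed.

Lemma cabs_norm z : `|z| = Complex (cabs z) 0. Proof. by rewrite normc_def. Qed.

Lemma cabs_sum (T : Type) (r : seq T) (P : pred T) (F : T -> CC) :
  cabs (\sum_(i <- r | P i) F i) <= \sum_(i <- r | P i) cabs (F i).
Proof.
have H := ler_norm_sum r F P.
have e : \sum_(i <- r | P i) `|F i| = \sum_(i <- r | P i) Complex (cabs (F i)) 0.
  by apply: eq_bigr => i _; exact: cabs_norm.
by move: H; rewrite e cabs_norm -complexr_sum lecE => /andP[].
Qed.

Lemma cabsM y z : cabs (y * z) = cabs y * cabs z.
Proof. by rewrite /cabs cn2M sqrtrM ?cn2_ge0. Qed.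

Lemma cabs_real (x : RR) : cabs (Complex x 0) = `|x|.
Proof. by rewrite /cabs /cn2 /= [0 ^+ 2]expr0n addr0 sqrtr_sqr. Qed.

Definition ccol k (h : 'I_k -> RR) : 'cV[CC]_k := \col_i Complex (h i) 0.

Lemma fro_col k (v : 'cV[CC]_k) : fro v = l2 (fun i => cabs (v i 0)).
Proof.
apply/eqP; rewrite -(@eqrXn2 _ 2) ?fro_ge0 ?l2_ge0 // fro_sq_sum big_ord1 l2_sq.
by apply/eqP; apply: eq_bigr => i _; rewrite cabs_sq.
Qed.

Lemma fro_ccol k (h : 'I_k -> RR) : fro (ccol h) = l2 h.
Proof.
rewrite fro_col; congr Num.sqrt; apply: eq_bigr => i _.
by rewrite mxE cabs_real real_normK ?num_real.
Qed.

Lemma CofR_ccol k (H : 'M[RR]_k) (y : 'I_k -> RR) :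
  CofR H *m ccol y = ccol (fun p => \sum_q H p q * y q).
Proof.
apply/matrixP => p j; rewrite !mxE complexr_sum; apply: eq_bigr => q _.
by rewrite !mxE; apply/eqP; rewrite eq_complex /= !(mul0r, mulr0, subr0, addr0) !eqxx.
Qed.

Lemma bilinear_spec k (H : 'M[RR]_k) (x y : 'I_k -> RR) :
  \sum_p \sum_q H p q * (x p * y q) <= spec_norm (CofR H) * (l2 x * l2 y).
Proof.
have -> : \sum_p \sum_q H p q * (x p * y q) = \sum_p x p * \sum_q H p q * y q.
  by apply: eq_bigr => p _; rewrite mulr_sumr; apply: eq_bigr => q _; rewrite mulrCA.
apply: (le_trans (CauchySchwarz_sum _ _)).
rewrite mulrCA; apply: ler_wpM2l; first exact: l2_ge0.
by rewrite -fro_ccol -CofR_ccol -(fro_ccol y) spec_norm_bound.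
Qed.

(** * Weight schemes: the dual form of the positive adversary bound *)

Section AdvUpper.
Variables (n : nat) (D : {set bits n}) (f : bits n -> bool).
Variables (g : bits n -> 'I_n -> RR) (U : RR).
Hypothesis U0 : 0 <= U.
Hypothesis g0 : forall x i, 0 <= g x i.
Hypothesis gU : forall x, x \in D -> \sum_i g x i ^+ 2 <= U.
Hypothesis gsep : forall x y, x \in D -> y \in D -> f x != f y ->
  1 <= \sum_(i | x i != y i) g x i * g y i.

Let Gi (G : 'M[RR]_#|D|) i : 'M[RR]_#|D| := \matrix_(p, q) (G p q * Dmx D i p q).

Lemma dptP (p : 'I_#|D|) : dpt p \in D. Proof. exact: enum_valP. Qed.

(** Multiplying each entry of [G] by the separation sum, which is at least 1 where the entry can be
    nonzero, splits the form into the forms of the masked matrices. Cauchy-Schwarz over the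
    positions and the budget [U] reassemble the vectors. *)
Lemma adv_bilinear (G : 'M[RR]_#|D|) (c a : 'I_#|D| -> RR) : adv_matrix f G ->
  (forall p, 0 <= c p) -> (forall p, 0 <= a p) ->
  \sum_p \sum_q G p q * (c p * a q) <=
  U * \big[Num.max/0]_(i < n) spec_norm (CofR (Gi G i)) * (l2 c * l2 a).
Proof.
move=> [_ _ Gp Gf] c0 a0; set m := \big[_/_]_(i < n) _.
have mi i : spec_norm (CofR (Gi G i)) <= m by rewrite /m (bigD1 i) //= le_max lexx.
have m0 : 0 <= m.
  by rewrite /m; elim/big_rec: _ => // i x _ x0; rewrite le_max x0 orbT.
pose gc i p := g (dpt p) i * c p; pose ga i p := g (dpt p) i * a p.
apply: (@le_trans _ _ (\sum_i \sum_p \sum_q Gi G i p q * (gc i p * ga i q))).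
  rewrite [leRHS]exchange_big; apply: ler_sum => p _ /=.
  rewrite [leRHS]exchange_big; apply: ler_sum => q _ /=.
  have [fe|fe] := eqVneq (f (dpt p)) (f (dpt q)).
    rewrite Gf // mul0r big1 // => i _; by rewrite mxE Gf // !mul0r.
  have -> : \sum_i Gi G i p q * (gc i p * ga i q) =
    G p q * (c p * a q) * \sum_(i | dpt p i != dpt q i) g (dpt p) i * g (dpt q) i.
    rewrite mulr_sumr [RHS]big_mkcond; apply: eq_bigr => i _; rewrite !mxE.
    by case: eqP => _; rewrite /= ?mulr0 ?mul0r // mulr1 /gc /ga; ring.
  by apply: ler_peMr; [rewrite !mulr_ge0|exact: (gsep (dptP p) (dptP q) fe)].
have S (h : 'I_#|D| -> RR) : l2 (fun i => l2 (fun p => g (dpt p) i * h p)) <= Num.sqrt U * l2 h.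
  apply: l2_le; first by rewrite mulr_ge0 ?sqrtr_ge0 ?l2_ge0.
  rewrite exprMn sqr_sqrtr // l2_sq mulr_sumr.
  under eq_bigr do rewrite l2_sq.
  rewrite exchange_big; apply: ler_sum => p _.
  under eq_bigr do rewrite exprMn.
  by rewrite -mulr_suml; apply: ler_wpM2r; [exact: sqr_ge0|exact: (gU (dptP p))].
apply: (@le_trans _ _ (m * \sum_i l2 (gc i) * l2 (ga i))).
  rewrite mulr_sumr; apply: ler_sum => i _; apply: (le_trans (bilinear_spec _ _ _)).
  by apply: ler_wpM2r => //; rewrite mulr_ge0 ?l2_ge0.
rewrite (mulrC U) -mulrA; apply: ler_wpM2l => //.
apply: (le_trans (CauchySchwarz_sum _ _)).
rewrite -[X in _ <= X * _](sqr_sqrtr U0) expr2 mulrACA.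
by apply: ler_pM; rewrite ?l2_ge0 ?S.
Qed.

Lemma adv_ratio_le (G : 'M[RR]_#|D|) : adv_matrix f G -> adv_ratio G <= U.
Proof.
move=> GA; rewrite /adv_ratio; set m := \big[_/_]_(i < n) _.
have m0 : 0 <= m.
  by rewrite /m; elim/big_rec: _ => // i x _ x0; rewrite le_max x0 orbT.
(* With denominator 0 the ratio is 0, as [0^-1 = 0]. *)
have [->|mN] := eqVneq m 0; first by rewrite invr0 mulr0.
have mp : 0 < m by rewrite lt_def mN.
rewrite ler_pdivrMr //; apply: spec_norm_le; first exact: mulr_ge0.
(* Since [G] has nonnegative entries, passing to the moduli of [v] does not decrease the norm of the
   image; the bilinear bound is then applied to [a] and to its image [c]. *)
move=> v; pose a q := cabs (v q 0); pose c p := \sum_q G p q * a q.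
have [_ _ Gp _] := GA.
have a0 q : 0 <= a q by exact: sqrtr_ge0.
have c0 p : 0 <= c p by apply: sumr_ge0 => q _; rewrite mulr_ge0.
have cv : fro (CofR G *m v) <= l2 c.
  rewrite fro_col; apply: l2_mono => p; rewrite ler_sqr ?nnegrE ?sqrtr_ge0 //.
  rewrite mxE; apply: (le_trans (cabs_sum _ _ _)); apply: ler_sum => q _.
  by rewrite cabsM mxE cabs_real ger0_norm.
apply: (le_trans cv); rewrite fro_col -/a.
have [->|cN] := eqVneq (l2 c) 0; first by rewrite !mulr_ge0 ?l2_ge0.
have cp : 0 < l2 c by rewrite lt_def cN l2_ge0.
rewrite -(ler_pM2l cp) -expr2 l2_sq.
have -> : \sum_t c t ^+ 2 = \sum_p \sum_q G p q * (c p * a q).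
  by apply: eq_bigr => p _; rewrite expr2 {2}/c mulr_sumr; apply: eq_bigr => q _; rewrite mulrCA.
by rewrite mulrCA; exact: adv_bilinear.
Qed.

Lemma Adv_le : Adv D f <= U.
Proof.
rewrite /Adv; set S := (X in sup X).
(* Without adversary matrices the supremum is 0 by convention. *)
have [->|/set0P S0] := eqVneq S set0; first by rewrite sup0.
by apply: ge_sup => // r [G [GA ->]]; exact: adv_ratio_le.
Qed.

Lemma Adv_ratio_le_Adv (G : 'M[RR]_#|D|) : adv_matrix f G -> adv_ratio G <= Adv D f.
Proof.
move=> GA; apply: ub_le_sup; last by exists G.
by exists U => r [G' [GA' ->]]; exact: adv_ratio_le.
Qed.
End AdvUpper.

(** * Adversary lower bound from disjoint sensitive blocks *)

Section AdvStar.
Variables (n : nat) (D : {set bits n}) (f : bits n -> bool) (s : nat).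
Variables (X : 'I_#|D|) (Z : 'I_s -> 'I_#|D|).
Hypothesis s0 : (0 < s)%N.
Hypothesis fXZ : forall j, f (dpt X) != f (dpt (Z j)).
Hypothesis disj : forall i j j', dpt X i != dpt (Z j) i -> dpt X i != dpt (Z j') i -> j = j'.

(** Adjacency matrix of a star with centre [X] and leaves [Z j]. By [disj] each input position
    distinguishes the centre from at most one leaf. *)
Definition star_mx : 'M[RR]_#|D| :=
  \matrix_(p, q) (((p == X) && (q \in codom Z)) || ((q == X) && (p \in codom Z)))%:R.

Lemma star_X : X \notin codom Z.
Proof. by apply/codomP => -[j Xj]; have := fXZ j; rewrite -Xj eqxx. Qed.

Lemma star_diff j : exists i, dpt X i != dpt (Z j) i.
Proof.
apply/existsP; apply: contraT; rewrite negb_exists => /forallP H.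
have := fXZ j; have -> : dpt (Z j) = dpt X; last by rewrite eqxx.
by apply/ffunP => i; have := H i; rewrite negbK => /eqP.
Qed.

Lemma star_inj : injective Z.
Proof. by move=> j j' e; have [i Hi] := star_diff j; apply: (disj Hi); rewrite -e. Qed.

Lemma star_adv : adv_matrix f star_mx.
Proof.
split.
- apply/eqP => /matrixP/(_ X (Z (Ordinal s0))); rewrite !mxE eqxx codom_f /= => /eqP.
  by rewrite oner_eq0.
- by apply/matrixP => p q; rewrite !mxE orbC.
- by move=> p q; rewrite mxE ler0n.
- move=> p q fe; rewrite mxE; case: eqP => [pX|_] /=.
    case: codomP => [[j qj]|_] /=; last by rewrite -pX; case: eqP => //= qp; rewrite pX (negbTE star_X).
    by have := fXZ j; rewrite -pX -qj fe eqxx.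
  case: eqP => //= qX; case: codomP => //= -[j pj].
  by have := fXZ j; rewrite -qX -pj fe eqxx.
Qed.

Lemma star_delta : fro (ccol (fun p => (p == X)%:R)) = 1.
Proof.
rewrite fro_ccol /l2 (bigD1 X) //= eqxx expr1n big1 ?addr0 ?sqrtr1 // => p /negbTE ->.
by rewrite expr0n.
Qed.

Lemma star_ge : Num.sqrt s%:R <= spec_norm (CofR star_mx).
Proof.
have := spec_norm_bound (CofR star_mx) (ccol (fun p => (p == X)%:R)).
rewrite star_delta mulr1; apply: le_trans.
rewrite CofR_ccol fro_ccol.
have -> : l2 (fun p => \sum_q star_mx p q * (q == X)%:R) = l2 (fun p => (p \in codom Z)%:R : RR).
  apply: eq_l2 => p; rewrite (bigD1 X) //= big1 ?addr0; last by move=> q /negbTE ->; rewrite mulr0.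
  rewrite eqxx mulr1 mxE eqxx; case: (eqVneq p X) => [->|] //=.
  by rewrite (negbTE star_X).
rewrite /l2 ler_wsqrtr //.
have -> : \sum_t ((t \in codom Z)%:R : RR) ^+ 2 = #|codom Z|%:R.
  transitivity (\sum_(t in codom Z) (1 : RR)); last by rewrite sumr_const.
  rewrite [RHS]big_mkcond; apply: eq_bigr => p _.
  by case: (p \in _); rewrite ?expr1n ?expr0n.
by rewrite card_codom ?card_ord //; exact: star_inj.
Qed.

(** Masking by a position leaves at most one edge, whose matrix acts as a transposition on two
    coordinates and as 0 elsewhere, hence is a contraction. *)
Lemma star_le i : spec_norm (CofR (\matrix_(p, q) (star_mx p q * Dmx D i p q))) <= 1.
Proof.
apply: spec_norm_le => // v; rewrite mul1r.
set H := CofR _.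
have [/existsP[j ij]|] := boolP [exists j, dpt X i != dpt (Z j) i]; last first.
  rewrite negb_exists => /forallP Hn.
  have -> : H = 0.
    apply/matrixP => p q; rewrite !mxE.
    case: eqP => [->|_] /=.
      case: codomP => [[j ->]|_] /=; last by rewrite (negbTE star_X) andbF mul0r.
      by have := Hn j; rewrite negbK => /eqP ->; rewrite eqxx mulr0.
    case: eqP => [->|_] /=; last by rewrite mul0r.
    case: codomP => [[j ->]|_] /=; last by rewrite mul0r.
    by have := Hn j; rewrite negbK => /eqP ->; rewrite eqxx mulr0.
  rewrite mul0mx; have -> : fro (0 : 'cV[CC]_#|D|) = 0; last exact: fro_ge0.
  rewrite fro_col /l2 big1 ?sqrtr0 // => p _.
  by rewrite mxE /cabs cn20 sqrtr0 expr0n.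
have HE p q : H p q = (((p == X) && (q == Z j)) || ((q == X) && (p == Z j)))%:R.
  rewrite !mxE; case: (eqVneq p X) => [->|pX] /=.
    rewrite (negbTE star_X) andbF orbF.
    have -> : (X == Z j) = false by apply/eqP => e; have := star_X; rewrite e codom_f.
    rewrite andbF orbF; case: (eqVneq q (Z j)) => [->|qj]; first by rewrite codom_f ij mul1r.
    case: codomP => [[j' qj']|_] /=; last by rewrite mul0r.
    case: eqP => [_|/eqP ij']; first by rewrite mulr0.
    by rewrite qj' in ij' qj; rewrite (disj ij ij') eqxx in qj.
  case: (eqVneq q X) => [->|qX] /=; last by rewrite mul0r.
  case: (eqVneq p (Z j)) => [->|pj]; first by rewrite codom_f eq_sym ij mul1r.
  case: codomP => [[j' pj']|_] /=; last by rewrite mul0r.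
  case: eqP => [_|/eqP ij']; first by rewrite mulr0.
  by rewrite eq_sym pj' in ij'; rewrite pj' in pj; rewrite (disj ij ij') eqxx in pj.
rewrite -ler_sqr ?nnegrE ?fro_ge0 // !fro_sq_sum !big_ord1.
rewrite [leRHS](reindex_inj (@perm_inj _ (tperm X (Z j)))) /=.
apply: ler_sum => p _; rewrite mxE.
have XZ : X != Z j by apply/eqP => e; have := star_X; rewrite e codom_f.
case: (eqVneq p X) => [->|pX].
  rewrite tpermL (bigD1 (Z j)) //= big1 ?addr0 => [|q qj].
    by rewrite HE !eqxx mul1r.
  by rewrite HE eqxx (negbTE qj) (negbTE XZ) !andbF /= mul0r.
case: (eqVneq p (Z j)) => [->|pj].
  rewrite tpermR (bigD1 X) //= big1 ?addr0 => [|q qj].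
    by rewrite HE !eqxx orbT mul1r.
  by rewrite HE (negbTE qj) [Z j == X]eq_sym (negbTE XZ) /= mul0r.
rewrite big1 ?cn20 ?cn2_ge0 // => q _; by rewrite HE (negbTE pX) (negbTE pj) andbF /= mul0r.
Qed.

(** Rules out a zero denominator, for which the ratio would be 0 by convention. *)
Lemma star_max : 1 <= \big[Num.max/0]_(i < n)
   spec_norm (CofR (\matrix_(p, q) (star_mx p q * Dmx D i p q))).
Proof.
pose j := Ordinal s0; have [i ij] := star_diff j.
rewrite (bigD1 i) //= le_max; apply/orP; left.
set H := \matrix_(p, q) _.
have := spec_norm_bound (CofR H) (ccol (fun p => (p == X)%:R)).
rewrite star_delta mulr1; apply: le_trans.
rewrite CofR_ccol fro_ccol /l2 (bigD1 (Z j)) //= (bigD1 X) //= big1 ?addr0; last first.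
  by move=> q /negbTE ->; rewrite mulr0.
rewrite eqxx mulr1 !mxE eqxx codom_f orbT eq_sym ij mulr1 expr1n.
rewrite -[leLHS]sqrtr1; apply: ler_wsqrtr; rewrite lerDl.
by apply: sumr_ge0 => p _; exact: sqr_ge0.
Qed.

Lemma star_ratio : Num.sqrt s%:R <= adv_ratio star_mx.
Proof.
rewrite /adv_ratio; have M1 := star_max; rewrite ler_pdivlMr ?(lt_le_trans ltr01) //.
apply: le_trans star_ge; rewrite -[leRHS]mulr1; apply: ler_wpM2l; first exact: sqrtr_ge0.
by apply/bigmax_leP; split=> // i _; exact: star_le.
Qed.
End AdvStar.

(** * Query algorithms and the hybrid argument *)

Lemma xorbK a b : xorb (xorb a b) b = a.
Proof. by case: a; case: b. Qed.

Section Run.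
Variables (n T : nat) (A : qalg n T).
Local Notation Q := (qbasis n (qa_w A)).
Implicit Types (x y : bits n) (v : Q -> CC).

Definition amp x t (s : Q) : CC := qa_state_rec A x t (enum_rank s) 0.

Definition Uapp t v (s : Q) : CC :=
  \sum_s' qa_U A t (enum_rank s) (enum_rank s') * v s'.

Lemma oracle_mapK x : involutive (@oracle_map n (qa_w A) x).
Proof. by move=> [[i b] z] /=; rewrite xorbK. Qed.

Lemma ampS x t s : amp x t.+1 s = Uapp t.+1 (fun s' => amp x t (oracle_map x s')) s.
Proof.
rewrite /amp /= mxE /Uapp (reindex (@enum_rank Q)) /=; last first.
  by exists enum_val => s' _; rewrite ?enum_rankK ?enum_valK.
apply: eq_bigr => s' _; congr (_ * _); rewrite mxE.
rewrite (bigD1 (enum_rank (oracle_map x s'))) //= big1 ?addr0 => [|c cs].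
  by rewrite mxE !enum_rankK oracle_mapK eqxx mul1r.
rewrite mxE enum_rankK; case: eqP => [e|_]; last by rewrite mul0r.
by rewrite e oracle_mapK enum_valK eqxx in cs.
Qed.

Lemma fro_fun v : fro (\col_i v (enum_val i) : 'cV_(qdim n (qa_w A))) = cl2 v.
Proof.
apply/eqP; rewrite -(@eqrXn2 _ 2) ?fro_ge0 ?cl2_ge0 // fro_sq_sum big_ord1 cl2_sq.
rewrite (reindex (@enum_rank Q)) /=; last first.
  by exists enum_val => s' _; rewrite ?enum_rankK ?enum_valK.
by apply/eqP; apply: eq_bigr => s _; rewrite mxE enum_rankK.
Qed.

Lemma cl2_Uapp t v : (t <= T)%N -> cl2 (Uapp t v) = cl2 v.
Proof.
move=> tT; rewrite -!fro_fun -[RHS](fro_unitary _ (unitary_dag (@qa_unitary n T A t tT))).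
congr fro; apply/matrixP => i j; rewrite !mxE /Uapp.
rewrite [RHS](reindex (@enum_rank Q)) /=; last first.
  by exists enum_val => s' _; rewrite ?enum_rankK ?enum_valK.
by apply: eq_bigr => s' _; rewrite mxE enum_rankK enum_valK.
Qed.

Lemma UappB t v w s : Uapp t v s - Uapp t w s = Uapp t (fun s' => v s' - w s') s.
Proof. by rewrite /Uapp -sumrB; apply: eq_bigr => s' _; rewrite mulrBr. Qed.

Lemma cl2_bij (h : Q -> Q) v : bijective h -> cl2 (v \o h) = cl2 v.
Proof.
move=> [h' hK h'K]; rewrite !cl2E; congr Num.sqrt.
by rewrite [RHS](reindex h) //; exists h' => s _.
Qed.

Lemma oracle_bij x : bijective (@oracle_map n (qa_w A) x).
Proof. exact: inv_bij (oracle_mapK x). Qed.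

Lemma cl2_amp x t : (t <= T)%N -> cl2 (amp x t) = 1.
Proof.
elim: t => [|t IH] tT; last first.
  rewrite (eq_cl2 (ampS x t)) cl2_Uapp // -[RHS](IH (ltnW tT)).
  exact: (cl2_bij (amp x t) (oracle_bij x)).
have E : amp x 0 =1 Uapp 0 (fun s' => (s' == qa_start A)%:R).
  move=> s; rewrite /amp /= mxE /Uapp (reindex (@enum_rank Q)) /=; last first.
    by exists enum_val => s' _; rewrite ?enum_rankK ?enum_valK.
  apply: eq_bigr => s' _; rewrite mxE eqxx andbT.
  by rewrite (inj_eq enum_rank_inj).
rewrite (eq_cl2 E) cl2_Uapp // cl2E (bigD1 (qa_start A)) //= big1 => [|s /negbTE ->].
  by rewrite eqxx cn21 addr0 sqrtr1.
by rewrite cn20.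
Qed.

(** Query magnitude: the state after [t] queries and [U_t] is the one entering the next query, so
    this is the mass with which that query reads a position in [P]. *)
Definition qmass x t (P : pred 'I_n) : RR := \sum_(s : Q | P s.1.1) cn2 (amp x t s).

Lemma qmass_ge0 x t P : 0 <= qmass x t P.
Proof. by apply: sumr_ge0 => s _; exact: cn2_ge0. Qed.

(** One query increases the distance of the two runs by at most twice the norm of the amplitudes
    sitting on positions where the inputs differ. Only the masses of the run on [x] enter, so [x]
    can be a blank input and [y] any marking of it. *)
Lemma hybrid x y t : (t <= T)%N ->
  cl2 (fun s => amp x t s - amp y t s) <=
  \sum_(u < t) 2 * Num.sqrt (qmass x u (fun i => x i != y i)).
Proof.
elim: t => [|t IH] tT.
  rewrite big_ord0; apply: cl2_le => //; rewrite big1 ?expr0n // => s _.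
  by rewrite subrr cn20.
rewrite big_ord_recr /=; apply: le_trans (lerD (IH (ltnW tT)) (lexx _)).
set a := amp x t; set b := amp y t; set P := (fun i => x i != y i).
have -> : cl2 (fun s => amp x t.+1 s - amp y t.+1 s) =
          cl2 (fun s => a (oracle_map x s) - b (oracle_map y s)).
  rewrite -[RHS](cl2_Uapp _ tT); apply: eq_cl2 => s.
  by rewrite !ampS UappB.
(* After undoing the oracle of [y], the composite [h] fixes every basis state whose position does
   not distinguish [x] from [y]. *)
pose h (s : Q) := oracle_map x (oracle_map y s).
have -> : cl2 (fun s => a (oracle_map x s) - b (oracle_map y s)) =
          cl2 (fun s => a (h s) - b s).
  rewrite -(cl2_bij (fun s => a (h s) - b s) (oracle_bij y)).
  by apply: eq_cl2 => s /=; rewrite /h !oracle_mapK.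
pose m (c : Q -> CC) (s : Q) : CC := if P s.1.1 then c s else 0.
have hP s : (h s).1.1 = s.1.1 by case: s => [[i c] z].
have hid s : ~~ P s.1.1 -> h s = s.
  case: s => [[i c] z]; rewrite /P negbK /= => /eqP e.
  by rewrite /h /= e xorbK.
have mE (c : Q -> CC) : cl2 (m c) = Num.sqrt (\sum_(s | P s.1.1) cn2 (c s)).
  rewrite cl2E; congr Num.sqrt; rewrite [RHS]big_mkcond; apply: eq_bigr => s _.
  by rewrite /m; case: ifP; rewrite ?cn20.
have -> : cl2 (fun s => a (h s) - b s) =
   cl2 (fun s => (a s - b s) + (m (a \o h) s - m a s)).
  apply: eq_cl2 => s; rewrite /m; case: ifPn => [_|/hid ->] /=; last by rewrite subrr addr0.
  by ring.
apply: (le_trans (cl2D _ _)); rewrite lerD2l.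
apply: (le_trans (cl2B _ _)); rewrite mulr_natl mulr2n.
have -> : cl2 (m (a \o h)) = cl2 (m a).
  have hb : bijective h by exact: bij_comp (oracle_bij x) (oracle_bij y).
  rewrite -(cl2_bij (m a) hb); apply: eq_cl2 => s.
  by rewrite /m /= hP.
by rewrite mE.
Qed.

(** The final pure state reshaped into a matrix from the traced-out to the kept register: the
    partial trace becomes its product with its adjoint, to which [trace_norm_gram_diff] applies. *)
Definition split_mx x : 'M[CC]_(qa_keep A, qa_trash A) :=
  \matrix_(a, z) \sum_(s | qa_split A s == (a, z)) amp x T s.

Lemma qa_outputE x : qa_output A x = split_mx x *m dag (split_mx x).
Proof.
have [g sK gK] := qa_split_bij A.
have spE (s : Q) p : (qa_split A s == p) = (s == g p).
  by apply/eqP/eqP => [<-|->].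
have mE a z : split_mx x a z = amp x T (g (a, z)).
  rewrite mxE (eq_bigl _ _ (fun s => spE s _)); exact: big_pred1_eq.
have gb : bijective g by exists (qa_split A).
apply/matrixP => a a'; rewrite !mxE.
under [RHS]eq_bigr do rewrite dagE !mE.
have -> : (\sum_s \sum_(s' | [&& (qa_split A s).1 == a, (qa_split A s').1 == a' &
     (qa_split A s).2 == (qa_split A s').2])
     qa_state A x (enum_rank s) 0 * Num.conj (qa_state A x (enum_rank s') 0)) =
   \sum_s (if (qa_split A s).1 == a then
      amp x T s * Num.conj (amp x T (g (a', (qa_split A s).2))) else 0).
  apply: eq_bigr => s _; case: eqP => sa; last by rewrite big_pred0.
  rewrite (eq_bigl (fun s' => s' == g (a', (qa_split A s).2))) ?big_pred1_eq //.
  move=> s' /=; rewrite -spE; case: (qa_split A s') => u v /=.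
  by rewrite xpair_eqE [v == _]eq_sym.
rewrite (reindex g) /=; last by apply: onW_bij.
under eq_bigr do rewrite gK.
rewrite (eq_bigr (fun p => (fun b z => if b == a then
   amp x T (g (b, z)) * Num.conj (amp x T (g (a', z))) else 0) p.1 p.2)); last by case.
rewrite -(pair_bigA _ (fun b z => if b == a then
   amp x T (g (b, z)) * Num.conj (amp x T (g (a', z))) else 0)) /=.
rewrite (bigD1 a) //= [X in _ + X]big1 ?addr0 => [|b /negbTE ->]; last exact: big1.
by apply: eq_bigr => z _; rewrite eqxx.
Qed.

Lemma fro_split_lin (F : 'M[CC]_(qa_keep A, qa_trash A)) v :
  (forall s, F (qa_split A s).1 (qa_split A s).2 = v s) -> fro F = cl2 v.
Proof.
have [g sK gK] := qa_split_bij A.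
move=> E; apply/eqP; rewrite -(@eqrXn2 _ 2) ?fro_ge0 ?cl2_ge0 // !cl2_sq.
rewrite (reindex (qa_split A)) /=; last by apply: onW_bij; exact: qa_split_bij.
by apply/eqP; apply: eq_bigr => s _; rewrite E.
Qed.

Lemma split_mxE x s : split_mx x (qa_split A s).1 (qa_split A s).2 = amp x T s.
Proof.
rewrite mxE -surjective_pairing (eq_bigl (pred1 s)) ?big_pred1_eq // => s' /=.
by rewrite (inj_eq (bij_inj (qa_split_bij A))).
Qed.

(** Both reshaped states have norm 1, and [1 + 1] cancels the one half in the trace distance. *)
Lemma trace_dist_le x y : trace_dist (qa_output A x) (qa_output A y) <=
  cl2 (fun s => amp x T s - amp y T s).
Proof.
rewrite /trace_dist !qa_outputE ler_pdivrMr //.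
apply: (le_trans (trace_norm_gram_diff _ _)).
rewrite (fro_split_lin (split_mxE x)) (fro_split_lin (split_mxE y)) !cl2_amp //.
rewrite (_ : 1 + 1 = 2) // (@fro_split_lin _ (fun s => amp x T s - amp y T s)) //.
by move=> s; rewrite !mxE -!split_mxE !mxE.
Qed.

Lemma separates_qmass (D : {set bits n}) (f : bits n -> bool) x y :
  qa_separates D f A -> x \in D -> y \in D -> f x != f y ->
  1 / 12 <= \sum_(t < T) Num.sqrt (qmass x t (fun i => x i != y i)).
Proof.
move=> sepA xD yD fxy; have := sepA x y xD yD fxy.
move=> /le_trans /(_ (trace_dist_le x y)) /le_trans /(_ (hybrid x y (leqnn T))).
rewrite -mulr_sumr; lra.
Qed.
End Run.
Arguments amp {n T} A x t s.

(* Some separating algorithm must be exhibited because the infimum defining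
   [QS] would be 0 on an empty set of query numbers. *)
Section ReadAll.
Variable n' : nat.
Local Notation n := n'.+1.
Local Notation w := #|{: bits n}|.

Definition bset (x : bits n) i b : bits n := [ffun j => if j == i then b else x j].

(** Swaps the answer bit with the memory bit of the current position and advances cyclically; a
    permutation of basis states, hence unitary. The answer bit is 0 again before each query because
    the memory starts blank. *)
Definition read_step (s : qbasis n w) : qbasis n w :=
  let: (i, b, z) := s in
  (ordS i, enum_val z i, enum_rank (bset (enum_val z) i b)).

Definition read_back (s : qbasis n w) : qbasis n w :=
  let: (i, b, z) := s in let j := ord_pred i in
  (j, enum_val z j, enum_rank (bset (enum_val z) j b)).

Lemma read_stepK : cancel read_step read_back.
Proof.
move=> [[i b] z]; rewrite /read_back /read_step ordSK enum_rankK ffunE eqxx.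
congr (_, _, _); rewrite -[RHS]enum_valK; congr enum_rank; apply/ffunP => j.
by rewrite !ffunE; case: eqP => [->|].
Qed.

Lemma read_backK : cancel read_back read_step.
Proof.
move=> [[i b] z]; rewrite /read_back /read_step ord_predK enum_rankK ffunE eqxx.
congr (_, _, _); rewrite -[RHS]enum_valK; congr enum_rank; apply/ffunP => j.
by rewrite !ffunE; case: eqP => [->|].
Qed.

Definition read_U (t : nat) : 'M[CC]_(qdim n w) :=
  if t is 0 then 1%:M else \matrix_(r, c) (enum_val r == read_step (enum_val c))%:R.

Lemma read_U_unitary t : read_U t \is unitarymx.
Proof.
case: t => [|t]; apply/unitarymxP; first by rewrite trmx1 map_mx1 mulmx1.
apply/matrixP => r r'; rewrite !mxE.
rewrite (bigD1 (enum_rank (read_back (enum_val r)))) //= big1 ?addr0 => [|c cr].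
  rewrite !mxE enum_rankK read_backK eqxx mul1r rmorph_nat (inj_eq enum_val_inj).
  by rewrite eq_sym.
rewrite !mxE; case: eqP => [e|_]; last by rewrite mul0r.
by rewrite e read_stepK enum_valK eqxx in cr.
Qed.

Definition read_start : qbasis n w := (ord0, false, enum_rank [ffun=> false]).

Definition read_split (s : qbasis n w) : ('I_(qdim n w) * 'I_1)%type := (enum_rank s, ord0).

Lemma read_split_bij : bijective read_split.
Proof.
exists (fun p : ('I_(qdim n w) * 'I_1)%type => enum_val p.1) => [s|[r z]].
  by rewrite enum_rankK.
by rewrite /read_split /= enum_valK (ord1 z).
Qed.

Definition read_alg : qalg n n :=
  @QAlg n n w read_U (fun t _ => read_U_unitary t) read_start (qdim n w) 1
    read_split read_split_bij.

Definition read_bits (x : bits n) t : bits n := [ffun i : 'I_n => (i < t)%N && x i].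

Lemma read_amp x t : (t < n)%N ->
  forall s, @amp _ _ read_alg x t s = (s == (inord t, false, enum_rank (read_bits x t)))%:R.
Proof.
elim: t => [|t IH] tn s.
  have -> : read_bits x 0 = [ffun=> false] by apply/ffunP => i; rewrite !ffunE.
  have -> : inord 0 = ord0 :> 'I_n by apply: val_inj; rewrite /= inordK.
  by rewrite /amp /= mul1mx mxE eqxx andbT (inj_eq enum_rank_inj).
rewrite ampS /Uapp (bigD1 (read_back s)) //= big1 ?addr0 => [|s' s's]; last first.
  rewrite mxE !enum_rankK; case: eqP => [e|_]; last by rewrite mul0r.
  by rewrite e read_stepK eqxx in s's.
rewrite mxE !enum_rankK read_backK eqxx mul1r IH ?(ltnW tn) //.
congr (_%:R); congr nat_of_bool.
have tI : inord t.+1 = ordS (inord t : 'I_n).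
  by apply: val_inj; rewrite /= !inordK ?(ltnW tn) // modn_small.
have -> : (s == (inord t.+1, false, enum_rank (read_bits x t.+1))) =
   (read_back s == read_back (inord t.+1, false, enum_rank (read_bits x t.+1))).
  by rewrite (can_eq read_backK).
have -> : (oracle_map x (read_back s) == (inord t, false, enum_rank (read_bits x t))) =
   (read_back s == oracle_map x (inord t, false, enum_rank (read_bits x t))).
  by rewrite -(can_eq (@oracle_mapK _ _ read_alg x)) oracle_mapK.
congr (_ == _); rewrite /read_back tI ordSK enum_rankK /= !ffunE inordK ?(ltnW tn) //.
rewrite ltnSn; congr (_, _, enum_rank _); apply/ffunP => i; rewrite !ffunE.
case: eqP => [->|/eqP it]; first by rewrite inordK ?ltnn // ltnW.
rewrite [(i < t.+1)%N]ltnS [(i <= t)%N]leq_eqVlt; have -> // : (i == t :> nat) = false.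
by apply/eqP => e; case/eqP: it; apply: val_inj; rewrite /= inordK // ltnW.
Qed.

(** The last query is treated apart because the position wraps around to 0. *)
Lemma read_ampT x s :
  @amp _ _ read_alg x n s = (s == (ord0, false, enum_rank x))%:R.
Proof.
rewrite ampS /Uapp (bigD1 (read_back s)) //= big1 ?addr0 => [|s' s's]; last first.
  rewrite mxE !enum_rankK; case: eqP => [e|_]; last by rewrite mul0r.
  by rewrite e read_stepK eqxx in s's.
rewrite mxE !enum_rankK read_backK eqxx mul1r read_amp //.
congr (_%:R); congr nat_of_bool.
have tI : ord0 = ordS (inord n' : 'I_n).
  by apply: val_inj; rewrite /= !inordK // modnn.
have -> : (s == (ord0, false, enum_rank x)) =
   (read_back s == read_back (ord0, false, enum_rank x)).
  by rewrite (can_eq read_backK).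
have -> : (oracle_map x (read_back s) == (inord n', false, enum_rank (read_bits x n'))) =
   (read_back s == oracle_map x (inord n', false, enum_rank (read_bits x n'))).
  by rewrite -(can_eq (@oracle_mapK _ _ read_alg x)) oracle_mapK.
congr (_ == _); rewrite /read_back tI ordSK enum_rankK /=.
congr (_, _, enum_rank _); apply/ffunP => i; rewrite !ffunE.
case: eqP => [->|/eqP it]; first by rewrite inordK ?ltnn.
have := ltn_ord i; rewrite ltnS leq_eqVlt => /orP[/eqP e|->] //.
by case/eqP: it; apply: val_inj; rewrite /= inordK.
Qed.
End ReadAll.

Lemma fro_le_trace_norm k (A : 'M[CC]_k) : fro A <= trace_norm A.
Proof.
have -> : fro A = fro (A *m svd_basis A).
  by rewrite -[RHS]fro_dag dagM fro_unitary ?fro_dag // dagK svd_unitaryr.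
have -> : fro (A *m svd_basis A) = Num.sqrt (\sum_i sigma A i ^+ 2).
  rewrite -[LHS](ger0_norm (fro_ge0 _)) -sqrtr_sqr fro_sq_sum; congr Num.sqrt.
  by apply: eq_bigr => i _; rewrite cl2_sq.
rewrite trace_normE.
have s0 i : 0 <= sigma A i by exact: cl2_ge0.
have S0 : 0 <= \sum_i sigma A i by apply: sumr_ge0.
apply: l2_le => //; rewrite expr2 mulr_suml; apply: ler_sum => i _.
rewrite expr2; apply: ler_wpM2l => //.
by rewrite (bigD1 i) //= lerDl; apply: sumr_ge0.
Qed.

Lemma read_alg_separates n' (D : {set bits n'.+1}) f : qa_separates D f (read_alg n').
Proof.
move=> x y xD yD fxy; rewrite /trace_dist.
have xy : x != y by apply: contraNneq fxy => ->.
(* Distinct inputs end in distinct basis states, so one diagonal entry of the difference is 1; the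
   trace distance is then at least 1/2. *)
set M := _ - _; suff H : 1 <= trace_norm M by lra.
apply: le_trans (fro_le_trace_norm M).
rewrite -ler_sqr ?nnegrE ?fro_ge0 // expr1n fro_sq_sum.
pose r := enum_rank (ord0, false, enum_rank x) : 'I_(qdim n'.+1 #|{: bits n'.+1}|).
rewrite (bigD1 r) //= (bigD1 r) //= -addrA -[leLHS]addr0; apply: lerD; last first.
  by rewrite addr_ge0 //; apply: sumr_ge0 => i _; rewrite ?cn2_ge0 // sumr_ge0 // => ? _; exact: cn2_ge0.
have outE z : qa_output (read_alg n') z r r = (z == x)%:R.
  rewrite qa_outputE mxE big_ord1 dagE.
  have -> : split_mx (read_alg n') z r ord0 = (z == x)%:R.
    have := @split_mxE _ _ (read_alg n') z (ord0, false, enum_rank x) => /= ->.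
    by rewrite read_ampT !xpair_eqE !eqxx (inj_eq enum_rank_inj) eq_sym.
  by rewrite rmorph_nat -natrM mulnb andbb.
have mB k (B C : 'M[CC]_k) i j : (B - C) i j = B i j - C i j by rewrite !mxE.
have yx : (y == x) = false by rewrite eq_sym (negbTE xy).
by rewrite /M mB (outE x) (outE y) eqxx yx subr0 cn21.
Qed.

Lemma QS_ge n (D : {set bits n}) f (c : RR) : (0 < n)%N ->
  (forall T (A : qalg n T), qa_separates D f A -> c <= T%:R) -> c <= QS D f.
Proof.
case: n D f => // n' D f _ H; apply: lb_le_inf.
  by exists n'.+1%:R, n'.+1; split => //; exists (read_alg n'); exact: read_alg_separates.
by move=> r [T [-> [A sA]]]; exact: H sA.
Qed.

(** * Degree of functions on the cube *)

Section Pdeg.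
Context {K : comNzRingType} {n : nat}.
Implicit Types (g h : bits n -> K) (d : nat).

(** Degree at most [d] as a function on the cube. Generation by one variable at a time gives the
    inductions that absorb variables one by one. The ring is a parameter because amplitudes are
    complex and approximating polynomials real. *)
Inductive pdeg : nat -> (bits n -> K) -> Prop :=
| pdeg_cst d c : pdeg d (fun=> c)
| pdeg_var d i g : pdeg d g -> pdeg d.+1 (fun x => (x i)%:R * g x)
| pdeg_add d g h : pdeg d g -> pdeg d h -> pdeg d (fun x => g x + h x).

Lemma pdeg_ext d g h : g =1 h -> pdeg d g -> pdeg d h.
Proof. by move=> /funext ->. Qed.

Lemma pdeg_leq d e g : (d <= e)%N -> pdeg d g -> pdeg e g.
Proof.
move=> + H; elim: H e => {d g} [d c|d i g _ IH|d g h _ IH1 _ IH2] e de.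
- exact: pdeg_cst.
- by case: e de => // e de; apply: pdeg_var; exact: IH.
- by apply: pdeg_add; [exact: IH1|exact: IH2].
Qed.

Lemma pdeg_scale d c g : pdeg d g -> pdeg d (fun x => c * g x).
Proof.
elim=> {d g} [d c'|d i g _ IH|d g h _ IH1 _ IH2].
- exact: pdeg_cst.
- by apply: pdeg_ext (pdeg_var i IH) => x /=; rewrite mulrCA.
- by apply: pdeg_ext (pdeg_add IH1 IH2) => x /=; rewrite mulrDr.
Qed.

Lemma pdegM d e g h : pdeg d g -> pdeg e h -> pdeg (d + e) (fun x => g x * h x).
Proof.
move=> H Hh; elim: H => {d g} [d c|d i g _ IH|d g g' _ IH1 _ IH2].
- by apply: pdeg_leq (pdeg_scale c Hh); exact: leq_addl.
- by apply: pdeg_ext (pdeg_var i IH) => x /=; rewrite mulrA.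
- by apply: pdeg_ext (pdeg_add IH1 IH2) => x /=; rewrite mulrDl.
Qed.

Lemma pdeg_bit i : pdeg 1 (fun x => (x i)%:R).
Proof. by apply: pdeg_ext (pdeg_var i (pdeg_cst 0 1)) => x /=; rewrite mulr1. Qed.

Lemma pdegN d g : pdeg d g -> pdeg d (fun x => - g x).
Proof. by move=> H; apply: pdeg_ext (pdeg_scale (-1) H) => x /=; rewrite mulN1r. Qed.

Lemma pdegB d g h : pdeg d g -> pdeg d h -> pdeg d (fun x => g x - h x).
Proof. by move=> H1 H2; exact: pdeg_add H1 (pdegN H2). Qed.

Lemma pdeg_sum d (J : Type) (r : seq J) (P : pred J) (F : J -> bits n -> K) :
  (forall j, P j -> pdeg d (F j)) -> pdeg d (fun x => \sum_(j <- r | P j) F j x).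
Proof.
move=> H; elim: r => [|j r IH].
  by apply: pdeg_ext (pdeg_cst d 0) => x; rewrite big_nil.
have [Pj|Pj] := boolP (P j); last by apply: pdeg_ext IH => x; rewrite big_cons (negbTE Pj).
by apply: pdeg_ext (pdeg_add (H j Pj) IH) => x; rewrite big_cons Pj.
Qed.

Lemma pdegX d e g : pdeg d g -> pdeg (e * d) (fun x => g x ^+ e).
Proof.
move=> H; elim: e => [|e IH]; first by apply: pdeg_ext (pdeg_cst _ 1) => x; rewrite expr0.
by rewrite mulSn; apply: pdeg_ext (pdegM H IH) => x /=; rewrite exprS.
Qed.

Definition setbit (x : bits n) i b : bits n := [ffun j => if j == i then b else x j].

Lemma setbitE (x : bits n) i b j : setbit x i b j = if j == i then b else x j.
Proof. by rewrite ffunE. Qed.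

(** Interpolation in one bit, [g = x_i (g_1 - g_0) + g_0], iterated over [l]. *)
Lemma pdeg_dep (l : seq 'I_n) g :
  (forall x y : bits n, (forall i, i \in l -> x i = y i) -> g x = g y) -> pdeg (size l) g.
Proof.
elim: l g => [|i l IH] g H.
  by apply: (@pdeg_ext _ (fun=> g [ffun=> false])); [move=> x; apply: H|exact: pdeg_cst].
have H' b : pdeg (size l) (fun x => g (setbit x i b)).
  apply: IH => x y xy; apply: H => j; rewrite inE !ffunE; case: eqP => //= _ jl.
  exact: xy.
have := pdeg_add (pdeg_var i (pdegB (H' true) (H' false))) (pdeg_leq (leqnSn _) (H' false)).
apply: pdeg_ext => x /=; have := fun b => congr1 (fun z => g z) (erefl (setbit x i b)).
have -> : g x = g (setbit x i (x i)).
  by congr g; apply/ffunP => j; rewrite ffunE; case: eqP => [->|].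
by case: (x i) => _ /=; rewrite ?mul1r ?mul0r ?add0r ?subrK.
Qed.
End Pdeg.

Lemma pdeg_conj n d (g : bits n -> CC) : @pdeg CC n d g -> @pdeg CC n d (fun x => Num.conj (g x)).
Proof.
elim=> {d g} [d c|d i g _ IH|d g h _ IH1 _ IH2].
- exact: pdeg_cst.
- by apply: pdeg_ext (pdeg_var i IH) => x /=; rewrite rmorphM rmorph_nat.
- by apply: pdeg_ext (pdeg_add IH1 IH2) => x /=; rewrite rmorphD.
Qed.

(** A query turns the amplitude at answer [b] into an interpolation by [x_i] between the amplitudes
    at [b] and [~~ b], which costs one degree; the unitaries take linear combinations. *)
Lemma pdeg_amp n T (A : qalg n T) t s : @pdeg CC n t (fun x => amp A x t s).
Proof.
elim: t s => [|t IH] s; first exact: (pdeg_cst _ (amp A [ffun=> false] 0 s)).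
apply: (@pdeg_ext _ _ _ (fun x => \sum_s' qa_U A t.+1 (enum_rank s) (enum_rank s') *
  amp A x t (oracle_map x s'))); first by move=> x; rewrite ampS.
apply: pdeg_sum => -[[i b] z] _; apply: pdeg_scale.
have := pdeg_add (pdeg_var i (pdegB (IH (i, ~~ b, z)) (IH (i, b, z)))) (pdeg_leq (leqnSn _) (IH (i, b, z))).
apply: pdeg_ext => x /=; case: (x i); case: b => /=;
  by rewrite ?mul1r ?mul0r ?add0r ?subrK.
Qed.

Lemma pdeg_qmass n T (A : qalg n T) t P :
  @pdeg CC n (t + t) (fun x => Complex (qmass A x t P) 0).
Proof.
have H : @pdeg CC n (t + t) (fun x => \sum_(s : qbasis n (qa_w A) | P s.1.1)
    amp A x t s * Num.conj (amp A x t s)).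
  apply: pdeg_sum => s _; apply: pdegM; first exact: pdeg_amp.
  by apply: (@pdeg_conj n t (fun x => amp A x t s)); exact: pdeg_amp.
apply: pdeg_ext H => x; rewrite /qmass complexr_sum.
by apply: eq_bigr => s _; rewrite cn2E.
Qed.

(** * Reed-Solomon codewords with a hidden cell *)

Section Embed.
Variables (J : finType) (n : nat) (iota : J -> 'I_n).
Hypothesis iota_inj : injective iota.

Definition embed (v : J -> bool) : bits n :=
  [ffun i => if [pick u | iota u == i] is Some u then v u else false].

Lemma embedE v u : embed v (iota u) = v u.
Proof.
rewrite ffunE; case: pickP => [u' /eqP/iota_inj -> //|/(_ u)]; by rewrite eqxx.
Qed.

Lemma embed_diff v v' i : embed v i != embed v' i -> exists2 u, i = iota u & v u != v' u.
Proof. by rewrite !ffunE; case: pickP => [u /eqP <-|]; [exists u|rewrite eqxx]. Qed.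

Lemma embed0 v i : (forall u, iota u != i) -> embed v i = false.
Proof. by move=> H; rewrite ffunE; case: pickP => // u; rewrite (negbTE (H u)). Qed.

Lemma embedP v i : (exists2 u, i = iota u & embed v i = v u) \/
  ((forall u, iota u != i) /\ embed v i = false).
Proof.
rewrite ffunE; case: pickP => [u /eqP <-|H]; first by left; exists u.
by right; split => // u; rewrite H.
Qed.
End Embed.

Section Code.
Variables (F : finFieldType) (s dg : nat) (pts : 'I_s -> F).
Hypothesis pts_inj : injective pts.
Local Notation msg := {ffun 'I_dg.+1 -> F}.
Local Notation word := {ffun 'I_s -> F}.

Definition msg_poly (a : msg) : {poly F} := \poly_(i < dg.+1) a (inord i).
Definition cw (a : msg) : word := [ffun j => (msg_poly a).[pts j]].
Definition top (a : msg) : F := a ord_max.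

Lemma coef_msg_poly a (i : 'I_dg.+1) : (msg_poly a)`_i = a i.
Proof. by rewrite coef_poly ltn_ord inord_val. Qed.

Lemma cw_agree a a' : a != a' -> (#|[set j | cw a j == cw a' j]| <= dg)%N.
Proof.
move=> aa'; set p := msg_poly a - msg_poly a'.
have p0 : p != 0.
  apply: contra aa' => /eqP p0; apply/eqP/ffunP => i.
  rewrite -!coef_msg_poly; apply/eqP; rewrite -subr_eq0 -coefB.
  by rewrite -/p p0 coef0.
have sp : (size p <= dg.+1)%N.
  by rewrite (leq_trans (size_polyD _ _)) // geq_max size_polyN !size_poly.
set S := [set j | _].
have := @max_poly_roots _ p [seq pts j | j <- enum S] p0.
rewrite size_map -cardE => H; rewrite -ltnS; apply: leq_trans sp; apply: H.
  apply/allP => x /mapP[j]; rewrite mem_enum inE !ffunE => /eqP e ->.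
  by rewrite /root /p hornerD hornerN e subrr.
by rewrite map_inj_uniq ?enum_uniq.
Qed.

(* Monic of degree [dg] and zero on [S]: adding a multiple of it changes the
   leading coefficient of a message but no symbol in [S]. *)
Definition shift_poly (S : {set 'I_s}) : {poly F} :=
  (\prod_(j in S) ('X - (pts j)%:P)) * 'X^(dg - #|S|).

Lemma shift_polyP (S : {set 'I_s}) : (#|S| <= dg)%N ->
  [/\ size (shift_poly S) = dg.+1, (shift_poly S)`_dg = 1
    & forall j, j \in S -> (shift_poly S).[pts j] = 0].
Proof.
move=> Sd.
have mon : shift_poly S \is monic by rewrite monicMl ?monicXn // monic_prod_XsubC.
have sz : size (shift_poly S) = dg.+1.
  rewrite /shift_poly size_Mmonic ?monicXn ?monic_neq0 ?monic_prod_XsubC //.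
  by rewrite size_polyXn -big_enum /= size_prod_XsubC -cardE addSn /= addnS subnKC.
split => //.
  by have /monicP := mon; rewrite lead_coefE sz.
move=> j jS; rewrite hornerM; apply/eqP; rewrite mulf_eq0; apply/orP; left.
by rewrite (bigD1 j) //= hornerM hornerXsubC subrr mul0r.
Qed.

Definition shift (S : {set 'I_s}) (c : F) (a : msg) : msg :=
  [ffun i : 'I_dg.+1 => a i + c * (shift_poly S)`_i].

Lemma shiftK S c : cancel (shift S c) (shift S (- c)).
Proof. by move=> a; apply/ffunP => i; rewrite !ffunE mulNr addrK. Qed.

Lemma shift_bij S c : bijective (shift S c).
Proof.
by exists (shift S (- c)); [exact: shiftK|move=> a; rewrite -[X in shift S X (shift _ _ _)](opprK c) shiftK].
Qed.

Lemma top_shift (S : {set 'I_s}) c a : (#|S| <= dg)%N -> top (shift S c a) = top a + c.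
Proof. by move=> /shift_polyP[_ h _]; rewrite /top ffunE /= h mulr1. Qed.

Lemma cw_shift (S : {set 'I_s}) c a j : (#|S| <= dg)%N -> j \in S -> cw (shift S c a) j = cw a j.
Proof.
move=> /shift_polyP[sz _ root] jS; rewrite !ffunE.
have -> : msg_poly (shift S c a) = msg_poly a + c *: shift_poly S.
  apply/polyP => i; rewrite coefD coefZ !coef_poly; case: ltnP => id.
    by rewrite ffunE inordK.
  by rewrite nth_default ?sz // mulr0 addr0.
by rewrite hornerD hornerZ root // mulr0 addr0.
Qed.

Definition depends_on (S : {set 'I_s}) (h : word -> CC) :=
  forall c c' : word, {in S, c =1 c'} -> h c = h c'.

(** Adding [(l' - l)] times the shift polynomial is a bijection from messages with leading
    coefficient [l] to those with [l'], and it fixes all symbols in [S]. *)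
Lemma hidden_top (S : {set 'I_s}) h l l' : (#|S| <= dg)%N -> depends_on S h ->
  \sum_(a | top a == l) h (cw a) = \sum_(a | top a == l') h (cw a).
Proof.
move=> Sd hS; rewrite [RHS](reindex (shift S (l' - l))); last first.
  by apply: onW_bij; exact: shift_bij.
apply: eq_big => [a|a _]; last by apply: hS => j jS; rewrite cw_shift.
rewrite top_shift //; apply/eqP/eqP => [->|e]; first by rewrite addrC subrK.
by apply: (addIr (l' - l)); rewrite e addrC subrK.
Qed.

Variables (t : nat) (enc : F -> {ffun 'I_t -> bool}).
Hypothesis enc_bij : bijective enc.
Local Notation J := ('I_s * 'I_t + F)%type.
Variables (n : nat) (iota : J -> 'I_n).
Hypothesis iota_inj : injective iota.

Definition code_input (c : word) (W : F -> bool) : bits n :=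
  embed iota (fun u => match u with inl p => enc (c p.1) p.2 | inr l => W l end).

Definition blank (a : msg) := code_input (cw a) (fun=> false).
Definition marked (a : msg) := code_input (cw a) (fun l => l == top a).

(** The statement carries a factor [h] depending on the symbols in [S] so that induction can absorb
    variables: a codeword bit goes into [h] at the price of one more symbol in [S], while table and
    padding bits vanish on blank inputs. The sum [#|S| + d] never grows. *)
Lemma hidden_pdeg d (g : bits n -> CC) (S : {set 'I_s}) h l l' : @pdeg CC n d g ->
  (#|S| + d <= dg)%N -> depends_on S h ->
  \sum_(a | top a == l) h (cw a) * g (blank a) =
  \sum_(a | top a == l') h (cw a) * g (blank a).
Proof.
move=> H; elim: H S h => {d g} [d c|d i g _ IH|d g g' _ IH1 _ IH2] S h Sd hS.
- by rewrite -!mulr_suml (hidden_top l l' _ hS) // (leq_trans _ Sd) ?leq_addr.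
- have [[u ui _]|[e0 _]] := embedP iota (fun=> false) i; last first.
    by rewrite !big1 // => a _; rewrite /blank /code_input embed0 // mul0r mulr0.
  case: u ui => [[j b]|f] ->; last first.
    by rewrite !big1 // => a _; rewrite /blank /code_input embedE // mul0r mulr0.
  have E a : h (cw a) * ((blank a (iota (inl (j, b))))%:R * g (blank a)) =
     (fun c : word => h c * (enc (c j) b)%:R) (cw a) * g (blank a).
    by rewrite /blank /code_input embedE //= mulrA.
  under eq_bigr do rewrite E; under [RHS]eq_bigr do rewrite E.
  apply: (IH (j |: S) (fun c : word => h c * (enc (c j) b)%:R)); first by rewrite (leq_trans _ Sd) // addnS -addSn leq_add2r cardsU1; case: (_ \notin _).
  move=> c c' cc'; rewrite (hS c c') => [|k kS]; last by apply: cc'; rewrite inE kS orbT.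
  by rewrite (cc' j) // setU11.
- under eq_bigr do rewrite mulrDr; under [RHS]eq_bigr do rewrite mulrDr.
  by rewrite !big_split /= (IH1 S h) // (IH2 S h).
Qed.

Lemma hidden_qmass T (A : qalg n T) u P l l' : (u + u <= dg)%N ->
  \sum_(a | top a == l) qmass A (blank a) u P =
  \sum_(a | top a == l') qmass A (blank a) u P.
Proof.
move=> ud; have := @hidden_pdeg _ _ finset.set0 (fun=> 1) l l' (pdeg_qmass A u P).
rewrite cards0 add0n => /(_ ud (fun _ _ _ => erefl)).
under eq_bigr do rewrite mul1r; under [in RHS]eq_bigr do rewrite mul1r.
by rewrite -!complexr_sum => -[].
Qed.

Variables (D : {set bits n}) (f : bits n -> bool).
Hypothesis blankD : forall a, blank a \in D.
Hypothesis markedD : forall a, marked a \in D.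
Hypothesis f_sep : forall a, f (blank a) != f (marked a).

(** By Cauchy-Schwarz every message has total mass at least [1 / (144 T)] on its own cell. Summed
    over messages, hiding bounds each query's contribution by a fraction [1 / #|F|] of their
    number. *)
Lemma code_query_bound T (A : qalg n T) : qa_separates D f A ->
  (2 * T <= dg)%N -> (#|F| <= 144 * T ^ 2)%N.
Proof.
move=> sepA Td; pose cell l : pred 'I_n := pred1 (iota (inr l)).
pose m l u a : RR := qmass A (blank a) u (cell l).
have m0 l u a : 0 <= m l u a by exact: qmass_ge0.
have step a : 1 / 144 <= T%:R * \sum_(u < T) m (top a) u a.
  have := separates_qmass sepA (blankD a) (markedD a) (f_sep a).
  have E u : qmass A (blank a) u (fun i => blank a i != marked a i) = m (top a) u a.
    apply: eq_bigl => -[[i b] z] /=; apply/idP/eqP => [|->].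
      rewrite /blank /marked => /embed_diff[[p -> /=|l -> /=]]; first by rewrite eqxx.
      by have [->|_] := eqVneq l (top a).
    by rewrite /blank /marked /code_input !embedE //= eqxx.
  under eq_bigr do rewrite E.
  move=> H; have := CauchySchwarz_sum (fun=> 1) (fun u : 'I_T => Num.sqrt (m (top a) u a)).
  under eq_bigr do rewrite mul1r.
  move=> /(le_trans H) {}H.
  have {}H : (1 / 12) ^+ 2 <= (l2 (fun _ : 'I_T => 1 : RR) * l2 (fun u : 'I_T => Num.sqrt (m (top a) u a))) ^+ 2.
    by rewrite lerXn2r // nnegrE ?mulr_ge0 ?l2_ge0 // divr_ge0.
  move: H; rewrite [leRHS]exprMn !l2_sq.
  under eq_bigr do rewrite expr1n.
  rewrite sumr_const card_ord.
  under eq_bigr do rewrite sqr_sqrtr //.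
  by move=> /(le_trans _); apply; lra.
set N0 := #|[pred a : msg | top a == 0]|.
have N0p : (0 < N0)%N by apply/card_gt0P; exists [ffun=> 0]; rewrite inE /top ffunE.
have Nl l : #|[pred a : msg | top a == l]| = N0.
  have := @hidden_top finset.set0 (fun=> 1) l 0.
  rewrite cards0 => /(_ isT (fun _ _ _ => erefl)); rewrite !sumr_const => /eqP.
  by rewrite eqr_nat => /eqP.
have tot : \sum_(a : msg) (1 / 144 : RR) = (#|F| * N0)%:R / 144.
  rewrite (partition_big top predT) //= (eq_bigr (fun=> N0%:R / 144)) => [|l _].
    by rewrite sumr_const -[LHS]mulr_natl natrM mulrA.
  by rewrite sumr_const Nl -[LHS]mulr_natl mul1r.
have : \sum_(a : msg) (1 / 144 : RR) <= \sum_a T%:R * \sum_(u < T) m (top a) u a.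
  by apply: ler_sum => a _; exact: step.
rewrite tot -mulr_sumr exchange_big /=.
have each (u : 'I_T) : \sum_a m (top a) u a <= N0%:R.
  rewrite (partition_big top predT) //=.
  (* Hiding moves all leading coefficients to 0. For a fixed message the cells [l] are now disjoint
     positions, whose masses sum to at most 1. *)
  rewrite (eq_bigr (fun l => \sum_(a | top a == 0) m l u a)) => [|l _]; last first.
    rewrite (eq_bigr (fun a => m l u a)) => [|a /eqP -> //].
    by apply: hidden_qmass; have := ltn_ord u; lia.
  rewrite exchange_big /= -[leRHS]mulr1 mulr_natl -sumr_const.
  apply: ler_sum => a _; rewrite /m /qmass.
  rewrite (exchange_big_dep predT) //=.
  rewrite -[leRHS](expr1n _ 2) -(cl2_amp A (blank a) (ltnW (ltn_ord u))) cl2_sq.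
  apply: ler_sum => -[[i b] z] _ /=; set v := cn2 _.
  have v0 : 0 <= v by exact: cn2_ge0.
  have [/existsP[l /eqP il]|] := boolP [exists l, i == iota (inr l)].
    rewrite (bigD1 l) /=; last by rewrite /cell /= il.
    rewrite big1 ?addr0 // => l' /andP[]; rewrite /cell /= il => /eqP/iota_inj[->].
    by rewrite eqxx.
  by rewrite negb_exists => /forallP H; rewrite big_pred0 // => l; exact: negbTE (H l).
have : \sum_(j < T) \sum_i m (top i) j i <= \sum_(j < T) N0%:R by apply: ler_sum.
rewrite sumr_const card_ord => H1 H2.
have {H1} := le_trans H2 (ler_wpM2l (ler0n _ T) H1).
rewrite -(mulr_natr (N0%:R : RR) T) => H.
have {H} : (#|F| * N0)%:R <= 144 * (T%:R * (N0%:R * T%:R)) :> RR by lra.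
rewrite -!natrM ler_nat => H; rewrite -(leq_pmul2r N0p) (leq_trans H) //.
by rewrite [(N0 * T)%N]mulnC [(T * (T * N0))%N]mulnA mulnA mulnn.
Qed.
End Code.

(** * The function reading the hidden cell, and its adversary weights *)

Lemma two_near (s a b c : nat) :
  (4 * a < s)%N -> (s <= c.*2)%N -> (c <= a + b)%N -> (4 * b < s)%N -> False.
Proof. by lia. Qed.

Section CodeFunction.
Variables (F : finFieldType) (s dg : nat) (pts : 'I_s -> F).
Hypothesis pts_inj : injective pts.
Variables (t : nat) (enc : F -> {ffun 'I_t -> bool}) (dec : {ffun 'I_t -> bool} -> F).
Hypotheses (encK : cancel enc dec) (decK : cancel dec enc).
Variables (n : nat) (iota : 'I_s * 'I_t + F -> 'I_n).
Hypothesis iota_inj : injective iota.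
Hypothesis dg_s : (dg.*2 <= s)%N.
Local Notation msg := {ffun 'I_dg.+1 -> F}.
Local Notation word := {ffun 'I_s -> F}.
Local Notation CW := (@cw F s dg pts).

Definition sym_bit j b : 'I_n := iota (inl (j, b)).
Definition cell_bit l : 'I_n := iota (inr l).

Definition word_of (x : bits n) : word := [ffun j => dec [ffun b => x (sym_bit j b)]].

Definition is_code (c : word) : bool := [exists a, c == CW a].

Definition secret (c : word) : F := if [pick a | c == CW a] is Some a then top a else 0.

Definition code_fun (x : bits n) : bool :=
  is_code (word_of x) && x (cell_bit (secret (word_of x))).

Definition code_dom : {set bits n} := [set x | is_code (word_of x)].

Definition hamming (c c' : word) : nat := #|[set j | c j != c' j]|.

Lemma hamming_sym c c' : hamming c c' = hamming c' c.
Proof. by apply: eq_card => j; rewrite !inE eq_sym. Qed.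

Lemma hamming_tri c c' c'' : (hamming c c'' <= hamming c c' + hamming c' c'')%N.
Proof.
rewrite /hamming (leq_trans _ (leq_card_setU _ _)) //; apply: subset_leq_card.
by apply/fintype.subsetP => j; rewrite !inE; case: (eqVneq (c j) (c' j)) => [->|].
Qed.

Lemma code_dist c c' : is_code c -> is_code c' -> c != c' -> (s <= (hamming c c').*2)%N.
Proof.
move=> /existsP[a /eqP ->] /existsP[a' /eqP ->] cc'.
have aa' : a != a' by apply: contra cc' => /eqP ->.
have := cw_agree pts_inj aa'.
have -> : hamming (CW a) (CW a') = (s - #|[set j | CW a j == CW a' j]|)%N.
  have C := cardsC [set j | CW a j == CW a' j].
  have -> : hamming (CW a) (CW a') = #|~: [set j | CW a j == CW a' j]|.
    by apply: eq_card => j; rewrite !inE.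
  by move: C; rewrite card_ord; lia.
move: dg_s; lia.
Qed.

Lemma cw_code a : is_code (CW a). Proof. by apply/existsP; exists a. Qed.

Lemma secret_cw a : (dg < s)%N -> secret (CW a) = top a.
Proof.
move=> ds; rewrite /secret; case: pickP => [a' /eqP e|/(_ a)]; last by rewrite eqxx.
have [->//|aa'] := eqVneq a a'; have := cw_agree pts_inj aa'.
have -> : [set j | CW a j == CW a' j] = finset.setT by apply/setP => j; rewrite !inE e eqxx.
by rewrite cardsT card_ord leqNgt ds.
Qed.

Lemma word_of_input c W : word_of (code_input enc iota c W) = c.
Proof.
apply/ffunP => j; rewrite ffunE -[RHS]encK; congr dec; apply/ffunP => b.
by rewrite ffunE /code_input embedE.
Qed.

Lemma cell_input c W l : code_input enc iota c W (cell_bit l) = W l.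
Proof. by rewrite /code_input embedE. Qed.

Lemma word_neq_bit x y j : word_of x j != word_of y j ->
  exists b, x (sym_bit j b) != y (sym_bit j b).
Proof.
move=> H; apply/existsP; apply: contraR H; rewrite negb_exists => /forallP H.
rewrite !ffunE; apply/eqP; congr dec; apply/ffunP => b; rewrite !ffunE.
by have := H b; rewrite negbK => /eqP.
Qed.

Lemma sym_bit_inj j b j' b' : sym_bit j b = sym_bit j' b' -> j = j' /\ b = b'.
Proof. by move=> /iota_inj[-> ->]. Qed.

Lemma code_fun_blank (a : msg) : code_fun (blank pts enc iota a) = false.
Proof. by rewrite /code_fun /blank word_of_input cell_input andbF. Qed.

Lemma code_fun_marked (a : msg) : (dg < s)%N -> code_fun (marked pts enc iota a) = true.
Proof.
by move=> ds; rewrite /code_fun /marked word_of_input cw_code cell_input secret_cw ?eqxx.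
Qed.

Lemma code_QS_bound (D : {set bits n}) (c : RR) : (0 < n)%N -> (dg < s)%N ->
  (forall a : msg, blank pts enc iota a \in D) -> (forall a : msg, marked pts enc iota a \in D) ->
  2 * c <= dg%:R -> 144 * c ^+ 2 <= #|F|%:R -> 0 <= c -> c <= QS D code_fun.
Proof.
move=> n0 ds bD mD c1 c2 c0; apply: QS_ge => // T A sepA.
have [Td|Td] := leqP (2 * T) dg; last first.
  rewrite -(ler_pM2l (ltr0n _ 2)) (le_trans c1) // -natrM ler_nat ltnW //.
have f_sep (a : msg) : code_fun (blank pts enc iota a) != code_fun (marked pts enc iota a).
  by rewrite code_fun_blank code_fun_marked.
have enc_bij : bijective enc by exists dec.
have := code_query_bound iota_inj bD mD f_sep sepA Td.
rewrite -(ler_nat RR) natrM natrX => /(le_trans c2).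
by rewrite ler_pM2l // ler_sqr ?nnegrE ?ler0n.
Qed.

Section Weights.
Variable g : bits n -> 'I_n -> RR.
Hypothesis g0 : forall x i, 0 <= g x i.

(** Each differing symbol contributes through one chosen differing bit, [pos j]; bits chosen for
    different symbols are different positions. *)
Lemma hamming_weight kap (x y : bits n) : 0 <= kap ->
  (forall j b, kap <= g x (sym_bit j b) * g y (sym_bit j b)) ->
  kap * (hamming (word_of x) (word_of y))%:R <= \sum_(i | x i != y i) g x i * g y i.
Proof.
move=> k0 H; pose pos j : option 'I_n :=
  omap (sym_bit j) [pick b | x (sym_bit j b) != y (sym_bit j b)].
rewrite /hamming -sum1_card natr_sum mulr_sumr mulr1.
have posP j : j \in [set j | word_of x j != word_of y j] ->
    exists b, pos j = Some (sym_bit j b) /\ x (sym_bit j b) != y (sym_bit j b).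
  rewrite inE => /word_neq_bit[b xb]; rewrite /pos; case: pickP => [b' xb'|/(_ b)].
    by exists b'.
  by rewrite xb.
apply: (@le_trans _ _ (\sum_(j in [set j | word_of x j != word_of y j])
    \sum_(i | (x i != y i) && (pos j == Some i)) g x i * g y i)).
  apply: ler_sum => j /posP[b [pj xb]].
  rewrite (bigD1 (sym_bit j b)) /=; last by rewrite xb pj eqxx.
  by rewrite (le_trans (H j b)) // lerDl sumr_ge0 // => i _; exact: mulr_ge0.
rewrite (exchange_big_dep (fun i => x i != y i)) //=; last by move=> j i _ /andP[].
apply: ler_sum => i xi.
have [/existsP[j0 /andP[j0S /eqP pj0]]|] :=
  boolP [exists j, (j \in [set j | word_of x j != word_of y j]) && (pos j == Some i)].
  rewrite (bigD1 j0) /=; last by rewrite j0S xi pj0 eqxx.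
  rewrite big1 ?addr0 // => j /andP[/and3P[jS _ /eqP pj] jj0].
  have [b [e _]] := posP j jS; have [b0 [e0 _]] := posP j0 j0S.
  move: e e0; rewrite pj pj0 => -[ei] [ei0]; move: ei; rewrite ei0 => /sym_bit_inj[e _].
  by rewrite e eqxx in jj0.
rewrite negb_exists => /forallP Hn; rewrite big_pred0 ?mulr_ge0 // => j.
by rewrite xi /=; exact: negbTE (Hn j).
Qed.

Lemma cell_weight (x y : bits n) l : x (cell_bit l) != y (cell_bit l) ->
  g x (cell_bit l) * g y (cell_bit l) <= \sum_(i | x i != y i) g x i * g y i.
Proof.
by move=> H; rewrite (bigD1 (cell_bit l)) //= lerDl sumr_ge0 // => i _; exact: mulr_ge0.
Qed.

Lemma bit_weight (x y : bits n) i : x i != y i ->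
  g x i * g y i <= \sum_(i | x i != y i) g x i * g y i.
Proof.
by move=> H; rewrite (bigD1 i) //= lerDl sumr_ge0 // => i' _; exact: mulr_ge0.
Qed.
End Weights.

Definition wt (u : 'I_s -> 'I_t -> RR) (v : F -> RR) (i : 'I_n) : RR :=
  if [pick p | iota p == i] is Some p then
    match p with inl q => u q.1 q.2 | inr l => v l end
  else 0.

Lemma wt_sym u v j b : wt u v (sym_bit j b) = u j b.
Proof. by rewrite /wt; case: pickP => [p /eqP/iota_inj -> //|/(_ (inl (j, b)))]; rewrite eqxx. Qed.

Lemma wt_cell u v l : wt u v (cell_bit l) = v l.
Proof. by rewrite /wt; case: pickP => [p /eqP/iota_inj -> //|/(_ (inr l))]; rewrite eqxx. Qed.

Lemma wt_ge0 u v i : (forall j b, 0 <= u j b) -> (forall l, 0 <= v l) -> 0 <= wt u v i.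
Proof. by move=> u0 v0; rewrite /wt; case: pickP => [[q|l]|]. Qed.

Lemma wt_sumsq u v : \sum_i wt u v i ^+ 2 =
  \sum_j \sum_b u j b ^+ 2 + \sum_l v l ^+ 2.
Proof.
rewrite (bigID (fun i => [exists p, iota p == i])) /= [X in _ + X]big1 ?addr0; last first.
  move=> i; rewrite negb_exists => /forallP H; rewrite /wt.
  by case: pickP => [p|_]; rewrite ?(negbTE (H p)) ?expr0n.
transitivity (\sum_(p : 'I_s * 'I_t + F) wt u v (iota p) ^+ 2); last first.
  rewrite big_sumType /=; congr (_ + _); last by apply: eq_bigr => l _; rewrite wt_cell.
  by rewrite pair_bigA; apply: eq_bigr => -[j b] _; rewrite wt_sym.
rewrite [RHS](partition_big iota (fun i => [exists p, iota p == i])) /=; last first.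
  by move=> p _; apply/existsP; exists p.
apply: eq_bigr => i /existsP[p /eqP <-].
by rewrite (eq_bigl (pred1 p)) ?big_pred1_eq // => q /=; rewrite (inj_eq iota_inj).
Qed.

Lemma code_dom_Adv : (0 < s)%N -> (dg < s)%N -> Adv code_dom code_fun <= 2 * t%:R + 1.
Proof.
(* With squared weight [2 / s], the at least [s / 2] symbols in which two codewords differ
   contribute 1, and all [s * t] codeword bits together cost [2 t]. *)
move=> s0 ds; pose gam : RR := Num.sqrt (2 / s%:R).
have gam2 : gam ^+ 2 = 2 / s%:R by rewrite sqr_sqrtr ?divr_ge0.
have gam0 : 0 <= gam by exact: sqrtr_ge0.
pose g x := wt (fun _ _ => gam) (fun l => (l == secret (word_of x))%:R).
have g0 x i : 0 <= g x i by apply: wt_ge0.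
have U0 : 0 <= 2 * t%:R + 1 :> RR by rewrite addr_ge0 ?mulr_ge0.
apply: (@Adv_le _ _ _ g) => //.
  move=> x _; rewrite wt_sumsq.
  rewrite (bigD1 (secret (word_of x))) //= eqxx [X in _ + (_ + X)]big1 ?addr0; last first.
    by move=> l /negbTE ->; rewrite expr0n.
  rewrite expr1n lerD2r gam2 !sumr_const !card_ord -mulrnA -[leLHS]mulr_natr natrM.
  by rewrite [_ * s%:R]mulrC mulrA divfK // pnatr_eq0 -lt0n.
move=> x y; rewrite !inE => xD yD fxy.
have [e|xy] := eqVneq (word_of x) (word_of y).
  have xyl : x (cell_bit (secret (word_of x))) != y (cell_bit (secret (word_of x))).
    by move: fxy; rewrite /code_fun xD yD -e.
  apply: le_trans (cell_weight g0 xyl).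
  by rewrite /g !wt_cell -e eqxx mulr1.
apply: le_trans (hamming_weight g0 (_ : 0 <= gam ^+ 2) _); rewrite ?sqr_ge0 //.
  have := code_dist xD yD xy; rewrite -(ler_nat RR) -muln2 natrM gam2 => H.
  by rewrite mulrAC ler_pdivlMr ?ltr0n // mul1r mulrC.
by move=> j b; rewrite /g !wt_sym expr2.
Qed.

Definition err_bit (c0 : word) (x : bits n) : option ('I_s * 'I_t) :=
  [pick p | x (sym_bit p.1 p.2) != enc (c0 p.1) p.2].

Definition near_code (c : word) : option word :=
  [pick c0 | is_code c0 && (4 * hamming c0 c < s)%N].

(* A word close to a codeword [c0] differs little from it, so one erroneous bit
   is given a large weight to witness the difference. *)
Definition special (x : bits n) : option ('I_s * 'I_t) :=
  if is_code (word_of x) then None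
  else if near_code (word_of x) is Some c0 then err_bit c0 x else None.

(** Codeword bits have squared weight [1 / R] with [R = sqrt s]. Words at distance at least [s / 4]
    are separated by [R / 4 >= 1], at cost [R t]. For a non-codeword close to the codeword it is
    compared with, which is unique by [two_near], the special bit of weight [gam^-1] meets weight
    [gam] and gives exactly 1, at extra cost [R]. *)
Lemma code_total_Adv : (16 <= s)%N -> (dg < s)%N -> (0 < t)%N ->
  Adv [set: bits n] code_fun <= 3 * (Num.sqrt s%:R * t%:R).
Proof.
move=> s16 ds t0; set R := Num.sqrt (s%:R : RR).
have R4 : 4 <= R.
  have -> : 4 = Num.sqrt (4 ^+ 2) :> RR by rewrite sqrtr_sqr ger0_norm.
  by rewrite ler_wsqrtr // -natrX ler_nat.
have R0 : 0 < R by lra.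
have RR2 : R ^+ 2 = s%:R by rewrite sqr_sqrtr.
pose gam : RR := Num.sqrt R^-1.
have gam2 : gam ^+ 2 = R^-1 by rewrite sqr_sqrtr ?invr_ge0 // ltW.
have gam0 : 0 < gam by rewrite sqrtr_gt0 invr_gt0.
have gam1 : gam <= gam^-1.
  rewrite -div1r ler_pdivlMr // -expr2 gam2 invf_le1 //; lra.
pose u x j b := if special x == Some (j, b) then gam^-1 else gam.
pose v x l : RR := (is_code (word_of x) && (l == secret (word_of x)))%:R.
pose g x := wt (u x) (v x).
have u0 x j b : gam <= u x j b by rewrite /u; case: ifP.
have g0 x i : 0 <= g x i.
  by apply: wt_ge0 => [j b|l]; rewrite ?ler0n // (le_trans (ltW gam0)).
have far x y : (s <= 4 * hamming (word_of x) (word_of y))%N ->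
    1 <= \sum_(i | x i != y i) g x i * g y i.
  move=> H; apply: le_trans (hamming_weight g0 (_ : 0 <= gam ^+ 2) _); rewrite ?sqr_ge0 //.
    rewrite gam2 mulrC ler_pdivlMr // mul1r.
    move: H; rewrite -(ler_nat RR) natrM -RR2; nra.
  by move=> j b; rewrite /g !wt_sym expr2 ler_pM ?(ltW gam0).
have sepw x y : code_fun x -> ~~ code_fun y -> 1 <= \sum_(i | x i != y i) g x i * g y i.
  move=> /andP[xC xl] fy.
  have [yC|yC] := boolP (is_code (word_of y)).
    have [e|xy] := eqVneq (word_of x) (word_of y).
      have xyl : x (cell_bit (secret (word_of x))) != y (cell_bit (secret (word_of x))).
        by move: fy; rewrite /code_fun yC -e xl /=; case: (y _).
      apply: le_trans (cell_weight g0 xyl).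
      by rewrite /g !wt_cell /v xC -e xC eqxx mulr1.
    by apply: far; have := code_dist xC yC xy; lia.
  have [near|] := ltnP (4 * hamming (word_of x) (word_of y)) s; last exact: far.
  have sp : near_code (word_of y) = Some (word_of x).
    rewrite /near_code; case: pickP => [c0 /andP[c0C c0n]|/(_ (word_of x))]; last by rewrite xC near.
    congr Some; apply/eqP; apply: contraT => c0x.
    have := hamming_tri c0 (word_of y) (word_of x).
    rewrite [hamming (word_of y) _]hamming_sym => tri.
    by case: (two_near c0n (code_dist c0C xC c0x) tri near).
  have [[j b] pjb xyb] : exists2 p, special y = Some p & x (sym_bit p.1 p.2) != y (sym_bit p.1 p.2).
    have xE j b : enc (word_of x j) b = x (sym_bit j b) by rewrite ffunE decK ffunE.
    have : word_of x != word_of y by apply: contraNneq yC => <-.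
    move=> /eqP xy; rewrite /special (negbTE yC) sp /err_bit; case: pickP => [p Hp|Hn].
      by exists p => //; rewrite eq_sym -xE.
    case: xy; apply/ffunP => j; apply/eqP; apply: contraT => /word_neq_bit[b].
    by have := Hn (j, b); rewrite /= xE eq_sym => ->.
  apply: le_trans (bit_weight g0 xyb); rewrite /g !wt_sym /= {2}/u pjb eqxx.
  by rewrite -ler_pdivrMr ?invr_gt0 // invrK mul1r.
have U0 : 0 <= 3 * (R * t%:R) :> RR by rewrite !mulr_ge0 ?(ltW R0).
apply: (@Adv_le _ _ _ g) => //.
  move=> x _; rewrite wt_sumsq.
  have v1 : \sum_l v x l ^+ 2 <= 1.
    rewrite (bigD1 (secret (word_of x))) //= [X in _ + X]big1 ?addr0.
      by rewrite /v; case: (is_code _ && _); rewrite ?expr1n ?expr0n.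
    by move=> l /negbTE ln; rewrite /v ln andbF expr0n.
  have u1 : \sum_j \sum_b u x j b ^+ 2 <= R * t%:R + R.
    rewrite pair_bigA /=.
    have -> : R * t%:R + R = \sum_(p : 'I_s * 'I_t) gam ^+ 2 + R.
      rewrite sumr_const card_prod !card_ord gam2; congr (_ + _).
      by rewrite -[RHS]mulr_natl natrM -RR2 expr2; field; rewrite gt_eqF.
    rewrite -lerBlDl -sumrB.
    case E: (special x) => [p|]; last first.
      by rewrite big1 ?(ltW R0) // => q _; rewrite /u E subrr.
    rewrite (bigD1 p) //= big1 => [|q qp].
      by rewrite /u E -surjective_pairing eqxx exprVn gam2 invrK addr0 gerBl invr_ge0 ltW.
    rewrite /u E -surjective_pairing; case: eqP => [[e]|_]; last by rewrite subrr.
    by rewrite e eqxx in qp.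
  have t1 : 1 <= t%:R :> RR by rewrite ler1n.
  nra.
move=> x y _ _; case fx: (code_fun x); case fy: (code_fun y) => // _.
  by apply: sepw; rewrite ?fx ?fy.
have := sepw y x; rewrite fx fy => /(_ isT isT); congr (_ <= _).
by apply: eq_big => i; rewrite 1?eq_sym // => _; rewrite mulrC.
Qed.
End CodeFunction.

(** Constant weight 1 is a scheme of cost [n] for every function, so the set of ratios is bounded
    and its supremum is an upper bound rather than a default value. *)
Lemma adv_ratio_le_Adv n (D : {set bits n}) f (G : 'M[RR]_#|D|) :
  adv_matrix f G -> adv_ratio G <= Adv D f.
Proof.
apply: (@Adv_ratio_le_Adv _ _ _ (fun _ _ => 1) n%:R) => //.
  by move=> x _; rewrite (eq_bigr (fun=> 1)) ?sumr_const ?card_ord // => i _; rewrite expr1n.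
move=> x y _ _ fxy.
have /existsP[i xy] : [exists i, x i != y i].
  apply: contraR fxy; rewrite negb_exists => /forallP H.
  by apply/eqP; congr f; apply/ffunP => i; apply/eqP; have := H i; rewrite negbK.
rewrite (bigD1 i) //= mulr1 lerDl; by apply: sumr_ge0 => j _; rewrite ?mulr1.
Qed.

Lemma card_eq_bij (T T' : finType) : #|T| = #|T'| ->
  exists2 f : T -> T', exists g, cancel f g & forall g, cancel f g -> cancel g f.
Proof.
move=> e; exists (fun x => enum_val (cast_ord e (enum_rank x))).
  exists (fun y => enum_val (cast_ord (esym e) (enum_rank y))) => x.
  by rewrite enum_valK cast_ordK enum_rankK.
move=> g fK y.
have -> : y = enum_val (cast_ord e (enum_rank (enum_val (cast_ord (esym e) (enum_rank y))))).
  by rewrite enum_valK cast_ordKV enum_rankK.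
by rewrite fK.
Qed.

Lemma card_le_inj (T T' : finType) : (#|T| <= #|T'|)%N -> exists f : T -> T', injective f.
Proof.
move=> e; exists (fun x => enum_val (widen_ord e (enum_rank x))) => x y /enum_val_inj/eqP.
by rewrite -val_eqE /= => /eqP/val_inj/enum_rank_inj.
Qed.

Lemma adv_star_bound n (f : bits n -> bool) (s : nat) (x : bits n) (z : 'I_s -> bits n) :
  (0 < s)%N -> (forall j, f x != f (z j)) ->
  (forall i j j', x i != z j i -> x i != z j' i -> j = j') ->
  Num.sqrt s%:R <= Adv [set: bits n] f.
Proof.
move=> s0 fxz disj.
pose X : 'I_#|[set: bits n]| := enum_rank_in (finset.in_setT x) x.
pose Z j : 'I_#|[set: bits n]| := enum_rank_in (finset.in_setT x) (z j).
have XE : dpt X = x by rewrite /dpt enum_rankK_in ?finset.in_setT.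
have ZE j : dpt (Z j) = z j by rewrite /dpt enum_rankK_in ?finset.in_setT.
have fXZ j : f (dpt X) != f (dpt (Z j)) by rewrite XE ZE.
have dXZ i j j' : dpt X i != dpt (Z j) i -> dpt X i != dpt (Z j') i -> j = j'.
  by rewrite XE !ZE; exact: disj.
exact: le_trans (star_ratio s0 fXZ dXZ) (adv_ratio_le_Adv (star_adv s0 fXZ)).
Qed.

(** * Choice of the code parameters *)

Lemma ln2_ge : 1 / 2 <= ln 2 :> RR.
Proof.
have := @le_ln1Dx RR (- (1 / 2)); have -> : 1 + - (1 / 2) = 2^-1 :> RR by field.
by rewrite lnV ?posrE //; lra.
Qed.

Lemma ln_pow2 r : r%:R / 2 <= ln (2 ^ r)%:R :> RR.
Proof.
rewrite natrX lnXn // -[leRHS]mulr_natl; have := ln2_ge; have := ler0n RR r; nra.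
Qed.

Section CodeInstance.
Variables (e s n : nat).
Hypotheses (e0 : (0 < e)%N) (s0 : (1 < s)%N) (se : (s <= 2 ^ e)%N).
Hypothesis sn : (s * e + 2 ^ e <= n)%N.

Lemma code_instance :
  exists (D : {set bits n}) (h : bits n -> bool),
  [/\ forall c : RR, 0 <= c -> 2 * c <= s./2%:R -> 144 * c ^+ 2 <= (2 ^ e)%:R ->
        c <= QS D h /\ c <= QS [set: bits n] h,
      Adv D h <= 2 * e%:R + 1,
      (16 <= s)%N -> Adv [set: bits n] h <= 3 * (Num.sqrt s%:R * e%:R)
    & (16 <= s)%N -> Num.sqrt s%:R <= Adv [set: bits n] h].
Proof.
have [F _ cF] := finfield.pPrimePowerField (isT : prime 2) e0.
have [pts pts_inj] : exists pts : 'I_s -> F, injective pts.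
  by apply: card_le_inj; rewrite card_ord cF.
have [enc [dec encK] /(_ _ encK) decK] : exists2 f : F -> {ffun 'I_e -> bool},
    exists g, cancel f g & forall g, cancel f g -> cancel g f.
  by apply: card_eq_bij; rewrite cF card_ffun card_bool card_ord.
have [iota iota_inj] : exists iota : ('I_s * 'I_e + F) -> 'I_n, injective iota.
  by apply: card_le_inj; rewrite card_sum card_prod !card_ord cF.
pose dg := s./2.
have dgs : (dg.*2 <= s)%N by rewrite /dg; lia.
have dg_s : (dg < s)%N by rewrite /dg; lia.
have n0 : (0 < n)%N by have := expn_gt0 2 e; lia.
pose h := code_fun dg pts dec iota; pose D := code_dom dg pts dec iota.
exists D, h; split.
- move=> c c0 c1 c2; have c2' : 144 * c ^+ 2 <= #|F|%:R by rewrite cF.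
  have inD w W : is_code dg pts w -> code_input enc iota w W \in D.
    by move=> H; rewrite inE word_of_input.
  have Q D' := @code_QS_bound F s dg pts pts_inj e enc dec encK decK n iota iota_inj D' c n0 dg_s.
  split; apply: Q => // a; rewrite ?finset.in_setT //.
    by apply: inD; exact: cw_code.
  by apply: inD; exact: cw_code.
- by rewrite /h /D; apply: code_dom_Adv => //; exact: ltnW.
- by move=> s16; rewrite /h; apply: (@code_total_Adv _ _ _ _ _ _ enc) => //.
move=> s16; pose a0 : {ffun 'I_dg.+1 -> F} := [ffun=> 0].
have [x hx] : exists x, h x.
  by exists (marked pts enc iota a0); rewrite /h code_fun_marked.
pose b0 : 'I_e := Ordinal e0.
(* Changing one bit of symbol [j] leaves the code, as codewords are at distance at least [s / 2];
   the function drops to 0. This gives [s] disjoint blocks at [x]. *)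
pose z j : bits n := setbit x (sym_bit iota j b0) (~~ x (sym_bit iota j b0)).
have xz j i : (x i != z j i) = (i == sym_bit iota j b0).
  by rewrite /z setbitE; have [->|_] := eqVneq i (sym_bit iota j b0); [case: (x _)|rewrite eqxx].
have hz j : ~~ h (z j).
  apply/negP => /andP[zC _].
  have xC : is_code dg pts (word_of dec iota x) by case/andP: hx.
  have nj k : (word_of dec iota x k != word_of dec iota (z j) k) -> k = j.
    by move=> /(word_neq_bit)[b]; rewrite xz => /eqP/(sym_bit_inj iota_inj)[].
  have jj : word_of dec iota x j != word_of dec iota (z j) j.
    rewrite !ffunE (can_eq decK); apply/eqP => /ffunP/(_ b0).
    by rewrite ffunE [RHS]ffunE; apply/eqP; rewrite xz.
  have := code_dist pts_inj dgs xC zC; rewrite /hamming.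
  have -> : [set k | word_of dec iota x k != word_of dec iota (z j) k] = [set j].
    by apply/setP => k; rewrite !inE; apply/idP/eqP => [/nj //|->].
  rewrite cards1 => H; have : word_of dec iota x != word_of dec iota (z j).
    by apply: contraNneq jj => ->.
  by move=> /H; lia.
apply: (@adv_star_bound _ _ _ x z) => [|j|i j j']; first exact: ltnW.
  by rewrite hx (negbTE (hz j)).
by rewrite !xz => /eqP -> /eqP/(sym_bit_inj iota_inj)[].
Qed.
End CodeInstance.

(** The field has [s ^ 2] elements: the limits [dg / 2 = s / 4] and [sqrt #|F| / 12 = s / 12] are
    then of one order, while the adversary bound is [sqrt s] up to a logarithm. Its lower bound
    serves both divergence and the logarithm in the denominator. *)
Lemma QS_Adv_square_family :
  exists (N : nat -> nat) (F : forall k : nat, bits (N k) -> bool),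
     (forall M : RR, exists k0 : nat, forall k : nat, (k0 <= k)%N ->
        M <= Adv [set: bits (N k)] (F k)) /\
     (exists (c : nat) (K : RR) (k0 : nat), 0 < K /\
        forall k : nat, (k0 <= k)%N ->
          K * (Adv [set: bits (N k)] (F k) ^+ 2)
            / (ln (Adv [set: bits (N k)] (F k) ^+ 2)) ^+ c
          <= QS [set: bits (N k)] (F k)).
Proof.
pose r k := (k + 4)%N; pose s k := (2 ^ r k)%N; pose e k := (2 * r k)%N.
pose N k := (s k * e k + 2 ^ e k)%N.
have s16 k : (16 <= s k)%N by rewrite (@leq_pexp2l 2 4) // /r leq_addl.
have H k : exists h : bits (N k) -> bool,
   [/\ (s k)%:R / 12 <= QS [set: bits (N k)] h,
     Adv [set: bits (N k)] h <= 3 * (Num.sqrt (s k)%:R * (e k)%:R)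
     & Num.sqrt (s k)%:R <= Adv [set: bits (N k)] h].
  have [||||D [h [q _ a b]]] := @code_instance (e k) (s k) (N k) => //.
  - by rewrite /e /r; lia.
  - exact: leq_trans (s16 k).
  - by rewrite leq_exp2l // /e; lia.
  exists h; split; [|exact: a|exact: b].
  have [] // := q ((s k)%:R / 12).
    have : (s k)%:R = (s k)./2%:R * 2 :> RR.
      by rewrite -natrM muln2 /s /r addnS expnS mul2n doubleK.
    by have := s16 k; rewrite -(ler_nat RR) => ? ?; lra.
  rewrite /e mulnC expnM natrX -/(s k) exprMn exprVn.
  have -> : 12 ^+ 2 = 144 :> RR by ring.
  lra.
pose F k := projT1 (cid (H k)).
have HF k : [/\ (s k)%:R / 12 <= QS [set: bits (N k)] (F k),
     Adv [set: bits (N k)] (F k) <= 3 * (Num.sqrt (s k)%:R * (e k)%:R)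
     & Num.sqrt (s k)%:R <= Adv [set: bits (N k)] (F k)] by exact: projT2 (cid (H k)).
exists N, F; split.
  move=> M; exists (Num.truncn (M ^+ 2)).+1 => k kM.
  have [_ _] := HF k; apply: le_trans.
  have [M0|M0] := lerP M 0; first by rewrite (le_trans M0) ?sqrtr_ge0.
  rewrite -(ger0_norm (ltW M0)) -sqrtr_sqr ler_wsqrtr //.
  rewrite (le_trans (ltW (truncnS_gt _))) // ler_nat (leq_trans kM) //.
  by rewrite /s /r (leq_trans (leq_addr 4 k)) // ltnW // ltn_expl.
(* From [A ^ 2 <= 36 r ^ 2 s] and [ln (A ^ 2) >= r / 2], compared with
   [(s / 12) (r / 2) ^ 2 = s r ^ 2 / 48]: the constant is [36 * 48 = 1728]. *)
exists 2%N, (1 / 1728), 0%N; split; first by rewrite divr_gt0 ?ltr01 ?ltr0n.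
move=> k _; have [q a b] := HF k; apply: le_trans q.
set A := Adv _ _ in a b *.
have S0 : 0 <= Num.sqrt (s k)%:R :> RR by exact: sqrtr_ge0.
have A0 : 0 <= A by exact: le_trans b.
have Ss : Num.sqrt (s k)%:R ^+ 2 = (s k)%:R :> RR by rewrite sqr_sqrtr.
have sA : (s k)%:R <= A ^+ 2 by rewrite -Ss ler_sqr ?nnegrE.
have As : A ^+ 2 <= 36 * (r k)%:R ^+ 2 * (s k)%:R.
  have -> : 36 * (r k)%:R ^+ 2 * (s k)%:R = (3 * (Num.sqrt (s k)%:R * (e k)%:R)) ^+ 2 :> RR.
    by rewrite !exprMn Ss /e natrM; ring.
  by rewrite ler_sqr ?nnegrE // !mulr_ge0.
have s_gt0 : 0 < (s k)%:R :> RR by rewrite ltr0n (leq_trans _ (s16 k)).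
have lnA : (r k)%:R / 2 <= ln (A ^+ 2).
  by rewrite (le_trans (ln_pow2 (r k))) // ler_ln ?posrE // (lt_le_trans s_gt0).
have r0 : 0 < (r k)%:R :> RR by rewrite ltr0n /r addnS.
have l0 : 0 < ln (A ^+ 2) by apply: lt_le_trans lnA; rewrite divr_gt0.
rewrite ler_pdivrMr ?exprn_gt0 //.
have l2 : ((r k)%:R / 2) ^+ 2 <= ln (A ^+ 2) ^+ 2.
  by rewrite ler_sqr ?nnegrE // ltW // divr_gt0.
apply: (@le_trans _ _ ((s k)%:R / 12 * ((r k)%:R / 2) ^+ 2)); last first.
  by apply: ler_wpM2l => //; rewrite divr_ge0.
by nra.
Qed.

(** With as many points as field elements, [2 ^ t] is about [n / log n] and the code gives a bound
    of order [sqrt (2 ^ t)], that is nearly [sqrt n]; the exponent is relaxed to [1 / 3] only at the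
    end. *)
Lemma QS_Adv_partial_family :
  exists (c : nat) (K1 K2 : RR) (n0 : nat), 0 < K1 /\
     forall n : nat, (n0 <= n)%N ->
       exists (D : {set bits n}) (h : bits n -> bool),
         K1 * powR (n%:R) (1 / 3) / (ln (n%:R)) ^+ c <= QS D h /\
         Adv D h <= K2 * ln (n%:R).
Proof.
exists 1%N, (1 / 72), 5, (2 ^ 10)%N; split; first by rewrite divr_gt0.
(* [2 ^ l] exceeds [L + 1], so the [2 ^ t * (t + 1)] bits fit into [2 ^ L <= n]; it is at most
   [2 (L + 1)], so only a logarithmic factor is lost. *)
move=> n n0; pose L := trunc_log 2 n; pose l := (trunc_log 2 L.+1).+1; pose t := (L - l)%N.
have npos : (0 < n)%N by apply: leq_trans n0; rewrite expn_gt0.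
have L10 : (10 <= L)%N by apply: trunc_log_max.
have /andP[Ln nL] := trunc_log_bounds (isT : 1 < 2)%N npos.
have /andP[lL Ll] := trunc_log_bounds (isT : 1 < 2)%N (isT : 0 < L.+1)%N.
rewrite -/L -/l in Ln nL lL Ll.
have lt_l : (l < L)%N.
  rewrite /l; apply: (@leq_trans (trunc_log 2 (2 ^ (L - 2))).+2).
    rewrite !ltnS; apply: leq_trunc_log.
    have -> : L = (L - 10 + 10)%N by lia.
    elim: (L - 10)%N => [|i IH] //.
    have -> : (i.+1 + 10 - 2 = (i + 10 - 2).+1)%N by lia.
    by rewrite expnS; move: IH; lia.
  by rewrite trunc_expnK //; lia.
have tL : (t + l = L)%N by rewrite /t subnK // ltnW.
have t0 : (0 < t)%N by rewrite /t subn_gt0.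
have sn : (2 ^ t * t + 2 ^ t <= n)%N.
  apply: leq_trans Ln; rewrite -mulnSr -tL expnD leq_mul2l ltnW ?orbT //.
  by apply: leq_ltn_trans Ll; rewrite /t; lia.
have [||||D [h [q a _ _]]] := @code_instance t (2 ^ t) n => //.
  by rewrite -{1}(expn0 2) ltn_exp2l.
exists D, h.
have ln0 : 1 <= ln n%:R :> RR.
  rewrite (le_trans _ (_ : ln (2 ^ 2)%:R <= _)) //; last first.
    by rewrite ler_ln ?posrE ?ltr0n // ler_nat (leq_trans _ n0).
  by have := ln_pow2 2; rewrite mulfV.
have Lln : L%:R <= 2 * ln n%:R :> RR.
  have := ln_pow2 L.
  have : ln (2 ^ L)%:R <= ln n%:R :> RR by rewrite ler_ln ?posrE ?ltr0n ?expn_gt0 // ler_nat.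
  lra.
split; last first.
  apply: (le_trans a); have : t%:R <= L%:R :> RR by rewrite ler_nat leq_subr.
  lra.
set s : RR := (2 ^ t)%:R.
have s1 : 2 <= s by rewrite /s -[2]/(2%:R) ler_nat -{1}(expn1 2) leq_exp2l.
set S := Num.sqrt s; have S0 : 0 <= S by exact: sqrtr_ge0.
have Ss : S ^+ 2 = s by rewrite sqr_sqrtr //; lra.
have S1 : 1 <= S by rewrite -sqrtr1 ler_wsqrtr //; lra.
have [|||qD _] := q (S / 12).
- by rewrite divr_ge0.
- have -> : ((2 ^ t)./2)%:R = s / 2.
    rewrite /s -(prednK t0) expnS mul2n doubleK -muln2 natrM mulfK //.
  by nra.
- by rewrite exprMn exprVn Ss -/s; lra.
apply: le_trans qD; rewrite expr1 ler_pdivrMr ?(lt_le_trans ltr01) //.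
have nS : n%:R <= (6 * S * ln n%:R) ^+ 2.
  apply: (@le_trans _ _ (s * (4 * (L%:R + 1)))).
    rewrite /s natr1 -natrM -natrM ler_nat ltnW // (leq_trans nL) //.
    by rewrite expnS -tL expnD; move: lL; rewrite /l expnS; nia.
  rewrite !exprMn Ss; have -> : 6 ^+ 2 * s * ln n%:R ^+ 2 = s * (36 * ln n%:R ^+ 2) by ring.
  by apply: ler_wpM2l; [lra|nra].
have pn : powR n%:R (1 / 3) <= 6 * S * ln n%:R.
  apply: (@le_trans _ _ (powR n%:R (2^-1))).
    apply: ler_powR; first by rewrite ler1n.
    by rewrite div1r lef_pV2 ?posrE // ler_nat.
  rewrite powR12_sqrt //.
  have l0 : 0 <= 6 * S * ln n%:R by rewrite !mulr_ge0 //; lra.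
  by rewrite -(ger0_norm l0) -sqrtr_sqr ler_wsqrtr.
by move: pn; lra.
Qed.

(** * Approximate degree *)

Import (canonicals) mpoly.

Lemma pdeg_prod n (J : Type) (s : seq J) (e : J -> nat) (g : J -> bits n -> RR) :
  (forall j, @pdeg RR n (e j) (g j)) ->
  @pdeg RR n (\sum_(j <- s) e j) (fun x : bits n => \prod_(j <- s) g j x).
Proof.
move=> H; elim: s => [|j s IH].
  by apply: pdeg_ext (pdeg_cst _ 1) => x; rewrite big_nil.
by rewrite big_cons; apply: pdeg_ext (pdegM (H j) IH) => x; rewrite big_cons.
Qed.

Section MPolyBridge.
Variable n : nat.
Implicit Types (g : bits n -> RR) (p : mpoly.mpoly n RR).

Definition mval (x : bits n) : 'I_n -> RR := fun i => (x i)%:R.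

Lemma pdeg_mpoly d g : @pdeg RR n d g -> exists p,
  (forall m, m \in mpoly.msupp p -> (mpoly.mdeg m <= d)%N) /\
  forall x, mpoly.meval (mval x) p = g x.
Proof.
elim=> {d g} [d c|d i g _ [p [pd pg]]|d g h _ [p [pd pg]] _ [r [rd rg]]].
- exists (mpoly.mpolyC n c); split=> [m|x]; last by rewrite mpoly.mevalC.
  rewrite mpoly.msuppC; case: eqP => // _; rewrite inE => /eqP ->.
  by rewrite mpoly.mdeg0.
- exists (mpoly.mpolyX RR (mpoly.mnm1 i) * p); split=> [m|x].
    move=> /mpoly.msuppM_le /allpairsP[[m1 m2] /= [h1 h2 ->]].
    rewrite mpoly.mdegD; move: h1; rewrite mpoly.msuppX inE => /eqP ->.
    by rewrite mpoly.mdeg1 add1n ltnS; exact: pd.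
  by rewrite mpoly.mevalM mpoly.mevalXU pg.
- exists (p + r); split=> [m|x]; last by rewrite mpoly.mevalD pg rg.
  by move=> /mpoly.msuppD_le; rewrite mem_cat => /orP[/pd|/rd].
Qed.

Lemma mpoly_pdeg d p : (forall m, m \in mpoly.msupp p -> (mpoly.mdeg m <= d)%N) ->
  @pdeg RR n d (fun x => mpoly.meval (mval x) p).
Proof.
move=> pd; apply: (@pdeg_ext _ _ _ (fun x => \sum_(m <- mpoly.msupp p | m \in mpoly.msupp p)
   mpoly.mcoeff m p * \prod_i mval x i ^+ mpoly.fun_of_multinom m i)).
  by move=> x; rewrite mpoly.mevalE -big_seq.
apply: pdeg_sum => m ms; apply: pdeg_scale; apply: (pdeg_leq (pd _ ms)).
rewrite mpoly.mdegE.
apply: pdeg_prod => i; rewrite -[X in pdeg X _]muln1; apply: pdegX; exact: pdeg_bit.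
Qed.

Lemma adeg_le (D : {set bits n}) (f : bits n -> bool) d (g : bits n -> RR) :
  @pdeg RR n d g -> (forall x, x \in D -> `|(f x)%:R - g x| <= 1 / 3) -> adeg D f <= d%:R.
Proof.
move=> /pdeg_mpoly[p [pd pg]] fg; apply: ge_inf; last first.
  exists d, p; split=> //; split; first by apply/bigmax_leqP_seq => m ms _; exact: pd.
  by move=> x xD; rewrite pg; exact: fg.
by exists 0 => r [d' [p' [-> _]]].
Qed.

(** Exact interpolation in all variables shows that the set of degrees is nonempty; otherwise the
    infimum would be a default value. *)
Lemma adeg_ge (D : {set bits n}) (f : bits n -> bool) (c : RR) :
  (forall d (g : bits n -> RR), @pdeg RR n d g ->
     (forall x, x \in D -> `|(f x)%:R - g x| <= 1 / 3) -> c <= d%:R) ->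
  c <= adeg D f.
Proof.
move=> H; apply: lb_le_inf.
  have [p [pd pg]] : exists p, (forall m, m \in mpoly.msupp p -> (mpoly.mdeg m <= size (enum 'I_n))%N) /\
    forall x, mpoly.meval (mval x) p = (f x)%:R.
    apply: pdeg_mpoly; apply: pdeg_dep => x y xy; congr ((f _)%:R).
    by apply/ffunP => i; rewrite xy // mem_enum.
  exists (size (enum 'I_n))%:R, (size (enum 'I_n)), p; split=> //.
  split; first by apply/bigmax_leqP_seq => m ms _; exact: pd.
  by move=> x _; rewrite pg subrr normr0.
move=> r [d [p [-> [pd fp]]]]; apply: (H _ (fun x => mpoly.meval (mval x) p)) => //.
by apply: mpoly_pdeg => m ms; move/bigmax_leqP_seq: pd; exact.
Qed.
End MPolyBridge.

Section Fdeg.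
Variable n : nat.
Implicit Type d : nat.

(* Stands in for "[f] is computed by a decision tree of depth [d]". *)
Definition fdeg (V : eqType) d (f : bits n -> V) :=
  forall u, @pdeg RR n d (fun x => (f x == u)%:R).

Lemma fdeg_bool d (f : bits n -> bool) : fdeg d f -> @pdeg RR n d (fun x => (f x)%:R).
Proof. by move=> H; apply: pdeg_ext (H true) => x; rewrite eqb_id. Qed.

Lemma fdeg_leq (V : eqType) d e (f : bits n -> V) : (d <= e)%N -> fdeg d f -> fdeg e f.
Proof. by move=> de H u; exact: pdeg_leq de (H u). Qed.

Lemma fdeg_bit i : fdeg 1 (fun x : bits n => x i).
Proof.
case; first by apply: pdeg_ext (pdeg_bit i) => x; rewrite eqb_id.
apply: pdeg_ext (pdegB (pdeg_cst _ 1) (pdeg_bit i)) => x.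
by case: (x i) => /=; rewrite ?subrr ?subr0.
Qed.

Lemma fdeg_bind (V : finType) (W : eqType) d e (f : bits n -> V) (g : V -> bits n -> W) :
  fdeg d f -> (forall u, fdeg e (g u)) -> fdeg (d + e) (fun x => g (f x) x).
Proof.
move=> Hf Hg w; apply: (@pdeg_ext _ _ _ (fun x => \sum_u (f x == u)%:R * (g u x == w)%:R)).
  move=> x; rewrite (bigD1 (f x)) //= eqxx mul1r big1 ?addr0 // => u /negbTE.
  by rewrite eq_sym => ->; rewrite mul0r.
by apply: pdeg_sum => u _; apply: pdegM; [exact: Hf|exact: Hg].
Qed.

Lemma fdeg_cst (V : eqType) d (c : V) : fdeg d (fun=> c).
Proof. by move=> u; exact: pdeg_cst. Qed.

Lemma fdeg_map (V : finType) (W : eqType) d (f : bits n -> V) (g : V -> W) :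
  fdeg d f -> fdeg d (fun x => g (f x)).
Proof.
by move=> H; rewrite -[d]addn0; apply: (fdeg_bind (g := fun u _ => g u)) => // u; exact: fdeg_cst.
Qed.

Lemma fdeg_ffun (K V : finType) d (f : K -> bits n -> V) :
  (forall j, fdeg d (f j)) -> fdeg (#|K| * d) (fun x => [ffun j => f j x]).
Proof.
move=> H u; apply: (@pdeg_ext _ _ _ (fun x => \prod_j (f j x == u j)%:R)).
  move=> x; have [/eqP e|ne] := boolP ([ffun j => f j x] == u).
    by rewrite big1 // => j _; rewrite -e ffunE eqxx.
  have [j jne] : exists j, f j x != u j.
    apply/existsP; apply: contraNT ne; rewrite negb_exists => /forallP E.
    by apply/eqP/ffunP => j; rewrite ffunE; apply/eqP; have := E j; rewrite negbK.
  by rewrite (bigD1 j) //= (negbTE jne) mul0r.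
rewrite -sum1_card big_distrl /=.
by apply: pdeg_prod => j; rewrite mul1n; exact: H.
Qed.
End Fdeg.

(** * Chebyshev polynomials and testing an integer for zero *)

Section Chebyshev.
Implicit Types (x y : RR) (n : nat).

Fixpoint cheb2 n y : RR * RR :=
  if n is n'.+1 then let: (u, v) := cheb2 n' y in (v, 2 * y * v - u) else (1, y).
Definition cheb n y : RR := (cheb2 n y).1.

Lemma cheb2E n y : cheb2 n y = (cheb n y, cheb n.+1 y).
Proof. by rewrite /cheb /=; case: (cheb2 n y). Qed.

Lemma chebSS n y : cheb n.+2 y = 2 * y * cheb n.+1 y - cheb n y.
Proof. by rewrite {1}/cheb /= cheb2E. Qed.

Lemma cheb_pell n y : cheb n y ^+ 2 - 2 * y * cheb n y * cheb n.+1 y + cheb n.+1 y ^+ 2 = 1 - y ^+ 2.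
Proof.
elim: n => [|n IH]; first by rewrite /cheb /=; ring.
by rewrite chebSS -IH; ring.
Qed.

(** In place of a cosine parametrisation: by the Pell identity [(1 - y ^ 2) (1 - T_{n+1} ^ 2)] is
    the square of [T_n - y T_{n+1}]. Division fails at [y ^ 2 = 1], where the identity gives
    [T_{n+1} = y T_n]. *)
Lemma cheb_le1 n y : y ^+ 2 <= 1 -> cheb n y ^+ 2 <= 1.
Proof.
move=> y1; elim: n => [|n IH]; first by rewrite /cheb /= expr1n.
have P := cheb_pell n y.
have [y1'|] := eqVneq (y ^+ 2) 1.
  have E : (cheb n.+1 y - y * cheb n y) ^+ 2 = 0.
    have -> : (cheb n.+1 y - y * cheb n y) ^+ 2 = (cheb n y ^+ 2 - 2 * y * cheb n y * cheb n.+1 y + cheb n.+1 y ^+ 2) - (1 - y ^+ 2) * cheb n y ^+ 2 by ring.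
    rewrite P.
    by rewrite y1'; ring.
  move/eqP: E; rewrite sqrf_eq0 subr_eq0 => /eqP ->.
  by rewrite exprMn y1' mul1r.
move=> ne; have y1' : 0 < 1 - y ^+ 2 by rewrite subr_gt0 lt_neqAle ne.
rewrite -subr_ge0 -(pmulr_rge0 _ y1').
have -> : (1 - y ^+ 2) * (1 - cheb n.+1 y ^+ 2) = (cheb n y - y * cheb n.+1 y) ^+ 2.
  by rewrite mulrBr mulr1 -{1}P; ring.
exact: sqr_ge0.
Qed.

(** The increment is carried along because the recurrence has order two; summing the increments
    gives the quadratic growth. *)
Lemma cheb_grow n (del : RR) : 0 <= del ->
  1 + n%:R ^+ 2 * del <= cheb n (1 + del) /\
  (2 * n%:R + 1) * del <= cheb n.+1 (1 + del) - cheb n (1 + del).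
Proof.
move=> d0; elim: n => [|n [IH1 IH2]].
  by rewrite /cheb /= expr0n mul0r mulr0 addr0 add0r mul1r; split=> //; lra.
have n0 : 0 <= (n%:R : RR) by [].
have h1 : 1 + n.+1%:R ^+ 2 * del <= cheb n.+1 (1 + del).
  by rewrite -natr1; nra.
split=> //; rewrite chebSS.
have h2 : 0 <= n.+1%:R ^+ 2 * del by rewrite mulr_ge0 // sqr_ge0.
by rewrite -natr1; nra.
Qed.

Lemma cheb_pdeg m n d (h : bits m -> RR) : @pdeg RR m d h ->
  @pdeg RR m (n * d) (fun x : bits m => cheb n (h x)).
Proof.
move=> H.
suff : @pdeg RR m (n * d) (fun x : bits m => cheb n (h x)) /\ @pdeg RR m (n.+1 * d) (fun x : bits m => cheb n.+1 (h x)) by case.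
elim: n => [|n [IH1 IH2]].
  split; first exact: (pdeg_cst _ 1).
  by rewrite mul1n; apply: pdeg_ext H => x.
split=> //; apply: (@pdeg_ext _ _ _ (fun x : bits m => 2 * (h x * cheb n.+1 (h x)) - cheb n (h x))).
  by move=> x; rewrite chebSS mulrA.
apply: pdegB; last by apply: pdeg_leq IH1; rewrite leq_mul2r; apply/orP; right; lia.
by apply: pdeg_scale; rewrite mulSn; apply: pdegM.
Qed.

(* The [e]-th power of a Chebyshev polynomial, rescaled so that [1 .. L] lands
   in [-1, 1] and 0 just outside, where the polynomial already exceeds 2. *)
Lemma zero_test_pdeg m (d e D L : nat) (V : bits m -> nat) : (0 < L)%N -> (L <= d ^ 2)%N ->
  @pdeg RR m D (fun x : bits m => (V x)%:R) -> (forall x : bits m, (V x <= L)%N) ->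
  exists g : bits m -> RR, @pdeg RR m (e * (d * D)) g /\
    (forall x : bits m, V x = 0%N -> g x = 1) /\
    (forall x : bits m, V x != 0%N -> `|g x| <= 2^-1 ^+ e).
Proof.
move=> L0 Ld HV VL; pose del : RR := 2 / L%:R.
have L0R : 0 < (L%:R : RR) by rewrite ltr0n.
have d0 : 0 <= del by rewrite divr_ge0.
pose y v : RR := 1 + del - del * v.
pose c := cheb d (1 + del).
have c2 : 2 <= c.
  have [+ _] := cheb_grow d d0; apply: le_trans.
  have : 1 <= d%:R ^+ 2 * (L%:R)^-1 :> RR.
    by rewrite ler_pdivlMr // mul1r -natrX ler_nat.
  by rewrite /del; nra.
exists (fun x : bits m => (c^-1 * cheb d (y (V x)%:R)) ^+ e); split; last split.
- apply: pdegX; apply: pdeg_scale; apply: cheb_pdeg; apply: pdegB; first exact: (pdeg_cst _ (1 + del)).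
  exact: pdeg_scale.
- by move=> x ->; rewrite /y mulr0 subr0 -/c mulVf ?expr1n // gt_eqF //; lra.
move=> x Vx; rewrite normrX lerXn2r ?nnegrE //.
have V1 : 1 <= ((V x)%:R : RR) by rewrite ler1n lt0n.
have VLR : (V x)%:R <= (L%:R : RR) by rewrite ler_nat.
have del2 : del * L%:R = 2 by rewrite divfK // gt_eqF.
have y1 : y (V x)%:R ^+ 2 <= 1.
  have h1 : y (V x)%:R <= 1 by rewrite /y; nra.
  have h2 : -1 <= y (V x)%:R by rewrite /y; nra.
  by rewrite expr2; nra.
have := cheb_le1 d y1; set z := cheb d _ => z1.
have {}z1 : `|z| <= 1 by rewrite -(@expr_le1 _ 2) // real_normK // num_real.
rewrite normrM normfV (ger0_norm (_ : 0 <= c)); last lra.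
rewrite mulrC ler_pdivrMr; last lra.
by apply: (le_trans z1); lra.
Qed.
End Chebyshev.

(** * Compressed oracles *)

Section CompressedOracle.
Variables (Co G : finType) (v0 : G).
Local Notation DB := {ffun Co -> option G}.
Local Notation q := (#|G|%:R : RR).
Implicit Types (D : DB) (c : Co) (h g : DB -> RR) (P : pred DB).

Definition upd D c o : DB := [ffun c' => if c' == c then o else D c'].

Lemma updE D c o c' : upd D c o c' = if c' == c then o else D c'.
Proof. by rewrite ffunE. Qed.

Lemma upd_same D c o : upd D c o c = o. Proof. by rewrite updE eqxx. Qed.

Lemma upd_upd D c o o' : upd (upd D c o) c o' = upd D c o'.
Proof. by apply/ffunP => c'; rewrite !updE; case: eqP. Qed.

Lemma upd_id D c : upd D c (D c) = D.
Proof. by apply/ffunP => c'; rewrite !updE; case: eqP => [->|]. Qed.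

Lemma upd_comm D c c' o o' : c != c' -> upd (upd D c o) c' o' = upd (upd D c' o') c o.
Proof.
move=> cc'; apply/ffunP => b; rewrite !updE.
have [->|] := eqVneq b c'; have [e|_] // := eqVneq _ c.
by rewrite e eqxx in cc'.
Qed.

Lemma q_gt0 : 0 < q. Proof. by rewrite ltr0n; apply/card_gt0P; exists v0. Qed.

(* The involution exchanging [None] with the uniform superposition of the
   [Some v] and fixing the orthogonal complement. *)
Definition swap_kernel (a b : option G) : RR :=
  match a, b with
  | None, None => 0
  | Some v, Some w => (v == w)%:R - q^-1
  | _, _ => (Num.sqrt q)^-1
  end.

Lemma swap_kernel_sym a b : swap_kernel a b = swap_kernel b a.
Proof. by case: a b => [v|] [w|] //=; rewrite eq_sym. Qed.

Lemma sum_option (k : option G -> RR) : \sum_o k o = k None + \sum_v k (Some v).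
Proof.
rewrite (bigD1 None) //=; congr (_ + _).
rewrite (reindex_omap Some id) /=; last by case.
by apply: eq_bigl => v; rewrite eqxx.
Qed.

Lemma sum_delta (v : G) : \sum_w ((v == w)%:R : RR) = 1.
Proof.
rewrite (bigD1 v) //= eqxx big1 ?addr0 // => w /negbTE wv.
by rewrite eq_sym wv.
Qed.

Lemma swap_kernelK a b : \sum_o swap_kernel a o * swap_kernel o b = (a == b)%:R.
Proof.
have q0 := q_gt0; have qN : q != 0 by rewrite gt_eqF.
have s2 : (Num.sqrt q)^-1 * (Num.sqrt q)^-1 = q^-1.
  by rewrite -invfM -expr2 sqr_sqrtr // ltW.
rewrite sum_option; case: a b => [v|] [w|] /=.
- rewrite s2; have -> : \sum_u ((v == u)%:R - q^-1) * ((u == w)%:R - q^-1) =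
     \sum_u ((v == u)%:R * (u == w)%:R - (v == u)%:R * q^-1 - (w == u)%:R * q^-1 + q^-1 * q^-1).
    by apply: eq_bigr => u _; rewrite [w == u]eq_sym; ring.
  rewrite big_split /= !sumrB -!mulr_suml !sum_delta sumr_const -[X in _ + X / _]mulr_natl.
  rewrite (bigD1 v) //= eqxx mul1r big1 ?addr0 => [|u uv]; last first.
    by rewrite eq_sym (negbTE uv) mul0r.
  have -> : (Some v == Some w) = (v == w) by apply/eqP/eqP => [[->]|->].
  by rewrite (divff qN) !mul1r; ring.
- rewrite mulr0 add0r -mulr_suml sumrB sum_delta sumr_const -[X in 1 - X]mulr_natl.
  by rewrite divff // subrr mul0r.
- rewrite mul0r add0r -mulr_sumr sumrB sumr_const -[X in _ - X]mulr_natl divff //.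
  have -> : \sum_i ((i == w)%:R : RR) = 1.
    rewrite (bigD1 w) //= eqxx big1 => [|u /negbTE -> //]; rewrite ?addr0 ?subrr ?mulr0 //.
  by rewrite ?subrr ?mulr0.
- rewrite mul0r add0r s2 sumr_const -[LHS]mulr_natl divff //.
Qed.

Definition F c h D : RR := \sum_o swap_kernel (D c) o * h (upd D c o).

Lemma F_inv c h : F c (F c h) = h.
Proof.
apply/funext => D; rewrite /F.
under eq_bigr => o _ do (rewrite mulr_sumr; under eq_bigr => o' _ do
   rewrite upd_same upd_upd mulrA).
rewrite exchange_big /=.
under eq_bigr => o _ do rewrite -mulr_suml swap_kernelK.
rewrite (bigD1 (D c)) //= eqxx mul1r upd_id big1 ?addr0 // => o oD.
by rewrite eq_sym (negbTE oD) mul0r.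
Qed.

Lemma F_comm c c' h : F c (F c' h) = F c' (F c h).
Proof.
have [->//|cc'] := eqVneq c c'.
apply/funext => D; rewrite /F.
under eq_bigr => o _ do (rewrite mulr_sumr; under eq_bigr => o' _ do
   rewrite updE eq_sym (negbTE cc') mulrCA (upd_comm _ _ _ cc')).
rewrite exchange_big /=; apply: eq_bigr => o' _.
rewrite mulr_sumr; apply: eq_bigr => o _.
by rewrite updE (negbTE cc').
Qed.

Lemma sum_fiber c (k : DB -> RR) :
  \sum_D k D = \sum_(D : DB | D c == None) \sum_o k (upd D c o).
Proof.
rewrite (partition_big (fun D => upd D c None) (fun D => D c == None)) /=; last first.
  by move=> D _; rewrite upd_same.
apply: eq_bigr => D /eqP Dc.
rewrite (reindex_onto (fun o => upd D c o) (fun D' => D' c)) /=; last first.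
  by move=> D' /eqP <-; rewrite upd_upd upd_id.
apply: eq_bigl => o; rewrite upd_same eqxx andbT upd_upd -Dc upd_id.
by rewrite eqxx.
Qed.

Lemma F_upd c h D o : F c h (upd D c o) = \sum_o' swap_kernel o o' * h (upd D c o').
Proof. by rewrite /F upd_same; apply: eq_bigr => o' _; rewrite upd_upd. Qed.

Lemma sumsq_F c h : \sum_D F c h D ^+ 2 = \sum_D h D ^+ 2.
Proof.
rewrite (sum_fiber c) [RHS](sum_fiber c); apply: eq_bigr => D _.
set a := fun o => h (upd D c o).
transitivity (\sum_o \sum_o' \sum_o'' swap_kernel o' o * swap_kernel o o'' * (a o' * a o'')).
  apply: eq_bigr => o _; rewrite F_upd expr2 mulr_suml; apply: eq_bigr => o' _.
  by rewrite mulr_sumr; apply: eq_bigr => o'' _; rewrite swap_kernel_sym -/(a o') -/(a o''); ring.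
rewrite exchange_big /=; apply: eq_bigr => o' _; rewrite exchange_big /=.
under eq_bigr => o'' _ do rewrite -mulr_suml swap_kernelK.
rewrite (bigD1 o') //= eqxx mul1r big1 ?addr0 => [|o'' oo]; first by rewrite expr2.
by rewrite eq_sym (negbTE oo) mul0r.
Qed.

Lemma l2_F c h : l2 (F c h) = l2 h.
Proof. by rewrite /l2 sumsq_F. Qed.

Lemma FD c g h : F c (fun D => g D + h D) = fun D => F c g D + F c h D.
Proof.
by apply/funext => D; rewrite /F -big_split; apply: eq_bigr => o _; rewrite mulrDr.
Qed.

Lemma FZ c a h : F c (fun D => a * h D) = fun D => a * F c h D.
Proof.
by apply/funext => D; rewrite /F mulr_sumr; apply: eq_bigr => o _; rewrite mulrCA.
Qed.

Definition Fs (l : seq Co) h : DB -> RR := foldr F h l.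

Lemma Fs_cat l l' h : Fs (l ++ l') h = Fs l (Fs l' h).
Proof. exact: foldr_cat. Qed.

Lemma F_Fs c l h : F c (Fs l h) = Fs l (F c h).
Proof. by elim: l => //= c' l IH; rewrite F_comm IH. Qed.

Lemma Fs_comm l l' h : Fs l (Fs l' h) = Fs l' (Fs l h).
Proof. by elim: l => //= c l ->; rewrite F_Fs. Qed.

Lemma Fs_inv l h : Fs l (Fs l h) = h.
Proof. by elim: l h => //= c l IH h; rewrite -F_Fs F_inv IH. Qed.

Lemma Fs_perm l l' h : perm_eq l l' -> Fs l h = Fs l' h.
Proof.
elim: l l' => [|c l IH] l'; first by rewrite perm_sym => /perm_nilP ->.
move=> H; have cl' : c \in l' by rewrite -(perm_mem H) mem_head.
case/splitPr: cl' H => p1 p2 H.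
have H2 : perm_eq l (p1 ++ p2) by rewrite -(perm_cons c) (perm_trans H) // perm_catC /= perm_cons perm_catC.
by rewrite /= (IH _ H2) F_Fs !Fs_cat -F_Fs Fs_comm.
Qed.

Lemma l2_Fs l h : l2 (Fs l h) = l2 h.
Proof. by elim: l => //= c l IH; rewrite l2_F. Qed.

Lemma FsD l g h : Fs l (fun D => g D + h D) = fun D => Fs l g D + Fs l h D.
Proof. by elim: l => //= c l ->; rewrite FD. Qed.

Lemma FsZ l a h : Fs l (fun D => a * h D) = fun D => a * Fs l h D.
Proof. by elim: l => //= c l ->; rewrite FZ. Qed.

Definition res P h D : RR := if P D then h D else 0.

Lemma res_le P h : l2 (res P h) <= l2 h.
Proof.
apply: l2_mono => D; rewrite /res; case: (P D) => //.
by rewrite expr0n sqr_ge0.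
Qed.

Lemma resD P g h : res P (fun D => g D + h D) = fun D => res P g D + res P h D.
Proof. by apply/funext => D; rewrite /res; case: (P D); rewrite ?addr0. Qed.

Lemma F_res_comm c P h : (forall D o, P (upd D c o) = P D) ->
  F c (res P h) = res P (F c h).
Proof.
move=> H; apply/funext => D; rewrite /F /res; case: ifP => PD.
  by apply: eq_bigr => o _; rewrite H PD.
by rewrite big1 // => o _; rewrite H PD mulr0.
Qed.

Lemma Fs_res_comm l P h : (forall c D o, c \in l -> P (upd D c o) = P D) ->
  Fs l (res P h) = res P (Fs l h).
Proof.
elim: l => //= c l IH H; rewrite IH => [|c' D o c'l]; last by rewrite H // inE c'l orbT.
by rewrite F_res_comm // => D o; rewrite H // mem_head.
Qed.

(** On a database recorded at [c], [F c g] differs from [g] by a term [kap] independent of the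
    recorded value, whose square is at most [2 / q] times the mass of the fibre. Only [r] values of
    that fibre are retained. *)
Lemma res_F_le c P (r : nat) g :
  (forall D, P D -> D c != None) ->
  (forall D, #|[pred v | P (upd D c (Some v))]| <= r)%N ->
  l2 (res P (F c g)) <= l2 (res P g) + Num.sqrt (2 * r%:R / q) * l2 g.
Proof.
move=> PN Pr; have q0 := q_gt0.
pose kap D := (Num.sqrt q)^-1 * g (upd D c None) - q^-1 * \sum_w g (upd D c (Some w)).
have kapu D o : kap (upd D c o) = kap D.
  by rewrite /kap upd_upd; congr (_ - _ * _); apply: eq_bigr => w _; rewrite upd_upd.
have -> : res P (F c g) = fun D => res P g D + res P kap D.
  apply/funext => D; rewrite /res; case: ifP => [/PN|]; last by rewrite addr0.
  rewrite /F; case Dc: (D c) => [v|//] _; rewrite sum_option /kap /=.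
  have -> : \sum_w ((v == w)%:R - q^-1) * g (upd D c (Some w)) =
     g D - q^-1 * \sum_w g (upd D c (Some w)).
    rewrite -[X in X - _](_ : \sum_w (v == w)%:R * g (upd D c (Some w)) = g D).
      by rewrite mulr_sumr -sumrB; apply: eq_bigr => w _; rewrite mulrBl.
    rewrite (bigD1 v) //= eqxx mul1r -Dc upd_id big1 ?addr0 // => w wv.
    by rewrite eq_sym (negbTE wv) mul0r.
  by rewrite addrCA.
apply: (le_trans (l2D _ _)); rewrite lerD2l.
apply: l2_le; first by rewrite mulr_ge0 ?l2_ge0 ?sqrtr_ge0.
rewrite exprMn l2_sq sqr_sqrtr; last by rewrite divr_ge0 // mulr_ge0.
rewrite (sum_fiber c) [X in _ * X](sum_fiber c) mulr_sumr; apply: ler_sum => D _.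
have kap2 : kap D ^+ 2 <= 2 / q * \sum_o g (upd D c o) ^+ 2.
  rewrite sum_option.
  have cs : (\sum_w g (upd D c (Some w))) ^+ 2 <= q * \sum_w g (upd D c (Some w)) ^+ 2.
    have := CauchySchwarz_sum (fun=> 1) (fun w => g (upd D c (Some w))).
    have := CauchySchwarz_sum (fun=> 1) (fun w => - g (upd D c (Some w))).
    under eq_bigr do rewrite mul1r; under [in X in _ -> X]eq_bigr do rewrite mul1r.
    have -> : l2 (fun w => - g (upd D c (Some w))) = l2 (fun w => g (upd D c (Some w))).
      by rewrite /l2; under eq_bigr do rewrite sqrrN.
    rewrite sumrN => h1 h2.
    have h3 : `|\sum_w g (upd D c (Some w))| <= l2 (fun _ : G => 1 : RR) * l2 (fun w => g (upd D c (Some w))).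
      by rewrite ler_norml; apply/andP; split => //; lra.
    rewrite -[leLHS]real_normK ?num_real //.
    have : l2 (fun _ : G => 1 : RR) ^+ 2 * l2 (fun w => g (upd D c (Some w))) ^+ 2 = q * \sum_w g (upd D c (Some w)) ^+ 2.
      rewrite !l2_sq; congr (_ * _).
      by under eq_bigr do rewrite expr1n; rewrite sumr_const.
    by move=> <-; rewrite -exprMn lerXn2r // nnegrE ?mulr_ge0 ?l2_ge0.
  rewrite /kap; set a := (Num.sqrt q)^-1 * _; set b := q^-1 * _.
  have a2 : a ^+ 2 = q^-1 * g (upd D c None) ^+ 2.
    by rewrite exprMn exprVn sqr_sqrtr // ltW.
  have b2 : b ^+ 2 <= q^-1 * \sum_w g (upd D c (Some w)) ^+ 2.
    rewrite exprMn expr2 -mulrA; apply: ler_wpM2l; first by rewrite invr_ge0 ltW.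
    by rewrite ler_pdivrMl.
  have : (a - b) ^+ 2 <= 2 * a ^+ 2 + 2 * b ^+ 2 by have := sqr_ge0 (a + b); nra.
  move=> /le_trans; apply; rewrite a2 mulrDr -!mulrA.
  by apply: lerD => //; apply: ler_wpM2l.
apply: (@le_trans _ _ (r%:R * kap D ^+ 2)).
  rewrite sum_option /res; case: ifP => [/PN|_]; first by rewrite upd_same.
  rewrite expr0n add0r.
  apply: (@le_trans _ _ (\sum_(v | P (upd D c (Some v))) kap D ^+ 2)).
    rewrite [leRHS]big_mkcond; apply: ler_sum => v _.
    by case: ifP => _; rewrite ?kapu // expr0n.
  rewrite sumr_const -[leLHS]mulr_natl; apply: ler_wpM2r; first exact: sqr_ge0.
  by rewrite ler_nat; exact: Pr.
have -> : 2 * r%:R / q * \sum_o g (upd D c o) ^+ 2 = r%:R * (2 / q * \sum_o g (upd D c o) ^+ 2) by ring.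
by apply: ler_wpM2l.
Qed.

Lemma res_Fs_le l P (r : nat) h :
  (forall c D, c \in l -> P D -> D c != None) ->
  (forall c D, c \in l -> #|[pred v | P (upd D c (Some v))]| <= r)%N ->
  l2 (res P (Fs l h)) <= l2 (res P h) + (size l)%:R * Num.sqrt (2 * r%:R / q) * l2 h.
Proof.
elim: l => [|c l IH] PN Pr /=; first by rewrite !mul0r addr0.
apply: (le_trans (res_F_le (r := r) _ _ _)).
- by move=> D; apply: PN; rewrite mem_head.
- by move=> D; apply: Pr; rewrite mem_head.
have := IH _ _ => /(_ (fun c' D H => PN c' D (_ : c' \in c :: l))).
have PN' c' D : c' \in l -> P D -> D c' != None by move=> c'l; apply: PN; rewrite inE c'l orbT.
have Pr' c' D : c' \in l -> (#|[pred v | P (upd D c' (Some v))]| <= r)%N.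
  by move=> c'l; apply: Pr; rewrite inE c'l orbT.
have := IH PN' Pr'; rewrite l2_Fs -natr1; move=> + _; lra.
Qed.

Definition supp h P := forall D, ~~ P D -> h D = 0.

Lemma res_supp h P P' : supp h P -> (forall D, P D -> ~~ P' D) -> res P' h = fun=> 0.
Proof.
move=> H PP'; apply/funext => D; rewrite /res; case: ifPn => // P'D.
by apply: H; apply: contraL P'D => /PP'.
Qed.

Lemma l2_0 : l2 (fun _ : DB => 0 : RR) = 0.
Proof. by rewrite /l2 big1 ?sqrtr0 // => D _; rewrite expr0n. Qed.

(** The projection onto [P] in the ordinary basis, expressed in the compressed one. *)
Definition Q l P h := Fs l (res P (Fs l h)).

(* Coordinate [c] enters [Bad] only through at most [r] of the [q] values that
   a fresh recording could take. *)
Lemma leak_one_register c (P Good Bad : pred DB) (r : nat) h :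
  supp h Good -> (forall D, Good D -> ~~ Bad D) ->
  (forall D o, Good (upd D c o) -> Bad D -> D c != None) ->
  (forall D o, Good (upd D c o) -> #|[pred v | Bad (upd D c (Some v))]| <= r)%N ->
  l2 (res Bad (Q [:: c] P h)) <= 2 * Num.sqrt (2 * r%:R / q) * l2 h.
Proof.
move=> hG GB BN Br; rewrite /Q /=.
(* [BN] and [Br] speak only of databases one change at [c] away from [Good]; no others receive
   weight, so [Bad] is cut down to these. *)
pose R := [pred D | Bad D && [exists o, Good (upd D c o)]].
have RN D : R D -> D c != None by case/andP=> hb /existsP[u hu]; exact: (BN _ _ hu hb).
have Rr D : (#|[pred v | R (upd D c (Some v))]| <= r)%N.
  have [/existsP[u GD]|] := boolP [exists o, Good (upd D c o)].
    apply: leq_trans (Br D u GD); apply: subset_leq_card.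
    by apply/fintype.subsetP => v; rewrite !inE => /andP[].
  rewrite negb_exists => /forallP H; rewrite eq_card0 // => v; rewrite !inE.
  apply/negP => /andP[_ /existsP[u]]; rewrite upd_upd => GD.
  by have := H u; rewrite GD.
have E : res Bad (F c (res P (F c h))) = res R (F c (res P (F c h))).
  apply/funext => D; rewrite /res /=; case: ifP => // BD /=.
  case: ifPn => //; rewrite negb_exists => /forallP H.
  rewrite /F big1 // => o _; case: ifP => _; rewrite ?mulr0 //.
  by rewrite big1 ?mulr0 // => o' _; rewrite upd_upd hG ?mulr0 // H.
rewrite E; set k := Num.sqrt _.
have k0 : 0 <= k by exact: sqrtr_ge0.
have e0 := res_F_le (res P (F c h)) RN Rr; rewrite -/k in e0.
have e1 : l2 (res R (res P (F c h))) <= l2 (res R (F c h)).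
  apply: l2_mono => D; rewrite /res; case: (R D) => //; case: (P D) => //.
  by rewrite expr0n sqr_ge0.
have e2 := res_F_le h RN Rr; rewrite -/k in e2.
have e3 : l2 (res R h) = 0.
  by rewrite (@res_supp _ Good) ?l2_0 // => D GD; rewrite /= (negbTE (GB D GD)).
have e4 : k * l2 (res P (F c h)) <= k * l2 h.
  by apply: ler_wpM2l => //; rewrite -[leRHS](l2_F c) res_le.
lra.
Qed.

Definition total D := [forall c, D c != None].
Definition vals D : {ffun Co -> G} := [ffun c => odflt v0 (D c)].
Definition lift (a : {ffun Co -> G} -> RR) D : RR := if total D then a (vals D) else 0.

Lemma sum_lift (a : {ffun Co -> G} -> RR) :
  \sum_D lift a D ^+ 2 = \sum_w a w ^+ 2.
Proof.
rewrite (bigID total) /= [X in _ + X]big1 ?addr0; last first.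
  by move=> D /negbTE nt; rewrite /lift nt expr0n.
rewrite (reindex_onto (fun w : {ffun Co -> G} => [ffun c => Some (w c)]) vals) /=; last first.
  move=> D /forallP tD; apply/ffunP => c; rewrite !ffunE.
  by have := tD c; case: (D c).
apply: eq_big => [w|w].
  have -> : vals [ffun c => Some (w c)] = w by apply/ffunP => c; rewrite !ffunE.
  by rewrite eqxx andbT; apply/forallP => c; rewrite ffunE.
by case/andP=> tw /eqP ew; rewrite /lift tw ew.
Qed.

Definition all_co := enum Co.

(** The swaps at coordinates outside [l] commute with the projection and cancel, so a query touches
    only the coordinates its bit depends on. *)
Lemma Q_all l P h : uniq l ->
  (forall D c o, c \notin l -> P (upd D c o) = P D) ->
  Fs all_co (res P (Fs all_co h)) = Q l P h.
Proof.
move=> ul Pl.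
have [l' [pl nl]] : exists l', perm_eq all_co (l ++ l') /\ (forall c, c \in l' -> c \notin l).
  exists [seq c <- all_co | c \notin l]; split; last by move=> c; rewrite mem_filter => /andP[].
  apply: uniq_perm; first exact: enum_uniq.
    rewrite cat_uniq ul filter_uniq ?enum_uniq // andbT /=.
    by apply/hasPn => c; rewrite mem_filter => /andP[].
  by move=> c; rewrite mem_cat mem_filter mem_enum /= andbT orbN.
rewrite !(Fs_perm _ pl) !Fs_cat [Fs l (Fs l' h)]Fs_comm Fs_res_comm ?Fs_inv //.
by move=> D c o cl'; exact: Pl (nl _ cl').
Qed.

End CompressedOracle.

(** * Running a query algorithm against the compressed oracle *)

Section Evolution.
Variables (Co G : finType) (v0 : G) (n T : nat) (A : qalg n T).
Local Notation DB := {ffun Co -> option G}.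
Local Notation Om := {ffun Co -> G}.
Local Notation P := (qbasis n (qa_w A) * bool)%type.
Variable (x0 : Om -> bits n) (cs : 'I_n -> seq Co) (ft : 'I_n -> pred DB).
Hypothesis cs_uniq : forall i, uniq (cs i).
Hypothesis ft_local : forall i (D : DB) c o, c \notin cs i -> ft i (upd D c o) = ft i D.
Hypothesis ft_total : forall i (D : DB), total D -> ft i D = x0 (vals v0 D) i.
Variables (Good : nat -> pred DB) (T0 : nat) (eps : RR).
Hypothesis TT0 : (T <= T0)%N.
Hypothesis eps_ge0 : 0 <= eps.
Hypothesis Good0 : Good 0 [ffun=> None].
Hypothesis GoodS : forall t (D : DB), Good t D -> Good t.+1 D.
Hypothesis leak : forall t i h, (t < T0)%N -> supp h (Good t) ->
  l2 (res (fun D => ~~ Good t.+1 D) (Q (cs i) (ft i) h)) <= eps * l2 h.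

Local Notation pix p := (p.1.1.1).
Definition flip (p : P) : P := ((p.1.1.1, ~~ p.1.1.2, p.1.2), p.2).

Lemma flipK : involutive flip.
Proof. by move=> [[[i b] z] c]; rewrite /flip /= negbK. Qed.

Definition nrm (Z : P -> DB -> RR) : RR := l2 (fun u : P * DB => Z u.1 u.2).

Lemma nrm_sq Z : nrm Z ^+ 2 = \sum_p l2 (Z p) ^+ 2.
Proof.
rewrite l2_sq -(pair_bigA _ (fun p D => Z p D ^+ 2)) /=.
by apply: eq_bigr => p _; rewrite l2_sq.
Qed.

Lemma nrm_ge0 Z : 0 <= nrm Z. Proof. exact: l2_ge0. Qed.

Lemma nrm_mono (Z Y : P -> DB -> RR) (a : RR) : 0 <= a ->
  (forall p, l2 (Z p) <= a * l2 (Y p)) -> nrm Z <= a * nrm Y.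
Proof.
move=> a0 H; apply: l2_le; first by rewrite mulr_ge0 // nrm_ge0.
rewrite -(pair_bigA _ (fun p D => Z p D ^+ 2)) /= exprMn nrm_sq mulr_sumr.
apply: ler_sum => p _; rewrite -l2_sq -exprMn.
by rewrite lerXn2r // nnegrE ?mulr_ge0 ?l2_ge0.
Qed.

(** The answer bit is flipped exactly on the part projected by the test, so a query adds the
    projected difference between the flipped and the original component. *)
Definition query (Z : P -> DB -> RR) p (D : DB) : RR :=
  Z p D + Q (cs (pix p)) (ft (pix p)) (fun D' => Z (flip p) D' - Z p D') D.

Lemma FsB (l : seq Co) (g h : DB -> RR) :
  Fs l (fun D => g D - h D) = fun D => Fs l g D - Fs l h D.
Proof.
have -> : (fun D => g D - h D) = (fun D => g D + -1 * h D) by apply/funext => D; rewrite mulN1r.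
by rewrite FsD FsZ; apply/funext => D; rewrite mulN1r.
Qed.

Lemma query_mix Z p : query Z p = Fs (cs (pix p)) (fun D =>
   if ft (pix p) D then Fs (cs (pix p)) (Z (flip p)) D else Fs (cs (pix p)) (Z p) D).
Proof.
set l := cs _; set f := ft _.
have -> : (fun D => if f D then Fs l (Z (flip p)) D else Fs l (Z p) D) =
  (fun D => Fs l (Z p) D + res f (Fs l (fun D' => Z (flip p) D' - Z p D')) D).
  apply/funext => D; rewrite FsB /res; case: (f D); rewrite ?addr0 //.
  by rewrite addrC subrK.
by rewrite FsD (Fs_inv v0).
Qed.

Lemma nrm_query Z : nrm (query Z) = nrm Z.
Proof.
apply/eqP; rewrite -(@eqrXn2 _ 2) ?nrm_ge0 // !nrm_sq; apply/eqP.
transitivity (\sum_p \sum_(D : DB) (if ft (pix p) D then Fs (cs (pix p)) (Z (flip p)) D else Fs (cs (pix p)) (Z p) D) ^+ 2).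
  by apply: eq_bigr => p _; rewrite query_mix (l2_Fs v0) l2_sq.
rewrite exchange_big /=.
transitivity (\sum_(D : DB) \sum_p Fs (cs (pix p)) (Z p) D ^+ 2).
  apply: eq_bigr => D _.
  rewrite [RHS](reindex (fun p => if ft (pix p) D then flip p else p)) /=.
    by apply: eq_bigr => p _; case: ifP.
  exists (fun p => if ft (pix p) D then flip p else p) => p _ /=.
    by case E: (ft (pix p) D); rewrite /= ?E ?flipK.
  by case E: (ft (pix p) D); rewrite /= ?E ?flipK.
rewrite exchange_big /=; apply: eq_bigr => p _; by rewrite -l2_sq (l2_Fs v0).
Qed.

(* The oracle register attached to component [p] (a basis state and a choice of
   real or imaginary part), in the compressed basis. *)
Definition Zst t (p : P) : DB -> RR :=
  Fs (all_co Co) (lift v0 (fun w => split_re (amp A (x0 w) t) p)).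

Definition Zpost t (p : P) : DB -> RR :=
  Fs (all_co Co) (lift v0 (fun w => split_re (fun s => amp A (x0 w) t (oracle_map (x0 w) s)) p)).

Lemma Zpost_query t : Zpost t = query (Zst t).
Proof.
apply/funext => p; apply/funext => D0; rewrite /query /Zpost.
have -> : lift v0 (fun w => split_re (fun s => amp A (x0 w) t (oracle_map (x0 w) s)) p) =
  fun D => lift v0 (fun w => split_re (amp A (x0 w) t) p) D +
    res (ft (pix p)) (Fs (all_co Co) (fun D' => Zst t (flip p) D' - Zst t p D')) D.
  apply/funext => D; rewrite FsB /Zst /res !(Fs_inv v0) /lift.
  case: ifP => tD; last by case: ifP => _; rewrite ?subrr addr0.
  rewrite ft_total //; case: p => [[[i b] z] c] /=; rewrite /split_re /flip /=.
  by case: (x0 (vals v0 D) i); case: b; case: c => /=; rewrite ?addr0 ?subr0 // addrC subrK.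
rewrite FsD (Q_all v0 _ (cs_uniq (pix p))) //; exact: ft_local.
Qed.

Lemma lift_sum (l : seq Co) (a : Om -> RR) (D : DB) :
  Fs l (lift v0 a) D = \sum_w a w * Fs l (lift v0 (fun w' => (w' == w)%:R)) D.
Proof.
have -> : lift v0 a = fun D => \sum_w a w * lift v0 (fun w' => (w' == w)%:R) D.
  apply/funext => D'; rewrite /lift; case: ifP => _; last by rewrite big1 // => w _; rewrite mulr0.
  rewrite (bigD1 (vals v0 D')) //= eqxx mulr1 big1 ?addr0 // => w /negbTE.
  by rewrite eq_sym => ->; rewrite mulr0.
elim: l D => [|c l IH] D //=.
have -> : Fs l (fun D => \sum_w a w * lift v0 (fun w' => (w' == w)%:R) D) =
   fun D => \sum_w a w * Fs l (lift v0 (fun w' => (w' == w)%:R)) D by apply/funext.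
rewrite {1}/F; under eq_bigr do rewrite mulr_sumr.
rewrite exchange_big /=; apply: eq_bigr => w _.
by rewrite /F mulr_sumr; apply: eq_bigr => o _; rewrite mulrCA.
Qed.

(** Compression combines inputs linearly with real coefficients and the unitary acts on basis
    states, so the two commute. The norm over components is preserved separately at each database,
    hence so is the bad weight. *)
Lemma Zst_unitary t (D : DB) : (t < T)%N ->
  \sum_p Zst t.+1 p D ^+ 2 = \sum_p Zpost t p D ^+ 2.
Proof.
move=> tT.
pose K w := Fs (all_co Co) (lift v0 (fun w' => (w' == w)%:R)) D.
pose comb (a : Om -> qbasis n (qa_w A) -> CC) s := \sum_w Complex (K w) 0 * a w s.
have E (a : Om -> qbasis n (qa_w A) -> CC) p :
    Fs (all_co Co) (lift v0 (fun w => split_re (a w) p)) D = split_re (comb a) p.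
  rewrite lift_sum /split_re /comb; case: p => s [] /=.
    by rewrite Re_sum; apply: eq_bigr => w _; case: (a w s) => u v /=; rewrite mul0r subr0 mulrC.
  by rewrite Im_sum; apply: eq_bigr => w _; case: (a w s) => u v /=; rewrite mul0r addr0 mulrC.
transitivity (\sum_p split_re (comb (fun w => amp A (x0 w) t.+1)) p ^+ 2).
  by apply: eq_bigr => p _; rewrite -E.
transitivity (\sum_p split_re (comb (fun w s => amp A (x0 w) t (oracle_map (x0 w) s))) p ^+ 2);
  last by apply: eq_bigr => p _; rewrite -E.
rewrite -!l2_sq -![l2 _]/(cl2 _); congr (_ ^+ 2).
rewrite -[RHS](cl2_Uapp _ tT); apply: eq_cl2 => s; rewrite /comb /Uapp.
transitivity (\sum_w \sum_s' Complex (K w) 0 * (qa_U A t.+1 (enum_rank s) (enum_rank s') * amp A (x0 w) t (oracle_map (x0 w) s'))).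
  by apply: eq_bigr => w _; rewrite ampS /Uapp mulr_sumr.
rewrite exchange_big /=; apply: eq_bigr => s' _; rewrite mulr_sumr.
by apply: eq_bigr => w _; rewrite mulrCA.
Qed.

Lemma nrm_Zst t : (t <= T)%N -> nrm (Zst t) ^+ 2 = #|{: Om}|%:R.
Proof.
move=> tT; rewrite nrm_sq.
under eq_bigr do rewrite (l2_Fs v0) l2_sq sum_lift.
rewrite exchange_big /=.
under eq_bigr do rewrite -l2_sq -[l2 _]/(cl2 _) cl2_amp // expr1n.
by rewrite sumr_const.
Qed.

Definition resZ (R : pred DB) (Z : P -> DB -> RR) p := res R (Z p).

Lemma nrm_resZ_le (R : pred DB) Z : nrm (resZ R Z) <= nrm Z.
Proof.
rewrite -[leRHS]mul1r; apply: nrm_mono => // p; rewrite mul1r; exact: res_le.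
Qed.

Lemma nrmD (Z Y : P -> DB -> RR) : nrm (fun p D => Z p D + Y p D) <= nrm Z + nrm Y.
Proof. exact: l2D. Qed.

Lemma nrm_flip Z : nrm (fun p => Z (flip p)) = nrm Z.
Proof.
apply/eqP; rewrite -(@eqrXn2 _ 2) ?nrm_ge0 // !nrm_sq; apply/eqP.
by rewrite [RHS](reindex_inj (inv_inj flipK)).
Qed.

Lemma nrmN Z : nrm (fun p D => - Z p D) = nrm Z.
Proof. by rewrite /nrm /l2; under eq_bigr do rewrite sqrrN. Qed.

Definition bad t (D : DB) := ~~ Good t D.
Definition sqOm : RR := Num.sqrt #|{: Om}|%:R.

Lemma nrm_ZstE t : (t <= T)%N -> nrm (Zst t) = sqOm.
Proof. by move=> tT; rewrite /sqOm -(nrm_Zst tT) sqrtr_sqr ger0_norm ?nrm_ge0. Qed.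

(** Before any query the amplitudes do not depend on [w], and a function constant in coordinate [c]
    is sent by [F c] to the value [None]. All weight lies on the empty database. *)
Lemma Zst0_good : resZ (bad 0) (Zst 0) = fun _ _ => 0.
Proof.
apply/funext => p; apply/funext => D; rewrite /resZ /res; case: ifP => // bD.
have [c Dc] : exists c, D c != None.
  apply/existsP; apply: contraT; rewrite negb_exists => /forallP H.
  have E : D = [ffun=> None] by apply/ffunP => c; rewrite ffunE; apply/eqP; have := H c; rewrite negbK.
  by rewrite /bad E Good0 in bD.
pose w0 : Om := [ffun=> v0].
have E : (fun w => split_re (amp A (x0 w) 0) p) = fun w => split_re (amp A (x0 w0) 0) p by [].
rewrite /Zst E.
have FcE : F c (lift v0 (fun=> split_re (amp A (x0 w0) 0) p)) =
   res (fun D => D c == None) (F c (lift v0 (fun=> split_re (amp A (x0 w0) 0) p))).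
  apply/funext => D'; rewrite /res; case: ifPn => // D'c.
  rewrite /F; case D'E: (D' c) D'c => [v|//] _.
  set a := split_re _ _.
  rewrite sum_option /= /lift.
  have -> : total (upd D' c None) = false.
    by apply/negbTE/forallPn; exists c; rewrite upd_same negbK.
  have tE u : total (upd D' c (Some u)) = total D'.
    apply/forallP/forallP => H c'; have := H c'; rewrite updE.
      by have [->|] := eqVneq c' c; rewrite ?D'E.
    by have [->|] := eqVneq c' c.
  under eq_bigr do rewrite tE.
  rewrite mulr0 add0r -mulr_suml sumrB sum_delta sumr_const -[X in _ - X]mulr_natl.
  by rewrite divff ?subrr ?mul0r // gt_eqF // (q_gt0 v0).
have pl : perm_eq (all_co Co) (rcons (rem c (all_co Co)) c).
  rewrite perm_sym perm_rcons perm_sym; apply: perm_to_rem; exact: mem_enum.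
rewrite (Fs_perm _ pl) -cats1 Fs_cat /= FcE Fs_res_comm.
  by rewrite /res (negbTE Dc).
move=> c' D' o; rewrite mem_rem_uniq ?enum_uniq // inE => /andP[cc' _].
by rewrite updE [c == c']eq_sym (negbTE cc').
Qed.

(** Unitaries preserve the bad weight and queries are isometries, so only leakage from the good part
    adds to it: at most [eps] times the norm of the difference of two components, hence the factor
    2. States are not normalised, which explains [sqOm]. *)
Lemma bad_weight t : (t <= T)%N -> nrm (resZ (bad t) (Zst t)) <= 2 * eps * t%:R * sqOm.
Proof.
elim: t => [|t IH] tT.
  rewrite Zst0_good /nrm /l2 big1 ?sqrtr0 ?mulr0 ?mul0r // => u _.
  by rewrite expr0n.
have {}IH := IH (ltnW tT).
have e1 : nrm (resZ (bad t.+1) (Zst t.+1)) = nrm (resZ (bad t.+1) (query (Zst t))).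
  apply/eqP; rewrite -(@eqrXn2 _ 2) ?nrm_ge0 // !nrm_sq; apply/eqP.
  under eq_bigr do rewrite l2_sq; under [RHS]eq_bigr do rewrite l2_sq.
  rewrite exchange_big [RHS]exchange_big /=; apply: eq_bigr => D _.
  have [bD|gD] := boolP (bad t.+1 D).
    transitivity (\sum_p Zst t.+1 p D ^+ 2); first by apply: eq_bigr => p _; rewrite /resZ /res bD.
    by rewrite Zst_unitary // Zpost_query; apply: eq_bigr => p _; rewrite /resZ /res bD.
  by rewrite !big1 // => p _; rewrite /resZ /res (negbTE gD) expr0n.
pose g := resZ (Good t) (Zst t); pose b := resZ (bad t) (Zst t).
have e2 : query (Zst t) = fun p D => query g p D + query b p D.
  apply/funext => p; apply/funext => D; rewrite /query.
  have E p' : Zst t p' = fun D' => g p' D' + b p' D'.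
    apply/funext => D'; rewrite /g /b /resZ /res /bad; case: (Good t D') => /=; by rewrite ?addr0 ?add0r.
  rewrite !E /Q.
  have -> : (fun D' => g (flip p) D' + b (flip p) D' - (g p D' + b p D')) =
     (fun D' => (g (flip p) D' - g p D') + (b (flip p) D' - b p D')).
    by apply/funext => D'; ring.
  by rewrite FsD resD FsD; ring.
have e3 : resZ (bad t.+1) (query (Zst t)) =
   fun p D => resZ (bad t.+1) (query g) p D + resZ (bad t.+1) (query b) p D.
  by apply/funext => p; rewrite e2 /resZ resD.
rewrite e1 e3; apply: (le_trans (nrmD _ _)).
have e4 : nrm (resZ (bad t.+1) (query b)) <= 2 * eps * t%:R * sqOm.
  by apply: le_trans (nrm_resZ_le _ _) _; rewrite nrm_query.
pose d p D := g (flip p) D - g p D.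
have e5 : nrm (resZ (bad t.+1) (query g)) <= eps * nrm d.
  apply: nrm_mono => // p.
  have E : res (bad t.+1) (query g p) = res (bad t.+1) (Q (cs (pix p)) (ft (pix p)) (d p)).
    apply/funext => D; rewrite /res /query; case: ifP => // bD.
    rewrite {1}/g /resZ /res; case: ifPn => [/GoodS|_]; last by rewrite add0r.
    by move=> gD; rewrite /bad gD in bD.
  rewrite /resZ E; apply: leak; first exact: leq_trans tT TT0.
  by move=> D nG; rewrite /d /g /resZ /res (negbTE nG) subrr.
have e6 : nrm d <= 2 * sqOm.
  have : nrm d <= nrm (fun p => g (flip p)) + nrm (fun p D => - g p D) by exact: nrmD.
  rewrite nrm_flip nrmN -(nrm_ZstE (ltnW tT)).
  by have := nrm_resZ_le (Good t) (Zst t); rewrite -/g; lra.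
have e7 : eps * nrm d <= eps * (2 * sqOm) by apply: ler_wpM2l.
rewrite -natr1; lra.
Qed.

Variables (ST : finType) (wS : ST -> pred 'I_n) (csS : ST -> seq Co) (bS : ST -> pred DB)
  (bw : ST -> pred Om) (eps' : RR).
Hypothesis wS_disj : forall u u' i, wS u i -> wS u' i -> u = u'.
Hypothesis csS_uniq : forall u, uniq (csS u).
Hypothesis bS_local : forall u (D : DB) c o, c \notin csS u -> bS u (upd D c o) = bS u D.
Hypothesis bS_total : forall u (D : DB), total D -> bS u D = bw u (vals v0 D).
Hypothesis eps'_ge0 : 0 <= eps'.
Hypothesis testS : forall t u h, (t < T0)%N -> supp h (Good t) ->
  l2 (res (bS u) (Fs (csS u) h)) <= eps' * l2 h.

Definition testZ (Z : P -> DB -> RR) (p : P) : DB -> RR :=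
  if [pick u | wS u (pix p)] is Some u then res (bS u) (Fs (csS u) (Z p)) else fun=> 0.

Lemma l2_testall u h : l2 (res (bS u) (Fs (all_co Co) h)) = l2 (res (bS u) (Fs (csS u) h)).
Proof.
by rewrite -(l2_Fs v0 (all_co Co)) (Q_all v0 _ (csS_uniq u)) ?(l2_Fs v0) //; exact: bS_local.
Qed.

(** The sets [wS u] are disjoint, so each component is tested against at most one [u] and the double
    sum is a squared norm. The good part passes the test with norm at most [eps'], and the bad part
    is small as a whole. *)
Lemma test_mass t : (t < T)%N ->
  \sum_w \sum_(u | bw u w) qmass A (x0 w) t (wS u) <= (eps' + 2 * eps * T%:R) ^+ 2 * #|{: Om}|%:R.
Proof.
move=> tT.
have -> : \sum_w \sum_(u | bw u w) qmass A (x0 w) t (wS u) = nrm (testZ (Zst t)) ^+ 2.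
  rewrite nrm_sq.
  have E p : l2 (testZ (Zst t) p) ^+ 2 =
     \sum_(u | wS u (pix p)) \sum_(w | bw u w) split_re (amp A (x0 w) t) p ^+ 2.
    rewrite /testZ; case: pickP => [u wSp|H]; last first.
      by rewrite /l2 big1 ?sqrtr0 ?expr0n ?big_pred0 // => D _; rewrite expr0n.
    rewrite (big_pred1 u) => [|u']; last first.
      by apply/idP/eqP => [h|-> //]; exact: wS_disj h wSp.
    rewrite -l2_testall /Zst (Fs_inv v0) l2_sq.
    transitivity (\sum_w (if bw u w then split_re (amp A (x0 w) t) p else 0) ^+ 2).
      rewrite -(sum_lift v0).
      apply: eq_bigr => D _; rewrite /res /lift; have [tD|] := boolP (total D).
        by rewrite bS_total //; case: ifP.
      by rewrite if_same.
    by rewrite [RHS]big_mkcond /=; apply: eq_bigr => w _; case: (bw u w) => //; rewrite expr0n.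
  under [RHS]eq_bigr do rewrite E.
  transitivity (\sum_u \sum_(p : P | wS u (pix p)) \sum_(w | bw u w) split_re (amp A (x0 w) t) p ^+ 2).
    transitivity (\sum_u \sum_(w | bw u w) qmass A (x0 w) t (wS u)).
      rewrite (exchange_big_dep xpredT) //=.
    apply: eq_bigr => u _; rewrite [RHS]exchange_big /=; apply: eq_bigr => w _.
    rewrite /qmass [LHS]big_mkcond [RHS]big_mkcond.
    rewrite -(pair_bigA _ (fun s b => if wS u s.1.1 then split_re (amp A (x0 w) t) (s, b) ^+ 2 else 0)) /=.
    by apply: eq_bigr => s _; rewrite big_bool /=; case: ifP; rewrite ?addr0.
  by rewrite (exchange_big_dep xpredT).
have e : nrm (testZ (Zst t)) <= (eps' + 2 * eps * T%:R) * sqOm.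
  pose g := resZ (Good t) (Zst t); pose b := resZ (bad t) (Zst t).
  have E : testZ (Zst t) = fun p D => testZ g p D + testZ b p D.
    apply/funext => p; apply/funext => D; rewrite /testZ; case: pickP => [u _|_]; last by rewrite addr0.
    have -> : Zst t p = fun D' => g p D' + b p D'.
      apply/funext => D'; rewrite /g /b /resZ /res /bad; case: (Good t D') => /=; by rewrite ?addr0 ?add0r.
    by rewrite FsD resD.
  rewrite E; apply: (le_trans (nrmD _ _)); rewrite mulrDl; apply: lerD.
    apply: (@le_trans _ _ (eps' * nrm g)); last first.
      by apply: ler_wpM2l => //; rewrite -(nrm_ZstE (ltnW tT)) nrm_resZ_le.
    apply: nrm_mono => // p; rewrite /testZ; case: pickP => [u _|_].
      apply: testS; first exact: leq_trans tT TT0.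
      by move=> D nG; rewrite /g /resZ /res (negbTE nG).
    by rewrite l2_0 mulr_ge0 ?l2_ge0.
  apply: (@le_trans _ _ (2 * eps * t%:R * sqOm)); last first.
    apply: ler_wpM2r; first exact: sqrtr_ge0.
    by apply: ler_wpM2l; rewrite ?mulr_ge0 // ler_nat ltnW.
  apply: le_trans (bad_weight (ltnW tT)); rewrite -/b -[leRHS]mul1r.
  apply: nrm_mono => // p; rewrite mul1r /testZ; case: pickP => [u _|_]; last by rewrite l2_0 l2_ge0.
  by apply: le_trans (res_le _ _) _; rewrite (l2_Fs v0).
have -> : (eps' + 2 * eps * T%:R) ^+ 2 * #|{: Om}|%:R = ((eps' + 2 * eps * T%:R) * sqOm) ^+ 2.
  by rewrite exprMn /sqOm sqr_sqrtr.
by rewrite lerXn2r // nnegrE ?nrm_ge0 // mulr_ge0 ?sqrtr_ge0 // addr_ge0 // !mulr_ge0.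
Qed.
End Evolution.

(** * Leakage of a query whose bit depends on several coordinates *)

Section TwoRegisterLeak.
Variables (Co G : finType) (v0 : G).
Local Notation DB := {ffun Co -> option G}.
Local Notation q := (#|G|%:R : RR).
Implicit Types (g h : DB -> RR).

Lemma sum_Fs_Fs l g h : \sum_D Fs l g D * Fs l h D = \sum_D g D * h D.
Proof.
have N (a : DB -> RR) : \sum_D Fs l a D ^+ 2 = \sum_D a D ^+ 2.
  by rewrite -[LHS]l2_sq -[RHS]l2_sq (l2_Fs v0).
have := N (fun D => g D + h D); rewrite FsD.
under eq_bigr do rewrite sqrrD; under [RHS]eq_bigr do rewrite sqrrD.
rewrite !big_split /= !N => /addIr/addrI.
have E (a b : DB -> RR) : \sum_D a D * b D *+ 2 = 2 * \sum_D a D * b D.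
  by rewrite mulr_sumr; apply: eq_bigr => D _; rewrite -[LHS]mulr_natl.
have := E g h; have := E (Fs l g) (Fs l h); rewrite !big_split /= => -> -> H; lra.
Qed.

Lemma Fs_adj l g h : \sum_D Fs l g D * h D = \sum_D g D * Fs l h D.
Proof. by rewrite -[in LHS](Fs_inv v0 l h) sum_Fs_Fs. Qed.

(** Adjoint of [res_Fs_le]: [Fs l] is symmetric, so it moves as little from [R] to the complement as
    from the complement into [R]. *)
Lemma res_compl_Fs_le l (R : pred DB) (r : nat) X :
  (forall c D, c \in l -> R D -> D c != None) ->
  (forall c D, c \in l -> #|[pred v | R (upd D c (Some v))]| <= r)%N ->
  supp X R ->
  l2 (res (fun D => ~~ R D) (Fs l X)) <= (size l)%:R * Num.sqrt (2 * r%:R / q) * l2 X.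
Proof.
move=> RN Rr sX; set Y := res _ _; set a := _ * Num.sqrt _.
have h0 : l2 (res R Y) = 0.
  rewrite (_ : res R Y = fun=> 0) ?l2_0 //.
  by apply/funext => D; rewrite /Y /res; case: (R D).
have h1 : l2 (res R (Fs l Y)) <= a * l2 Y.
  by have := res_Fs_le v0 Y RN Rr; rewrite h0 add0r.
have h2 : l2 Y ^+ 2 = \sum_D res R (Fs l Y) D * X D.
  rewrite l2_sq; transitivity (\sum_D Y D * Fs l X D).
    by apply: eq_bigr => D _; rewrite /Y /res; case: (~~ R D); rewrite ?mul0r ?expr0n.
  rewrite -Fs_adj; apply: eq_bigr => D _; rewrite /res; case: ifPn => // /sX ->.
  by rewrite !mulr0.
have h3 := CauchySchwarz_sum (res R (Fs l Y)) X.
rewrite -h2 in h3.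
have := l2_ge0 Y; rewrite le_eqVlt => /orP[/eqP <-|Y0].
  by rewrite !mulr_ge0 ?l2_ge0 ?sqrtr_ge0.
rewrite -(ler_pM2l Y0) -expr2; apply: (le_trans h3).
apply: (@le_trans _ _ (a * l2 Y * l2 X)); last by rewrite mulrCA mulrA.
by apply: ler_wpM2r; rewrite ?l2_ge0.
Qed.

Lemma Fs_eq0 (l : seq Co) h (D : DB) :
  (forall D' : DB, (forall c, c \notin l -> D' c = D c) -> h D' = 0) -> Fs l h D = 0.
Proof.
elim: l D => [|c l IH] D H /=; first exact: H.
rewrite /F big1 // => o _; rewrite IH ?mulr0 // => D' D'D; apply: H => c'.
rewrite inE negb_or => /andP[c'c c'l].
by rewrite D'D // updE (negbTE c'c).
Qed.

(* The tested predicate is a conjunction: off [R], the coordinates in [l] would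
   have to complete [R]; on [R], which they almost preserve, only the coordinate
   [s] matters and the single-coordinate estimate applies. *)
Lemma leak_two_registers s l (R fs f Good Bad : pred DB) (r : nat) h :
  (forall D, f D = R D && fs D) -> s \notin l ->
  (forall D c o, c \in l -> fs (upd D c o) = fs D) ->
  (forall D o, R (upd D s o) = R D) ->
  (forall c D, c \in l -> R D -> D c != None) ->
  (forall c D, c \in l -> #|[pred v | R (upd D c (Some v))]| <= 1)%N ->
  (forall D D', R D -> R D' -> (forall c, c \notin l -> D c = D' c) -> Good D -> Good D') ->
  (forall D, Good D -> ~~ Bad D) ->
  (forall D o, R D -> Good (upd D s o) -> Bad D -> D s != None) ->
  (forall D o, R D -> Good (upd D s o) -> #|[pred v | Bad (upd D s (Some v))]| <= r)%N ->
  supp h Good ->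
  l2 (res Bad (Q (s :: l) f h)) <=
    (2 * ((size l)%:R * Num.sqrt (2 / q)) + 2 * Num.sqrt (2 * r%:R / q)) * l2 h.
Proof.
move=> fE sl fsl Rs RN R1 GR GB BN Br hG.
set k1 := (size l)%:R * _; set k2 := Num.sqrt (2 * r%:R / q).
have k10 : 0 <= k1 by rewrite mulr_ge0 ?sqrtr_ge0.
have k1E : (size l)%:R * Num.sqrt (2 * 1%:R / q) = k1 by rewrite /k1 mulr1.
pose h1 := res R h; pose h2 := res (fun D => ~~ R D) h.
pose X := res f (F s (Fs l h1)).
have Rcomm a : res R (F s a) = F s (res R a) by rewrite F_res_comm // => D o; exact: Rs.
have E1 : Q (s :: l) f h = fun D => Q (s :: l) f h2 D + F s (Fs l X) D.
  have -> : h = fun D => h2 D + h1 D.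
    by apply/funext => D; rewrite /h1 /h2 /res; case: (R D); rewrite ?addr0 ?add0r.
  by rewrite {1}/Q FsD resD FsD.
have a1 : l2 (Q (s :: l) f h2) <= k1 * l2 h.
  rewrite /Q (l2_Fs v0) /=.
  apply: (@le_trans _ _ (l2 (res R (F s (Fs l h2))))).
    apply: l2_mono => D; rewrite /res fE; case: (R D) => //=; case: (fs D) => //.
    by rewrite expr0n sqr_ge0.
  rewrite Rcomm (l2_F v0); have := res_Fs_le v0 h2 RN R1; rewrite k1E.
  have -> : res R h2 = fun=> 0 by apply/funext => D; rewrite /h2 /res; case: (R D).
  rewrite l2_0 add0r => /le_trans; apply; apply: ler_wpM2l => //; exact: res_le.
have X_le : l2 X <= l2 h.
  apply: le_trans (res_le _ _) _; rewrite (l2_F v0) (l2_Fs v0); exact: res_le.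
have sX : supp X R by move=> D nR; rewrite /X /res fE (negbTE nR).
have a2 : l2 (res (fun D => ~~ R D) (Fs l X)) <= k1 * l2 h.
  have := res_compl_Fs_le RN R1 sX; rewrite k1E => /le_trans; apply.
  exact: ler_wpM2l.
(* The part that is in [R] before, between and after the two changes of basis on [l]. As [F s]
   commutes with [R], the query acts on it as a query to [s] alone. *)
pose h' := res R (Fs l (res R (Fs l h1))).
have h'_le : l2 h' <= l2 h.
  apply: le_trans (res_le _ _) _; rewrite (l2_Fs v0).
  apply: le_trans (res_le _ _) _; rewrite (l2_Fs v0); exact: res_le.
have E2 : F s (res R (Fs l X)) = Q [:: s] fs h'.
  rewrite /Q /=; congr (F s _).
  have -> : X = res fs (res R (F s (Fs l h1))).
    by apply/funext => D; rewrite /X /res fE; case: (R D); case: (fs D).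
  rewrite Fs_res_comm; last by move=> c D o cl; exact: fsl.
  rewrite Rcomm -F_Fs.
  transitivity (res fs (res R (F s (Fs l (res R (Fs l h1)))))).
    by apply/funext => D; rewrite /res; case: (R D); case: (fs D).
  by rewrite Rcomm.
have a3 : l2 (res Bad (Q [:: s] fs h')) <= 2 * k2 * l2 h'.
  apply: (@leak_one_register _ _ v0 _ _ (fun D => Good D && R D)).
  - move=> D; rewrite negb_and /h' /res; case: ifPn => // RD; rewrite orbF => nG.
    apply: Fs_eq0 => D' D'D; case: ifP => // RD'.
    apply: Fs_eq0 => D2 D2D'; rewrite /h1 /res; case: ifP => // RD2.
    apply: hG; apply: contra nG => GD2; apply: GR GD2 => // c cl.
    by rewrite D2D' // D'D.
  - by move=> D /andP[/GB].
  - by move=> D o /andP[hg]; rewrite Rs => hr; exact: BN hr hg.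
  - by move=> D o /andP[hg]; rewrite Rs => hr; exact: Br hr hg.
have E3 : F s (Fs l X) = fun D => F s (res (fun D => ~~ R D) (Fs l X)) D + Q [:: s] fs h' D.
  rewrite -E2 -FD; congr (F s _); apply/funext => D; rewrite /res.
  by case: (R D); rewrite ?addr0 ?add0r.
rewrite E1 E3 resD; apply: (le_trans (l2D _ _)).
have b1 := res_le Bad (Q (s :: l) f h2).
rewrite resD; have b2 := l2D (res Bad (F s (res (fun D => ~~ R D) (Fs l X)))) (res Bad (Q [:: s] fs h')).
have b3 := res_le Bad (F s (res (fun D => ~~ R D) (Fs l X))).
rewrite (l2_F v0) in b3.
have b4 : k2 * l2 h' <= k2 * l2 h by apply: ler_wpM2l => //; exact: sqrtr_ge0.
lra.
Qed.

End TwoRegisterLeak.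

(** * Solutions of random k-sum instances *)

Section KSum.
Variables (k : nat) (M : finType) (G : finZmodType).
Local Notation Pt := {ffun 'I_k -> M}.
Local Notation I := ('I_k * M)%type.
Implicit Types (tau : Pt -> G) (P : Pt).

Definition sol tau (w : I -> G) P : bool := \sum_j w (j, P j) == tau P.
Definition nsol tau w : nat := #|[pred P | sol tau w P]|.

Definition rsol tau (w : I -> option G) P : bool :=
  [forall j, w (j, P j) != None] && sol tau (fun i => odflt 0 (w i)) P.

Definition cupd (w : I -> option G) i v : I -> option G :=
  fun i' => if i' == i then Some v else w i'.

(** The completing value is determined by the other [k - 1] symbols of the point, each of which must
    be among the [N] recorded ones. *)
Lemma card_completions tau w j a (N : nat) :
  (#|[pred i | w i != None]| <= N)%N ->
  (#|[pred v | [exists P : Pt, (P j == a) && rsol tau (cupd w (j, a) v) P]]| <= N ^ k.-1)%N.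
Proof.
move=> wN.
pose Fam (j' : 'I_k) : pred M := if j' == j then pred1 a else [pred x | w (j', x) != None].
pose g P := tau P - \sum_(j' | j' != j) odflt 0 (w (j', P j')).
apply: (@leq_trans #|family Fam|).
  apply: leq_trans (leq_image_card g _); apply: subset_leq_card.
  apply/fintype.subsetP => v; rewrite !inE => /existsP[P /andP[/eqP Pj /andP[/forallP Pr /eqP Ps]]].
  apply/fintype.imageP; exists P.
    apply/familyP => j'; rewrite /Fam /in_mem /=; have [->|jj] := eqVneq j' j.
      by rewrite /= Pj.
    have := Pr j'; rewrite /cupd; have [[jE _]|_ //] := eqVneq (j', P j') (j, a).
    by rewrite jE eqxx in jj.
  rewrite /g -Ps (bigD1 j) //= {1}/cupd Pj eqxx /=.
  rewrite (eq_bigr (fun j' => odflt 0 (w (j', P j')))) ?addrK // => j' jj.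
  by rewrite /cupd; case: eqP => // -[jE _]; rewrite jE eqxx in jj.
rewrite card_family foldrE big_map big_enum /= (bigD1 j) //=.
rewrite {1}/Fam eqxx card1 mul1n.
apply: (@leq_trans (\prod_(j' | j' != j) N)).
  apply: leq_prod => j' jj; rewrite /Fam (negbTE jj); apply: leq_trans wN.
  rewrite -(card_imset _ (_ : injective (fun x => (j', x)))); last by move=> x y [].
  by apply: subset_leq_card; apply/fintype.subsetP => i /imsetP[x]; rewrite inE => h ->; rewrite inE.
by rewrite prod_nat_const cardC1 card_ord.
Qed.

Lemma sol_ext tau (w w' : I -> G) : w =1 w' -> sol tau w =1 sol tau w'.
Proof. by move=> e P; rewrite /sol; congr (_ == _); apply: eq_bigr => j _; rewrite e. Qed.

Local Notation q := #|G|.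

(* Bernoulli's inequality for [(1 - 1 / (c + 1)) ^ h], cleared of denominators. *)
Lemma bernoulli_nat (c h : nat) : (h <= c.+1 -> c.+1 ^ h * (c.+1 - h) <= c ^ h * c.+1)%N.
Proof.
elim: h => [|h IH] hc; first by rewrite !expn0 subn0.
have {}IH := IH (ltnW hc).
apply: (@leq_trans (c * (c.+1 ^ h * (c.+1 - h)))); last by rewrite expnS -mulnA leq_mul2l IH orbT.
rewrite expnS -mulnA mulnCA [leqRHS]mulnCA leq_mul2l; apply/orP; right.
by nia.
Qed.

(** Bernoulli on half of the exponent gives the factor 2; squaring gives 4. *)
Lemma succ_pow_le (h : nat) : ((2 * h).+1 ^ (2 * h) <= 4 * (2 * h) ^ (2 * h))%N.
Proof.
have H : ((2 * h).+1 ^ h <= 2 * (2 * h) ^ h)%N.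
  have := @bernoulli_nat (2 * h) h; rewrite ltnW ?ltnS ?leq_pmull // => /(_ isT).
  have -> : ((2 * h).+1 - h = h.+1)%N by lia.
  move=> E; rewrite -(@leq_pmul2r h.+1) //; apply: (leq_trans E).
  by rewrite [X in (_ <= X * _)%N]mulnC -mulnA leq_mul2l; apply/orP; right; lia.
have E (b : nat) : (b ^ (2 * h) = (b ^ h) ^ 2)%N by rewrite mulnC expnM.
rewrite !E.
have -> : (4 * ((2 * h) ^ h) ^ 2 = (2 * (2 * h) ^ h) ^ 2)%N by rewrite [RHS]expnMn.
by rewrite leq_exp2r.
Qed.

(* First moment: averaged over [tau], the weight [2 ^ nsol tau w] is
   [(1 + 1 / q) ^ #|Pt|], which is at most [4 ^ lam]. *)
Lemma exists_few_solutions (h lam : nat) : q = (2 * h)%N -> (0 < h)%N ->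
  #|{: Pt}| = (q * lam)%N ->
  exists tau, forall w : I -> G, (2 ^ nsol tau w <= q ^ #|{: I}| * 4 ^ lam)%N.
Proof.
move=> qh h0 PtE.
have tot : (\sum_(tau : {ffun Pt -> G}) \sum_(w : {ffun I -> G}) 2 ^ nsol tau w =
   q ^ #|{: I}| * q.+1 ^ #|{: Pt}|)%N.
  rewrite exchange_big /=.
  rewrite -(card_ffun I G) -sum_nat_const; apply: eq_bigr => w _.
  transitivity (\prod_(P : Pt) \sum_(g : G) (if (\sum_j w (j, P j))%R == g then 2 else 1))%N.
    rewrite bigA_distr_bigA /=; apply: eq_bigr => tau _.
    by rewrite -[RHS]big_mkcond /= prod_nat_const; congr (2 ^ _)%N; apply: eq_card => P; rewrite !inE.
  rewrite (eq_bigr (fun=> q.+1)) ?prod_nat_const // => P _.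
  rewrite (bigD1 (\sum_j w (j, P j))) //= eqxx.
  rewrite (eq_bigr (fun=> 1%N)) => [|g /negbTE]; last by rewrite eq_sym => ->.
  by rewrite sum_nat_const muln1 cardC1 add2n prednK // qh muln_gt0.
have [tau Htau] : exists tau : {ffun Pt -> G},
   (\sum_(w : {ffun I -> G}) 2 ^ nsol tau w <= q ^ #|{: I}| * 4 ^ lam)%N.
  apply/existsP; apply: contraT; rewrite negb_exists => /forallP H.
  have : (\sum_(tau : {ffun Pt -> G}) (q ^ #|{: I}| * 4 ^ lam) <
      \sum_(tau : {ffun Pt -> G}) \sum_(w : {ffun I -> G}) 2 ^ nsol tau w)%N.
    rewrite (bigD1 ([ffun=> 0] : {ffun Pt -> G})) // [ltnRHS](bigD1 ([ffun=> 0] : {ffun Pt -> G})) //= -addSn leq_add //.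
      by rewrite ltnNge.
    by apply: leq_sum => tau _; rewrite ltnW // ltnNge.
  rewrite tot sum_nat_const card_ffun PtE !expnM ltnNge mulnCA leq_mul2l -expnMn.
  have [->|l0] := posnP lam; first by rewrite !expn0 leqnn orbT.
  by rewrite leq_exp2r // mulnC qh succ_pow_le orbT.
exists tau => w.
apply: leq_trans Htau; rewrite (bigD1 (finfun w)) //= -[leqLHS]addn0 leq_add //.
by rewrite /nsol; apply/eq_leq; congr (2 ^ _)%N; apply: eq_card => P; rewrite !inE; apply: sol_ext => i; rewrite ffunE.
Qed.

Variables (Co : finType) (emb : I -> Co).
Hypothesis emb_inj : injective emb.
Local Notation Om := {ffun Co -> G}.

Definition shift_at (c : Co) (a : G) (w : Om) : Om :=
  [ffun i => if i == c then w i + a else w i].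

Lemma shiftE c a w i : shift_at c a w i = if i == c then w i + a else w i.
Proof. by rewrite ffunE. Qed.

Lemma shift_inj c a : injective (shift_at c a).
Proof.
move=> w w' /ffunP e; apply/ffunP => i; have := e i; rewrite !shiftE.
by case: ifP => // _ /addIr.
Qed.

(** Adding to the symbol at [c] runs through all values of [f] without affecting [p]: conditioned on
    [p], the value of [f] is uniform. *)
Lemma card_shift c (f : Om -> G) (p : pred Om) g :
  (forall a w, f (shift_at c a w) = f w + a) -> (forall a w, p (shift_at c a w) = p w) ->
  (#|[pred w | (f w == g) && p w]| * q = #|p|)%N.
Proof.
move=> fs ps.
have E g' : #|[pred w | (f w == g') && p w]| = #|[pred w | (f w == g) && p w]|.
  rewrite -(fintype.card_image (@shift_inj c (g - g'))); apply: eq_card => w.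
  apply/fintype.imageP/idP => [[w' + ->]|]; rewrite !inE.
    by rewrite fs ps => /andP[/eqP -> ->]; rewrite addrC subrK eqxx.
  move=> /andP[/eqP fw pw]; exists (shift_at c (g' - g) w).
    by rewrite !inE fs ps pw fw addrC subrK eqxx.
  apply/ffunP => i; rewrite !shiftE; have [_|//] := eqVneq i c.
  by rewrite -addrA [_ + (g - g')]addrA subrK subrr addr0.
rewrite -[RHS]sum1_card [RHS](partition_big f xpredT) //=.
under [RHS]eq_bigr => g' _.
  rewrite sum1_card (_ : #|_| = #|[pred w | (f w == g) && p w]|).
    over.
  by rewrite -(E g'); apply: eq_card => w; rewrite !inE andbC.
by rewrite sum_nat_const mulnC.
Qed.

Lemma sum_shift j P a (w : Om) : \sum_j' shift_at (emb (j, P j)) a w (emb (j', P j')) = \sum_j' w (emb (j', P j')) + a.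
Proof.
rewrite (bigD1 j) //= shiftE eqxx [in RHS](bigD1 j) //= addrAC; congr (_ + _ + _).
by apply: eq_bigr => j' jj; rewrite shiftE; case: eqP => // /emb_inj[e]; rewrite e eqxx in jj.
Qed.

Lemma card_sol tau P : (0 < k)%N -> (#|[pred w : Om | sol tau (w \o emb) P]| * q = #|{: Om}|)%N.
Proof.
move=> k0; pose j := Ordinal k0.
rewrite -(@card_shift (emb (j, P j)) (fun w => \sum_j w (emb (j, P j))) xpredT (tau P)) //.
  by congr (_ * _)%N; apply: eq_card => w; rewrite !inE andbT.
by move=> a w; rewrite sum_shift.
Qed.

(** A symbol used by [P] and not by [P'] can be shifted, which makes the sum at [P] uniform given
    that [P'] is a solution. *)
Lemma card_sol2 tau P P' : P != P' ->
  (#|[pred w : Om | sol tau (w \o emb) P && sol tau (w \o emb) P']| * q * q = #|{: Om}|)%N.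
Proof.
move=> PP'; have [j jj] : exists j, P j != P' j.
  apply/existsP; apply: contraT; rewrite negb_exists => /forallP H.
  by case/eqP: PP'; apply/ffunP => j; apply/eqP; have := H j; rewrite negbK.
have k0 : (0 < k)%N by case: j {jj} => ? /(leq_ltn_trans _); apply.
rewrite -(card_sol tau P' k0); congr (_ * _)%N.
apply: (@card_shift (emb (j, P j)) (fun w => \sum_j w (emb (j, P j))) (fun w => sol tau (w \o emb) P') (tau P)).
  by move=> a w; rewrite sum_shift.
move=> a w; rewrite /sol; congr (_ == _); apply: eq_bigr => j' _; rewrite /= shiftE.
by case: eqP => // /emb_inj[-> e]; rewrite e eqxx in jj.
Qed.

(* Chebyshev's inequality: distinct points are solutions pairwise independently. *)
Lemma few_unsolvable tau (lam : nat) : (0 < k)%N -> #|{: Pt}| = (q * lam)%N ->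
  (#|[pred w : Om | nsol tau (w \o emb) == 0]| * lam <= #|{: Om}|)%N.
Proof.
move=> k0 PtE; have [->|l0] := posnP lam; first by rewrite muln0.
set NO := #|{: Om}|.
have q0 : (0 < q)%N by apply/card_gt0P; exists 0.
have qR : (q%:R : RR) != 0 by rewrite pnatr_eq0 -lt0n.
pose X (w : Om) : RR := \sum_P (sol tau (w \o emb) P)%:R.
have XE w : X w = (nsol tau (w \o emb))%:R.
  by rewrite /X -natr_sum /nsol -sum1_card [in RHS]big_mkcond; congr (_%:R); apply: eq_bigr => P _; rewrite inE; case: sol.
have cnt (p : pred Om) : \sum_w (p w)%:R = #|p|%:R :> RR.
  by rewrite -natr_sum -sum1_card [in RHS]big_mkcond; congr (_%:R); apply: eq_bigr => w _; case: (p w).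
have s1 : \sum_w X w = lam%:R * NO%:R.
  rewrite /X exchange_big /=.
  under eq_bigr => P _.
    rewrite (cnt (fun w => sol tau (w \o emb) P)) (_ : #|_|%:R = NO%:R / q%:R).
      over.
    rewrite /NO -(card_sol tau P k0) natrM mulfK //.
  by rewrite sumr_const -[LHS]mulr_natl PtE natrM; field.
have s2 : \sum_w X w ^+ 2 <= (lam%:R + lam%:R ^+ 2) * NO%:R.
  under eq_bigr => w _ do rewrite expr2 /X mulr_suml; rewrite exchange_big /=.
  under eq_bigr => P _.
    under eq_bigr => w _ do rewrite mulr_sumr; rewrite exchange_big /=.
    over.
  apply: (@le_trans _ _ (\sum_(P : Pt) (NO%:R / q%:R + \sum_(P' : Pt) NO%:R / (q%:R * q%:R)))).
    apply: ler_sum => P _; rewrite (bigD1 P) //=; apply: lerD.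
      under eq_bigr => w _ do rewrite -natrM mulnb andbb.
      by rewrite (cnt (fun w => sol tau (w \o emb) P)) /NO -(card_sol tau P k0) natrM mulfK.
    rewrite big_mkcond; apply: ler_sum => P' _; case: ifPn => [PP'|_]; last first.
      by rewrite divr_ge0 // mulr_ge0.
    under eq_bigr => w _ do rewrite -natrM mulnb.
    rewrite (cnt (fun w => sol tau (w \o emb) P && sol tau (w \o emb) P')) eq_sym in PP' *.
    by rewrite /NO -(card_sol2 tau PP') !natrM -[X in X / _]mulrA mulfK // mulf_neq0.
  rewrite !sumr_const -[leLHS]mulr_natl -[X in _ * (_ + X)]mulr_natl PtE natrM.
  by rewrite le_eqVlt; apply/orP; left; apply/eqP; field.
have s3 : \sum_w (X w - lam%:R) ^+ 2 <= lam%:R * NO%:R.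
  under eq_bigr => w _ do rewrite sqrrB.
  rewrite !big_split /= sumr_const -[X in _ + X]mulr_natl.
  have -> : \sum_w (- (X w * lam%:R *+ 2)) = - 2 * lam%:R * (lam%:R * NO%:R).
    rewrite -s1 mulr_sumr; apply: eq_bigr => w _; rewrite -[X in - X]mulr_natl; ring.
  rewrite -/NO; lra.
have s4 : #|[pred w : Om | nsol tau (w \o emb) == 0]|%:R * lam%:R ^+ 2 <= \sum_w (X w - lam%:R) ^+ 2.
  rewrite -cnt mulr_suml; apply: ler_sum => w _ /=; rewrite XE.
  by case: eqP => [->|_]; rewrite ?sub0r ?sqrrN ?mul1r // mul0r sqr_ge0.
have l0R : 0 < (lam%:R : RR) by rewrite ltr0n.
rewrite -(ler_nat RR) natrM -(ler_pM2l l0R); apply: le_trans s3; apply: le_trans s4.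
by rewrite expr2 le_eqVlt; apply/orP; left; apply/eqP; ring.
Qed.

End KSum.

(** * The two-level k-sum function and its approximate degree *)

Section CheckedKSum.
Variables (k a t : nat) (G : finZmodType).
Local Notation M := {ffun 'I_a -> bool}.
Local Notation Pt := {ffun 'I_k -> M}.
Local Notation I := ('I_k * M)%type.
Variables (dec : {ffun 'I_t -> bool} -> G) (tau : Pt -> G).
(* An input consists of a column [y_b : I -> G] and a table [Z_b : Pt -> G] for
   every [b : I], and of a cell for every [S : Pt], which holds one hint in [Pt]
   for each [b] together with a flag. *)
Definition ksum_var := (I * I * 'I_t + I * Pt * 'I_t + Pt * option (I * 'I_k * 'I_a))%type.
Local Notation J := ksum_var.
Implicit Types (v : J -> bool) (b : I) (S P : Pt).

Definition ycol v b (i : I) : G := dec [ffun e => v (inl (inl (b, i, e)))].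
Definition zval v b P : G := dec [ffun e => v (inl (inr (b, P, e)))].
Definition hint v S b : Pt := [ffun j => [ffun e => v (inr (S, Some (b, j, e)))]].
Definition flag v S : bool := v (inr (S, None)).
Definition uval v S b : G := zval v b (hint v S b).
Definition before S' S := (enum_rank S' < enum_rank S)%N.

(* The hints name solutions of all columns, the values read there have [S] as
   their first solution, and on the columns of [S] every solution gives the same
   value. The last condition makes the valid cell unique: another valid cell
   reads the same values on [S], so that [S] solves its outer instance too. *)
Definition valid v S : bool :=
  [&& [forall b, sol tau (ycol v b) (hint v S b)],
      sol tau (uval v S) S,
      [forall S', before S' S ==> ~~ sol tau (uval v S) S'],
      [forall j, [forall P, sol tau (ycol v (j, S j)) P ==>
         (zval v (j, S j) P == uval v S (j, S j))]]
    & flag v S].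

Definition checked_ksum v : bool := [exists S, valid v S].

Lemma valid_uniq v S S' : valid v S -> valid v S' -> S = S'.
Proof.
suff H S1 S2 : valid v S1 -> valid v S2 -> ~~ before S1 S2.
  move=> vS vS'; have := H _ _ vS vS'; have := H _ _ vS' vS; rewrite /before -!leqNgt => h1 h2.
  by apply/enum_rank_inj/val_inj/eqP; rewrite eqn_leq h1 h2.
move=> /and5P[/forallP i1 ii1 _ iii1 _] /and5P[/forallP i2 ii2 /forallP f2 iii2 _].
apply/negP => bf; have := f2 S1; rewrite bf /= => /negP; apply.
rewrite /sol in ii1 *; rewrite -(eqP ii1); apply/eqP; apply: eq_bigr => j _.
have /forallP/(_ (hint v S2 (j, S1 j))) := forallP iii1 j.
by rewrite i2 /= => /eqP.
Qed.

Definition nviol v S : nat :=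
  \sum_b (~~ sol tau (ycol v b) (hint v S b))
  + (~~ sol tau (uval v S) S)
  + \sum_(S' | before S' S) sol tau (uval v S) S'
  + \sum_j \sum_P (sol tau (ycol v (j, S j)) P && (zval v (j, S j) P != uval v S (j, S j)))
  + ~~ flag v S.

Lemma nviol_eq0 v S : (nviol v S == 0)%N = valid v S.
Proof.
rewrite /nviol !addn_eq0 !sum_nat_eq0 /valid -!andbA; congr [&& _, _, _, _ & _].
- by apply: eq_forallb => b; rewrite eqb0 negbK.
- by rewrite eqb0 negbK.
- by apply: eq_forallb => S'; rewrite eqb0.
- apply: eq_forallb => j; rewrite sum_nat_eq0; apply: eq_forallb => P.
  by rewrite eqb0; case: (sol _ _ _) => //=; rewrite negbK.
- by rewrite eqb0 negbK.
Qed.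

(** The sums run over exponentially many points, but only solutions contribute. The bound [L] is
    required of every [w] because [v] is arbitrary and need not be a typical input. *)
Lemma nviol_le v S L : (forall w, nsol tau w <= L)%N ->
  (nviol v S <= #|{: I}| + 2 + k.+1 * L)%N.
Proof.
move=> HL.
have h1 : (\sum_b (~~ sol tau (ycol v b) (hint v S b)) <= #|{: I}|)%N.
  by rewrite -sum1_card; apply: leq_sum => b _; exact: leq_b1.
have ns w : (\sum_P (sol tau w P : nat) = nsol tau w)%N.
  rewrite /nsol -sum1_card [RHS]big_mkcond; apply: eq_bigr => P _.
  by rewrite inE; case: (sol _ _ _).
have h2 : (\sum_(S' | before S' S) sol tau (uval v S) S' <= L)%N.
  apply: leq_trans (HL (uval v S)); rewrite -ns [leqRHS](bigID (fun S' => before S' S)) /=.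
  exact: leq_addr.
have h3 : (\sum_j \sum_P (sol tau (ycol v (j, S j)) P && (zval v (j, S j) P != uval v S (j, S j))) <= k * L)%N.
  rewrite -[X in (_ <= X * _)%N](card_ord k) -sum_nat_const; apply: leq_sum => j _.
  apply: leq_trans (HL (ycol v (j, S j))); rewrite -ns; apply: leq_sum => P _.
  by case: (sol _ _ _) => //=; exact: leq_b1.
have h4 : (~~ sol tau (uval v S) S <= 1)%N by exact: leq_b1.
have h5 : (~~ flag v S <= 1)%N by exact: leq_b1.
by rewrite /nviol; lia.
Qed.

Variables (n : nat) (iota : J -> 'I_n).
Local Notation inp x := (fun u => (x : bits n) (iota u)).
Definition ksum_fun (x : bits n) : bool := checked_ksum (inp x).

Lemma fdeg_ycol b i : fdeg t (fun x : bits n => ycol (inp x) b i).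
Proof.
apply: fdeg_map; rewrite -[t in fdeg t _]muln1 -[X in fdeg (X * _)](card_ord t).
by apply: fdeg_ffun => e; exact: fdeg_bit.
Qed.

Lemma fdeg_zval b P : fdeg t (fun x : bits n => zval (inp x) b P).
Proof.
apply: fdeg_map; rewrite -[t in fdeg t _]muln1 -[X in fdeg (X * _)](card_ord t).
by apply: fdeg_ffun => e; exact: fdeg_bit.
Qed.

Lemma fdeg_hint S b : fdeg (k * a) (fun x : bits n => hint (inp x) S b).
Proof.
rewrite -[X in fdeg (X * _)](card_ord k); apply: fdeg_ffun => j.
rewrite -[a in fdeg a _]muln1 -[X in fdeg (X * _)](card_ord a).
by apply: fdeg_ffun => e; exact: fdeg_bit.
Qed.

Lemma fdeg_uval S b : fdeg (k * a + t) (fun x : bits n => uval (inp x) S b).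
Proof. exact: (fdeg_bind (fdeg_hint S b) (fun P => fdeg_zval b P)). Qed.

Lemma fdeg_sol d (w : bits n -> I -> G) P : (forall i, fdeg d (w^~ i)) ->
  fdeg (k * d) (fun x => sol tau (w x) P).
Proof.
move=> H; have := fdeg_ffun (fun j => H (j, P j)); rewrite card_ord => H2.
have := fdeg_map (fun u : {ffun 'I_k -> G} => \sum_j u j == tau P) H2.
congr fdeg; apply/funext => x; rewrite /sol; congr (_ == _).
by apply: eq_bigr => j _; rewrite ffunE.
Qed.

(** A common depth for all terms: [k] reads of a hint and a value for a solution test, two more for
    comparing table entries, and one to cover the flag. *)
Definition viol_deg := (k.+2 * (k * a + t)).+1.

Lemma pdeg_nviol S : @pdeg RR n viol_deg (fun x : bits n => (nviol (inp x) S)%:R).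
Proof.
have H1 b : fdeg viol_deg (fun x : bits n => ~~ sol tau (ycol (inp x) b) (hint (inp x) S b)).
  apply: fdeg_map; apply: (@fdeg_leq _ _ (k * a + k * t)); first by rewrite /viol_deg; nia.
  apply: (@fdeg_bind _ _ _ _ _ _ (fun P x => sol tau (ycol (inp x) b) P) (fdeg_hint S b)) => P.
  by apply: fdeg_sol => i; exact: fdeg_ycol.
have H2 S' : fdeg viol_deg (fun x : bits n => sol tau (uval (inp x) S) S').
  apply: (@fdeg_leq _ _ (k * (k * a + t))); first by rewrite /viol_deg; nia.
  by apply: fdeg_sol => i; exact: fdeg_uval.
have H3 j P : fdeg viol_deg (fun x : bits n => sol tau (ycol (inp x) (j, S j)) P &&
     (zval (inp x) (j, S j) P != uval (inp x) S (j, S j))).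
  apply: (@fdeg_leq _ _ (k * t + (t + (k * a + t)))); first by rewrite /viol_deg; nia.
  apply: (@fdeg_bind _ _ _ _ _ _ (fun u x => u && (zval (inp x) (j, S j) P != uval (inp x) S (j, S j)))).
    by apply: fdeg_sol => i; exact: fdeg_ycol.
  move=> u; apply: (@fdeg_bind _ _ _ _ _ _ (fun z x => u && (z != uval (inp x) S (j, S j)))).
    exact: fdeg_zval.
  by move=> z; apply: (fdeg_map (fun z' => u && (z != z'))); exact: fdeg_uval.
have H4 : fdeg viol_deg (fun x : bits n => ~~ flag (inp x) S).
  by apply: fdeg_map; apply: (@fdeg_leq _ _ 1) => //; exact: fdeg_bit.
have S1 (T : Type) (r : seq T) (p : pred T) (f : T -> bits n -> bool) : (forall u, fdeg viol_deg (f u)) ->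
    @pdeg RR n viol_deg (fun x : bits n => (\sum_(u <- r | p u) f u x)%:R).
  move=> H; apply: (@pdeg_ext _ _ _ (fun x : bits n => \sum_(u <- r | p u) (f u x)%:R)).
    by move=> x; rewrite natr_sum.
  by apply: pdeg_sum => u _; apply: fdeg_bool.
apply: (@pdeg_ext _ _ _ (fun x : bits n =>
  (\sum_b (~~ sol tau (ycol (inp x) b) (hint (inp x) S b)))%:R
  + (~~ sol tau (uval (inp x) S) S)%:R
  + (\sum_(S' | before S' S) sol tau (uval (inp x) S) S')%:R
  + \sum_j (\sum_P (sol tau (ycol (inp x) (j, S j)) P && (zval (inp x) (j, S j) P != uval (inp x) S (j, S j))))%:R
  + (~~ flag (inp x) S)%:R)).
  by move=> x; rewrite /nviol !natrD natr_sum [in RHS]natr_sum [X in _ = _ + _ + _ + X + _]natr_sum natr_sum.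
apply: pdeg_add; first (apply: pdeg_add; first (apply: pdeg_add; first apply: pdeg_add)).
- exact: S1.
- by apply: fdeg_bool; apply: fdeg_map.
- exact: S1.
- by apply: pdeg_sum => j _; apply: S1.
- exact: fdeg_bool.
Qed.

(* Each term of the sum over cells has error [2^-e], hence the factor
   [k * a + 2]: there are [2 ^ (k * a)] cells. *)
Lemma adeg_ksum_le L d : (forall w, nsol tau w <= L)%N ->
  (#|{: I}| + 2 + k.+1 * L <= d ^ 2)%N ->
  adeg [set: bits n] ksum_fun <= ((k * a + 2) * (d * viol_deg))%:R.
Proof.
move=> HL Ld; set Lv := (_ + _ + _)%N in Ld.
have Lv0 : (0 < Lv)%N by rewrite /Lv addnAC addn2.
pose e := (k * a + 2)%N.
have H S := @zero_test_pdeg n d e viol_deg Lv (fun x => nviol (inp x) S) Lv0 Ld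
  (pdeg_nviol S) (fun x => nviol_le (inp x) S HL).
pose g S := projT1 (cid (H S)).
have gP S : @pdeg RR n (e * (d * viol_deg)) (g S) /\
    (forall x : bits n, nviol (inp x) S = 0%N -> g S x = 1) /\
    (forall x : bits n, nviol (inp x) S != 0%N -> `|g S x| <= 2^-1 ^+ e) := projT2 (cid (H S)).
apply: (@adeg_le _ _ _ _ (fun x : bits n => \sum_S g S x)).
  by apply: pdeg_sum => S _; have [] := gP S.
move=> x _.
have E : (ksum_fun x)%:R = \sum_S (valid (inp x) S)%:R :> RR.
  rewrite /ksum_fun /checked_ksum; have [/existsP[S vS]|] := boolP [exists S, valid _ S].
    rewrite (bigD1 S) //= vS big1 ?addr0 // => S' S'S.
    case: (boolP (valid _ S')) => // vS'.
    by rewrite (valid_uniq vS vS') eqxx in S'S.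
  by rewrite negb_exists => /forallP nv; rewrite big1 // => S _; rewrite (negbTE (nv S)).
rewrite E -sumrB; apply: le_trans (ler_norm_sum _ _ _) _.
apply: (@le_trans _ _ (\sum_(S : Pt) 2^-1 ^+ e)).
  apply: ler_sum => S _; have [_ [g1 g0]] := gP S.
  have [vS|nv] := boolP (valid (inp x) S).
    by rewrite g1 ?subrr ?normr0 ?exprn_ge0 //; apply/eqP; rewrite nviol_eq0.
  by rewrite sub0r normrN; apply: g0; rewrite nviol_eq0.
have c : #|{: Pt}| = (2 ^ (k * a))%N by rewrite !card_ffun card_bool !card_ord -expnM mulnC.
rewrite sumr_const -[leLHS]mulr_natl c natrX /e exprD mulrA -exprMn divff ?pnatr_eq0 //.
by rewrite expr1n mul1r; lra.
Qed.

End CheckedKSum.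

(** * A degree lower bound for NOR *)

Section BernoulliExtrapolation.

Fixpoint extrap_factor (d : nat) : RR :=
  if d is d'.+1 then extrap_factor d' * ((8 ^+ d + 1) / (8 ^+ d - 1)) else 1.

(** The correction [(8 ^+ d)^-1 / 2] makes the bound inductive; uniformly in [d] the factor stays
    below [3 / 2]. *)
Lemma extrap_factor_le d : extrap_factor d <= 3 / 2 - (8 ^+ d)^-1 / 2.
Proof.
elim: d => [|d IH]; first by rewrite expr0 invr1 /=; lra.
have e1 : 1 <= (8 : RR) ^+ d by rewrite exprn_ege1 // ler1n.
rewrite [extrap_factor _]/= !exprS; set y := 8 ^+ d in IH e1 *.
have y0 : 0 < y by lra.
apply: (@le_trans _ _ ((3 / 2 - y^-1 / 2) * ((8 * y + 1) / (8 * y - 1)))).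
  by apply: ler_wpM2r => //; rewrite divr_ge0 //; lra.
rewrite mulrA ler_pdivrMr; last lra.
have yV : y * y^-1 = 1 by rewrite divff // gt_eqF.
have -> : (8 * y)^-1 = y^-1 / 8 by rewrite invfM mulrC.
have v0 : 0 < y^-1 by rewrite invr_gt0.
nra.
Qed.

(* [R (8 x)] and [R x] combine to cancel the top coefficient while keeping [R 0]. *)
Lemma extrapolate d (R : {poly RR}) (p b : RR) : (size R <= d.+1)%N ->
  (forall i, (i <= d)%N -> `|R.[8 ^+ i * p]| <= b) -> `|R.[0]| <= extrap_factor d * b.
Proof.
elim: d R b => [|d IH] R b sR Rb.
  have := Rb 0%N (leqnn _); rewrite mul1r.
  by rewrite (size1_polyC sR) !hornerC mul1r.
have e1 : 1 <= (8 : RR) ^+ d by rewrite exprn_ege1 // ler1n.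
have e2 : 0 < (8 : RR) ^+ d.+1 - 1 by rewrite exprS; lra.
pose R' := \poly_(i < d.+1) ((8 ^+ d.+1 - 8 ^+ i) / (8 ^+ d.+1 - 1) * R`_i).
have R'E x : R'.[x] = (8 ^+ d.+1 * R.[x] - R.[8 * x]) / (8 ^+ d.+1 - 1).
  rewrite horner_poly !(horner_coef_wide _ sR) mulr_sumr -sumrB [in RHS]big_ord_recr /=.
  have -> : 8 ^+ d.+1 * (R`_d.+1 * x ^+ d.+1) - R`_d.+1 * (8 * x) ^+ d.+1 = 0 by rewrite exprMn; ring.
  rewrite addr0 mulr_suml; apply: eq_bigr => i _.
  by rewrite exprMn; ring.
have R'0 : R'.[0] = R.[0] by rewrite R'E mulr0 -{2}[R.[0]]mul1r -mulrBl mulrAC divff ?mul1r // gt_eqF.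
rewrite -R'0 /= -mulrA; apply: IH; first exact: size_poly.
move=> i id; rewrite R'E normrM normfV (ger0_norm (ltW e2)) ler_pdivrMr // [leRHS]mulrC.
have h1 := Rb i (leqW id); have := Rb i.+1 id; rewrite exprS -mulrA => h2.
apply: (le_trans (ler_normB _ _)); rewrite normrM ger0_norm ?exprn_ge0 //.
have -> : (8 ^+ d.+1 - 1) * ((8 ^+ d.+1 + 1) / (8 ^+ d.+1 - 1) * b) = (8 ^+ d.+1 + 1) * b.
  by rewrite mulrA mulrCA divff ?mulr1 // gt_eqF.
rewrite [leRHS]mulrDl mul1r lerD //.
by rewrite ler_wpM2l // exprn_ge0.
Qed.

Variable N : nat.
Definition bern (p : RR) (z : bits N) : RR := \prod_b (if z b then p else 1 - p).

Lemma sum_bern (p : RR) (F : 'I_N -> bool -> RR) :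
  \sum_z bern p z * \prod_b F b (z b) = \prod_b (p * F b true + (1 - p) * F b false).
Proof.
rewrite (eq_bigr (fun b => \sum_(c : bool) (if c then p else 1 - p) * F b c)); last first.
  by move=> b _; rewrite big_bool.
by rewrite bigA_distr_bigA /=; apply: eq_bigr => z _; rewrite -big_split.
Qed.

Lemma bern_poly d (g : bits N -> RR) (S : {set 'I_N}) : @pdeg RR N d g ->
  exists R : {poly RR}, (size R <= (#|S| + d).+1)%N /\
    forall p, R.[p] = \sum_z bern p z * (\prod_(b in S) (z b)%:R * g z).
Proof.
move=> H; elim: H S => {d g} [d c|d i g _ IH|d g h _ IH1 _ IH2] S.
- exists (c *: 'X^#|S|); split.
    by apply: leq_trans (size_scale_leq _ _) _; rewrite size_polyXn ltnS leq_addr.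
  move=> p; rewrite hornerZ hornerXn.
  transitivity (\sum_z bern p z * \prod_b (if b \in S then (z b)%:R else 1) * c); last first.
    by apply: eq_bigr => z _; rewrite -mulrA [in RHS]big_mkcond.
  rewrite -mulr_suml (sum_bern p (fun b c => if b \in S then c%:R else 1)) mulrC; congr (_ * _).
  rewrite -prodr_const big_mkcond; apply: eq_bigr => b _.
  by case: ifP => _; rewrite ?mulr1 ?mulr0 ?addr0 // addrC subrK.
- have [R [sR RE]] := IH (i |: S); exists R; split.
    by apply: leq_trans sR _; rewrite cardsU1; case: (i \in S) => /=; lia.
  move=> p; rewrite RE; apply: eq_bigr => z _; congr (_ * _).
  rewrite mulrA; congr (_ * _); have [iS|iS] := boolP (i \in S).
    have -> : i |: S = S by apply/finset.setUidPr; rewrite finset.sub1set.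
    rewrite (bigD1 i) //=; by case: (z i); rewrite ?mul0r ?mul1r ?mulr1.
  by rewrite big_setU1 //= mulrC.
have [R1 [s1 E1]] := IH1 S; have [R2 [s2 E2]] := IH2 S; exists (R1 + R2); split.
  by apply: leq_trans (size_polyD _ _) _; rewrite geq_max s1 s2.
move=> p; rewrite hornerD E1 E2 -big_split; apply: eq_bigr => z _.
by rewrite /= !mulrDr.
Qed.

Lemma bern_sum1 p : \sum_z bern p z = 1.
Proof.
rewrite (eq_bigr (fun z => bern p z * \prod_(b < N) 1)) => [|z _]; last by rewrite big1 ?mulr1.
by rewrite (sum_bern p (fun _ _ => 1)) big1 // => b _; rewrite !mulr1 addrC subrK.
Qed.

Lemma bern_ge0 p z : 0 <= p <= 1 -> 0 <= bern p z.
Proof. by move=> /andP[p0 p1]; apply: prodr_ge0 => b _; case: (z b) => //; rewrite subr_ge0. Qed.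

Definition zero_bits : bits N := [ffun=> false].

Lemma bern_zero_le p : 0 <= p <= 1 -> bern p zero_bits * (1 + N%:R * p) <= 1.
Proof.
move=> /andP[p0 p1].
have -> : bern p zero_bits = (1 - p) ^+ N.
  by rewrite /bern (eq_bigr (fun=> 1 - p)) => [|b _]; rewrite ?prodr_const ?card_ord // ffunE.
elim: N => [|m IH]; first by rewrite expr0 mul0r addr0 mulr1.
apply: le_trans IH; rewrite exprS -natr1.
have h : 0 <= (1 - p) ^+ m by rewrite exprn_ge0 // subr_ge0.
have m0 : 0 <= (m%:R : RR) by [].
have -> : (1 - p) * (1 - p) ^+ m * (1 + (m%:R + 1) * p) = (1 - p) ^+ m * ((1 - p) * (1 + (m%:R + 1) * p)) by ring.
by apply: ler_wpM2l => //; nra.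
Qed.

(* Averaging over Bernoulli([p]) inputs gives a univariate polynomial in [p]
   that is small on [8^-d, 1] but not at 0. *)
Lemma nor_pdeg d (g : bits N -> RR) : @pdeg RR N d g ->
  (forall z, `|(z == zero_bits)%:R - g z| <= 1 / 3) -> (N < 9 * 8 ^ d)%N.
Proof.
move=> Hg gz; rewrite ltnNge; apply/negP => Nd.
have [R [sR RE]] := bern_poly finset.set0 Hg.
rewrite cards0 add0n in sR.
have e8 : 0 < (8 : RR) ^+ d by rewrite exprn_gt0.
have R0 : 2 / 3 <= R.[0].
  rewrite RE (bigD1 zero_bits) //= [X in _ + X]big1 ?addr0 => [|z z0]; last first.
    have [b zb] : exists b, z b.
      apply/existsP; apply: contraNT z0; rewrite negb_exists => /forallP H.
      by apply/eqP/ffunP => b; rewrite ffunE; apply/negbTE.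
    by rewrite /bern (bigD1 b) //= zb !mul0r.
  rewrite /bern big1 => [|b _]; last by rewrite ffunE subr0.
  rewrite big_set0 !mul1r; have := gz zero_bits; rewrite eqxx.
  by rewrite ler_norml -[true%:R]/(1 : RR) => /andP[_]; lra.
(* [N p >= 9] makes the all-zero probability at most [1 / 10], and [3 / 2] times [1 / 3 + 1 / 10] is
   [13 / 20], below the value [2 / 3] at 0. *)
have Rb i : (i <= d)%N -> `|R.[8 ^+ i * (8 ^+ d)^-1]| <= 1 / 3 + 1 / 10.
  move=> id; set p := 8 ^+ i * _.
  have e8i : 0 < (8 : RR) ^+ i by rewrite exprn_gt0.
  have p01 : 0 <= p <= 1.
    apply/andP; split; first by rewrite divr_ge0 ?ltW.
    rewrite /p ler_pdivrMr // mul1r; by rewrite ler_eXn2l // ltr1n.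
  have pN : 9 <= N%:R * p.
    have : (9 * 8 ^ d)%:R <= (N%:R : RR) by rewrite ler_nat.
    rewrite natrM natrX => h.
    have hp : (8 ^+ d)^-1 <= p.
      rewrite /p -[leLHS]mul1r; apply: ler_wpM2r; first by rewrite invr_ge0 ltW.
      by rewrite exprn_ege1 // ler1n.
    apply: (@le_trans _ _ (9 * 8 ^+ d * (8 ^+ d)^-1)).
      by rewrite mulfK // gt_eqF.
    by apply: ler_pM => //; rewrite ?invr_ge0 ?mulr_ge0 // ltW.
  have z10 : bern p zero_bits <= 1 / 10.
    by have := bern_zero_le p01; have := bern_ge0 zero_bits p01; nra.
  have -> : R.[p] = bern p zero_bits - \sum_z bern p z * ((z == zero_bits)%:R - g z).
    rewrite RE; under eq_bigr do rewrite big_set0 mul1r.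
    under [X in _ - X]eq_bigr do rewrite mulrBr.
    rewrite sumrB [X in _ - (X - _)](bigD1 zero_bits) //= eqxx mulr1.
    rewrite [X in _ - (_ + X - _)]big1 => [|z /negbTE ->]; last by rewrite mulr0.
    by rewrite addr0 opprB addrC subrK.
  apply: (le_trans (ler_normB _ _)); rewrite addrC; apply: lerD; last first.
    by rewrite ger0_norm // bern_ge0.
  apply: (le_trans (ler_norm_sum _ _ _)); apply: (@le_trans _ _ (\sum_z bern p z * (1 / 3))); last by rewrite -mulr_suml bern_sum1 mul1r.
  apply: ler_sum => z _; rewrite normrM ger0_norm ?bern_ge0 //.
  by apply: ler_wpM2l; rewrite ?bern_ge0.
have := extrapolate sR Rb; have := extrap_factor_le d.
have : 0 < ((8 : RR) ^+ d)^-1 by rewrite invr_gt0.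
have := ler_norm R.[0]; set e := extrap_factor d; set w := (_ ^-1); set nR := `|_|.
move=> h1 h2 h3 h4; nra.
Qed.
End BernoulliExtrapolation.

Lemma pdeg_comp n N d (g : bits n -> RR) (X : bits N -> bits n) :
  (forall i, fdeg 1 (fun z => X z i)) -> @pdeg RR n d g -> @pdeg RR N d (fun z => g (X z)).
Proof.
move=> HX; elim=> {d g} [d c|d i g _ IH|d g h _ IH1 _ IH2].
- exact: pdeg_cst.
- by rewrite -add1n; apply: pdegM => //; apply: fdeg_bool.
- exact: pdeg_add.
Qed.

(** A substitution of bits of degree one turns [f] into NOR. The bound is only logarithmic in [N],
    which suffices: the approximate degree has merely to tend to infinity. *)
Lemma adeg_nor_ge n N (f : bits n -> bool) (X : bits N -> bits n) d :
  (forall i, fdeg 1 (fun z => X z i)) -> (forall z, f (X z) = (z == zero_bits N)) ->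
  (9 * 8 ^ d <= N)%N -> d%:R <= adeg [set: bits n] f.
Proof.
move=> HX fX Nd; apply: adeg_ge => e g Hg fg; rewrite ler_nat leqNgt; apply/negP => ed.
have := nor_pdeg (pdeg_comp HX Hg); rewrite ltnNge => /(_ _)/negP; apply.
  by move=> z; rewrite -fX; apply: fg; rewrite finset.in_setT.
by apply: leq_trans Nd; rewrite leq_mul2l leq_exp2l // ltnW.
Qed.

(** * Query lower bound for the two-level k-sum function *)

Section Database.
Variables (k : nat) (M : finType) (G : finZmodType).
Local Notation Pt := {ffun 'I_k -> M}.
Local Notation I := ('I_k * M)%type.
Local Notation Co := (option I * I)%type.
Local Notation DB := {ffun Co -> option G}.
Variables (tau : Pt -> G) (s : nat).
Hypothesis k0 : (0 < k)%N.
Implicit Types (D : DB) (b i : I) (P S : Pt) (o : option I).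

(** Coordinates [(Some b, i)] hold the symbols of inner column [b] and [(None, b)] the secret that
    column unlocks, so [col D None] is the outer instance. *)
Definition col D o : I -> option G := fun i => D (o, i).
Definition active D b : bool := (D (None, b) != None) || [exists P, rsol tau (col D (Some b)) P].
Definition nrec D o : nat := #|[pred i | col D o i != None]|.
(* A column is charged for its recorded symbols until it becomes active, when it
   is charged [s]; an outer solution can then only become recorded once about
   [s] columns are active, that is after about [s ^ 2] queries. *)
Definition cost1 D b : nat := if active D b then s else minn (nrec D (Some b)) s.
Definition cost D : nat := \sum_b cost1 D b.
Definition outer D : bool := [exists S, rsol tau (col D None) S].
Definition good t D : bool := (cost D <= t)%N && ~~ outer D.

Definition subdb D D' := forall c, D c = None \/ D c = D' c.

Lemma rsol_ext (w w' : I -> option G) P : (forall j, w (j, P j) = w' (j, P j)) -> rsol tau w P = rsol tau w' P.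
Proof.
move=> e; rewrite /rsol; congr (_ && _); first by apply: eq_forallb => j; rewrite e.
by rewrite /sol; congr (_ == _); apply: eq_bigr => j _; rewrite e.
Qed.

Lemma rsol_sub D D' o P : subdb D D' -> rsol tau (col D o) P -> rsol tau (col D' o) P.
Proof.
move=> DD' h; rewrite -(@rsol_ext (col D o)) // => j.
case/andP: h => /forallP/(_ j); rewrite /col.
by case: (DD' (o, (j, P j))) => ->.
Qed.

Lemma nrec_sub D D' o : subdb D D' -> (nrec D o <= nrec D' o)%N.
Proof.
move=> DD'; apply: subset_leq_card; apply/fintype.subsetP => i; rewrite !inE /col.
by case: (DD' (o, i)) => ->.
Qed.

Lemma active_sub D D' b : subdb D D' -> active D b -> active D' b.
Proof.
move=> DD' /orP[h|/existsP[P h]]; apply/orP.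
  by left; move: h; case: (DD' (None, b)) => ->.
by right; apply/existsP; exists P; exact: rsol_sub h.
Qed.

Lemma cost1_le D b : (cost1 D b <= s)%N.
Proof. by rewrite /cost1; case: ifP => // _; exact: geq_minr. Qed.

Lemma cost1_sub D D' b : subdb D D' -> (cost1 D b <= cost1 D' b)%N.
Proof.
move=> DD'; rewrite {2}/cost1; case: ifPn => [_|na]; first exact: cost1_le.
rewrite /cost1 ifN; first by rewrite leq_min geq_minr andbT geq_min nrec_sub.
by apply: contra na; exact: active_sub.
Qed.

Lemma good_sub D D' t : subdb D D' -> good t D' -> good t D.
Proof.
move=> DD' /andP[h1 h2]; apply/andP; split.
  by apply: leq_trans h1; apply: leq_sum => b _; exact: cost1_sub.
by apply: contra h2 => /existsP[S hS]; apply/existsP; exists S; exact: rsol_sub hS.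
Qed.

Lemma subdb_None D c x : subdb (upd D c None) (upd D c x).
Proof. by move=> c'; rewrite !updE; case: ifP; [left|right]. Qed.

Lemma good_None D t c x : good t (upd D c x) -> good t (upd D c None).
Proof. exact/good_sub/subdb_None. Qed.

Lemma goodS t D : good t D -> good t.+1 D.
Proof. by case/andP=> h1 h2; apply/andP; split=> //; exact: leqW. Qed.

Lemma good_recorded D t c x : good t (upd D c x) -> ~~ good t.+1 D -> D c != None.
Proof.
move=> /good_None g; apply: contraNN => /eqP Dc; apply: goodS.
by rewrite -(upd_id D c) Dc.
Qed.

Lemma rsol_empty o P : ~~ rsol tau (col [ffun=> None] o) P.
Proof. by apply/negP => /andP[/forallP/(_ (Ordinal k0))]; rewrite /col ffunE. Qed.

Lemma good_empty : good 0 [ffun=> None].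
Proof.
apply/andP; split; last by apply/existsPn => S; exact: rsol_empty.
rewrite leqn0 sum_nat_eq0; apply/forallP => b /=.
rewrite /cost1 /active ffunE eqxx ifN; last by apply/existsPn => P; exact: rsol_empty.
rewrite -leqn0 geq_min /nrec (eq_card0 (_ : _ =i pred0)) // => i.
by rewrite !inE /col ffunE.
Qed.

Lemma col_upd D o i v : col (upd D (o, i) (Some v)) o =1 cupd (col (upd D (o, i) None) o) i v.
Proof.
move=> i'; rewrite /col /cupd !updE; have [->|ne] := eqVneq i' i; first by rewrite eqxx.
have -> // : ((o, i') == (o, i)) = false by apply/negbTE; apply: contra ne => /eqP[->].
Qed.

Lemma col_upd_off D o o' i v : o != o' -> col (upd D (o, i) v) o' = col D o'.
Proof.
move=> oo; apply/funext => i'; rewrite /col updE ifN //.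
by apply: contra oo => /eqP[->].
Qed.

Lemma new_rsol D o i v S : rsol tau (col (upd D (o, i) (Some v)) o) S ->
  ~~ rsol tau (col (upd D (o, i) None) o) S ->
  (S i.1 == i.2) && rsol tau (cupd (col (upd D (o, i) None) o) (i.1, i.2) v) S.
Proof.
move=> h nh; apply/andP; split; last first.
  rewrite -(@rsol_ext (col (upd D (o, i) (Some v)) o)) // => j.
  by rewrite col_upd; case: i {h nh}.
apply: contraNT nh => ne; rewrite -(@rsol_ext (col (upd D (o, i) (Some v)) o)) // => j.
rewrite /col !updE; case: eqP => // -[e]; case/negP: ne.
by rewrite -e.
Qed.

Lemma card_new_rsol D o i (N : nat) (B : pred G) : (nrec (upd D (o, i) None) o <= N)%N ->
  (forall v, B v -> exists2 S, rsol tau (col (upd D (o, i) (Some v)) o) S &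
     ~~ rsol tau (col (upd D (o, i) None) o) S) ->
  (#|B| <= N ^ k.-1)%N.
Proof.
move=> hN HB; apply: leq_trans (card_completions tau i.1 i.2 hN).
apply: subset_leq_card; apply/fintype.subsetP => v /HB[S h1 h2]; rewrite inE.
by apply/existsP; exists S; exact: new_rsol h1 h2.
Qed.

(** A new symbol adds at most 1 to the cost of its column unless it completes a solution there. With
    fewer than [s] symbols recorded, few values do so; from [s] on, the cost of the column is
    already maximal. *)
Lemma y_leak_count D t b i x : good t (upd D (Some b, i) x) ->
  (#|[pred v | ~~ good t.+1 (upd D (Some b, i) (Some v))]| <= s ^ k.-1)%N.
Proof.
move=> /good_None; set c := (Some b, i); set D0 := upd D c None => gD0.
have [h1 h2] := andP gD0.
have oth b' v : b' != b -> cost1 (upd D c (Some v)) b' = cost1 D0 b'.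
  move=> b'b; rewrite /cost1 /active /nrec !col_upd_off ?updE //.
  - by apply: contra b'b => /eqP[->].
  - by apply: contra b'b => /eqP[->].
have out v : outer (upd D c (Some v)) = outer D0.
  by rewrite /outer !col_upd_off.
have bad v : ~~ good t.+1 (upd D c (Some v)) -> (cost1 D0 b + 1 < cost1 (upd D c (Some v)) b)%N.
  rewrite /good out h2 andbT -ltnNge /cost (bigD1 b) //= (eq_bigr _ (fun b' b'b => oth b' v b'b)).
  move=> bt; rewrite -(ltn_add2r (\sum_(b' | b' != b) cost1 D0 b')) addn1 addSn.
  by apply: leq_ltn_trans bt; rewrite ltnS; move: h1; rewrite /cost (bigD1 b).
have [sb|sb] := leqP s (nrec D0 (Some b)).
  rewrite eq_card0 // => v; rewrite inE /=; apply/negbTE/negP => bv; move: (bad v bv).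
  have := cost1_le (upd D c (Some v)) b; rewrite {2}/cost1.
  by case: ifP => _; [lia|rewrite (minn_idPr sb); lia].
apply: (@card_new_rsol D (Some b) i); first exact: ltnW.
move=> v /bad bv.
have na : ~~ active D0 b.
  apply/negP => a0; move: bv; rewrite {1}/cost1 a0.
  by rewrite ltnNge => /negP; apply; apply: leq_trans (cost1_le _ _) (leq_addr _ _).
have av : active (upd D c (Some v)) b.
  apply: contraLR bv => nav; rewrite /cost1 (negbTE na) (negbTE nav) -leqNgt.
  have : (nrec (upd D c (Some v)) (Some b) <= nrec D0 (Some b) + 1)%N.
    rewrite /nrec addn1; apply: (@leq_trans #|[predU1 i & [pred i' | col D0 (Some b) i' != None]]|).
      apply: subset_leq_card; apply/fintype.subsetP => i'; rewrite !inE /col /D0 !updE.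
      have [->|ne] := eqVneq i' i; first by [].
      by rewrite !ifN // /c; apply: contra ne => /eqP[->].
    by rewrite cardU1; case: (_ \notin _); rewrite ?add1n ?add0n.
  move: (nrec _ _) (nrec _ _) sb => x1 x2; rewrite /minn; do 2 case: ifP => //; lia.
move: na av; rewrite /active !updE /= negb_or => /andP[/negbTE -> /= /existsPn na] /existsP[P hP].
by exists P.
Qed.

(** Column [b] is active through its recorded solution, so recording its secret leaves the cost
    unchanged and can only complete an outer solution. Each recorded secret is charged [s], so
    [t < s ^ 2] keeps their number at most [s]. *)
Lemma s_leak_count D t b P x : (t < s ^ 2)%N -> rsol tau (col D (Some b)) P ->
  good t (upd D (None, b) x) ->
  (#|[pred v | ~~ good t.+1 (upd D (None, b) (Some v))]| <= s ^ k.-1)%N.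
Proof.
move=> ts RD /good_None; set c := (None, b); set D0 := upd D c None => gD0.
have [h1 h2] := andP gD0.
have act u : active (upd D c u) b.
  by apply/orP; right; apply/existsP; exists P; rewrite col_upd_off.
have cE v : cost (upd D c (Some v)) = cost D0.
  apply: eq_bigr => b' _; have [->|b'b] := eqVneq b' b; first by rewrite /cost1 !act.
  rewrite /cost1 /active /nrec !col_upd_off // !updE.
  by have -> : ((None, b') == c) = false by apply/negbTE; apply: contra b'b => /eqP[->].
apply: (@card_new_rsol D None b).
  rewrite -/D0; have : (s * nrec D0 None <= cost D0)%N.
    rewrite /nrec mulnC -sum_nat_const /cost big_mkcond; apply: leq_sum => b' _.
    by rewrite inE /col; case: ifP => // r; rewrite /cost1 /active r.
  case: (s) ts h1 => [|s'] ts h1 h3; first by rewrite ltn0 in ts.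
  rewrite -(@leq_pmul2l s'.+1) //; apply: (leq_trans h3); apply: (leq_trans h1).
  by rewrite mulnn ltnW.
move=> v; rewrite inE /= /good cE (leqW h1) /= negbK => /existsP[S hS].
by exists S => //; apply: contra h2 => hS'; apply/existsP; exists S.
Qed.

End Database.

Section HardInputs.
Variables (k a t : nat) (G : finZmodType).
Local Notation M := {ffun 'I_a -> bool}.
Local Notation Pt := {ffun 'I_k -> M}.
Local Notation I := ('I_k * M)%type.
Local Notation J := (ksum_var k a t).
Local Notation Co := (option I * I)%type.
Local Notation Om := {ffun Co -> G}.
Local Notation DB := {ffun Co -> option G}.
Variables (dec : {ffun 'I_t -> bool} -> G) (enc : G -> {ffun 'I_t -> bool}).
Hypotheses (encK : cancel enc dec) (decK : cancel dec enc).
Variables (tau : Pt -> G) (n : nat) (iota : J -> 'I_n).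
Hypotheses (iota_inj : injective iota) (k0 : (0 < k)%N).
Implicit Types (w : Om) (D : DB) (b i : I) (P S : Pt).

Definition wcol w o : I -> G := fun i => w (o, i).

(* In the hard inputs, [Z_b] carries the secret [w (None, b)] exactly at the
   solutions of column [b], and all cells are blank. *)
Definition blank_input w (u : J) : bool :=
  match u with
  | inl (inl (b, i, e)) => enc (w (Some b, i)) e
  | inl (inr (b, P, e)) => sol tau (wcol w (Some b)) P && enc (w (None, b)) e
  | inr _ => false
  end.

Definition marked_input w S (h : I -> Pt) (u : J) : bool :=
  match u with
  | inl u' => blank_input w (inl u')
  | inr (S', c) => (S' == S) && (if c is Some (b, j, e) then h b j e else true)
  end.

Lemma dec_eta (g : G) (f : 'I_t -> bool) : (forall e, f e = enc g e) -> dec [ffun e => f e] = g.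
Proof. by move=> fE; rewrite -[RHS]encK; congr dec; apply/ffunP => e; rewrite ffunE fE. Qed.

Lemma ycol_blank w b : ycol dec (blank_input w) b = wcol w (Some b).
Proof. by apply/funext => i; exact: dec_eta. Qed.

Lemma zval_blank w b P : sol tau (wcol w (Some b)) P -> zval dec (blank_input w) b P = w (None, b).
Proof. by move=> h; apply: dec_eta => e; rewrite /= h. Qed.

Definition ok w := [forall o : option I, nsol tau (wcol w o) != 0%N].

Lemma okP w : ok w -> exists (S : Pt) (h : I -> Pt),
  [/\ forall b, sol tau (wcol w (Some b)) (h b), sol tau (wcol w None) S &
      forall S', before S' S -> ~~ sol tau (wcol w None) S'].
Proof.
move=> /forallP okw.
have ex o : exists P, sol tau (wcol w o) P.
  have := okw o; rewrite -lt0n => /card_gt0P[P]; rewrite inE => h; by exists P.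
have [S0 hS0] := ex None.
exists [arg min_(S < S0 | sol tau (wcol w None) S) enum_rank S].
exists (fun b => projT1 (cid (ex (Some b)))); case: arg_minnP => // S hS minS.
split=> //; first by move=> b; exact: projT2 (cid (ex (Some b))).
by move=> S'; apply: contraTN => /minS; rewrite /before -leqNgt.
Qed.

Lemma valid_marked w S h : (forall b, sol tau (wcol w (Some b)) (h b)) ->
  sol tau (wcol w None) S -> (forall S', before S' S -> ~~ sol tau (wcol w None) S') ->
  valid dec tau (marked_input w S h) S.
Proof.
move=> hh hS fS.
have yE b : ycol dec (marked_input w S h) b = wcol w (Some b) by exact: ycol_blank.
have hE b : hint (marked_input w S h) S b = h b.
  by apply/ffunP => j; rewrite ffunE; apply/ffunP => e; rewrite ffunE /= eqxx.
have zE b P : sol tau (wcol w (Some b)) P -> zval dec (marked_input w S h) b P = w (None, b).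
  exact: zval_blank.
have uE : uval dec (marked_input w S h) S = wcol w None.
  by apply/funext => b; rewrite /uval hE zE.
apply/and5P; split; rewrite ?uE //.
- by apply/forallP => b; rewrite yE hE.
- by apply/forallP => S'; apply/implyP; exact: fS.
- apply/forallP => j; apply/forallP => P; apply/implyP; rewrite yE => /zE ->.
  by [].
- by rewrite /flag /= eqxx.
Qed.

Definition blank_bits w := embed iota (blank_input w).
Definition marked_bits w S h := embed iota (marked_input w S h).

Lemma inp_embed (v : J -> bool) : (fun u => embed iota v (iota u)) = v.
Proof. by apply/funext => u; rewrite embedE. Qed.

Lemma ksum_blank w : ksum_fun dec tau iota (blank_bits w) = false.
Proof.
rewrite /ksum_fun inp_embed; apply/negbTE/existsPn => S.
by rewrite /valid /flag /= !andbF.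
Qed.

Lemma ksum_marked w S h : (forall b, sol tau (wcol w (Some b)) (h b)) ->
  sol tau (wcol w None) S -> (forall S', before S' S -> ~~ sol tau (wcol w None) S') ->
  ksum_fun dec tau iota (marked_bits w S h) = true.
Proof.
by move=> *; rewrite /ksum_fun inp_embed; apply/existsP; exists S; exact: valid_marked.
Qed.

Lemma blank_marked w S h (i : 'I_n) : blank_bits w i != marked_bits w S h i -> exists c, i = iota (inr (S, c)).
Proof.
move=> /embed_diff[[u' ->|[S' c] ->]]; first by rewrite /= eqxx.
by rewrite /=; have [->|] := eqVneq S' S; [exists c|].
Qed.

Lemma few_not_ok (lam : nat) : #|{: Pt}| = (#|G| * lam)%N ->
  (#|[pred w | ~~ ok w]| * lam <= #|{: option I}| * #|{: Om}|)%N.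
Proof.
move=> PtE.
have H o : (#|[pred w : Om | nsol tau (wcol w o) == 0%N]| * lam <= #|{: Om}|)%N.
  by apply: (@few_unsolvable k M G _ (fun i => (o, i))) => // i i' [].
apply: (@leq_trans (\sum_(o : option I) #|[pred w : Om | nsol tau (wcol w o) == 0%N]| * lam)).
  rewrite -big_distrl /= leq_mul2r; apply/orP; right.
  rewrite -sum1_card big_mkcond.
  rewrite [X in (_ <= X)%N](eq_bigr (fun o => \sum_(w : Om) (nsol tau (wcol w o) == 0%N : nat))); last first.
    by move=> o _; rewrite -sum1_card big_mkcond; apply: eq_bigr => w _; rewrite inE; case: eqP.
  rewrite exchange_big /=; apply: leq_sum => w _.
  rewrite inE; case: ifPn => //; rewrite negb_forall => /existsP[u]; rewrite negbK => ho.
  by rewrite (bigD1 u) //= ho.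
by rewrite -sum_nat_const; apply: leq_sum => o _; exact: H.
Qed.

Hypothesis t0 : (0 < t)%N.

(** Bit [b] of [z] complements the encoding of one symbol at the hinted solution of column [b]. The
    sum changes and the hint fails, so the function becomes NOR of [z]. *)
Definition corrupt_input w S (h : I -> Pt) (z : bits #|{: I}|) (u : J) : bool :=
  match u with
  | inl (inl (b, i, e)) => (z (enum_rank b) && (i == (Ordinal k0, h b (Ordinal k0))))
                              (+) enc (w (Some b, i)) e
  | _ => marked_input w S h u
  end.

Lemma ksum_corrupt w S h z : (forall b, sol tau (wcol w (Some b)) (h b)) ->
  sol tau (wcol w None) S -> (forall S', before S' S -> ~~ sol tau (wcol w None) S') ->
  ksum_fun dec tau iota (embed iota (corrupt_input w S h z)) = (z == zero_bits #|{: I}|).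
Proof.
move=> hh hS fS; rewrite /ksum_fun inp_embed.
have [->|z0] := eqVneq z (zero_bits _).
  have -> : corrupt_input w S h (zero_bits _) = marked_input w S h.
    by apply/funext => -[[[[b i] e]|//]|//]; rewrite /= ffunE.
  by apply/existsP; exists S; exact: valid_marked.
have [b zb] : exists b : I, z (enum_rank b).
  have [b zb] : exists b : 'I__, z b.
    apply/existsP; apply: contraNT z0; rewrite negb_exists => /forallP H.
    by apply/eqP/ffunP => b; rewrite ffunE; apply/negbTE.
  by exists (enum_val b); rewrite enum_valK.
apply/negbTE/existsPn => S'; have [->|S'S] := eqVneq S' S; last first.
  by rewrite /valid /flag /= (negbTE S'S) !andbF.
rewrite /valid; apply/negP => /and5P[/forallP/(_ b) + _ _ _ _].
have -> : hint (corrupt_input w S h z) S b = h b.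
  by apply/ffunP => j; rewrite ffunE; apply/ffunP => e; rewrite ffunE /= eqxx.
have /eqP hb := hh b; rewrite /sol -hb; pose j0 := Ordinal k0.
rewrite (bigD1 j0) //= [X in _ == X](bigD1 j0) //=.
rewrite [X in _ + X](eq_bigr (fun j => wcol w (Some b) (j, h b j))) => [|j jj]; last first.
  apply: dec_eta => e /=; case: eqP => [[e1]|_]; last by rewrite andbF.
  by rewrite e1 eqxx in jj.
move=> /eqP/addIr/(congr1 enc); rewrite decK => /ffunP/(_ (Ordinal t0)).
by rewrite ffunE /= zb eqxx /=; case: (enc _ _).
Qed.

Lemma adeg_ksum_ge w d : ok w -> (9 * 8 ^ d <= #|{: I}|)%N ->
  d%:R <= adeg [set: bits n] (ksum_fun dec tau iota).
Proof.
move=> /okP[S [h [hh hS fS]]] Nd.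
apply: (adeg_nor_ge (X := fun z => embed iota (corrupt_input w S h z)) _ _ Nd).
  move=> i; have [[u -> _]|[H _]] := embedP iota (fun=> false) i.
    have E : (fun z => embed iota (corrupt_input w S h z) (iota u)) = fun z => corrupt_input w S h z u.
      by apply/funext => z; rewrite embedE.
    rewrite E; case: u {E} => [[[[b i'] e]|u]|u] /=; try exact: fdeg_cst.
    apply: (fdeg_map (fun c => (c && (i' == (Ordinal k0, h b (Ordinal k0)))) (+) enc (w (Some b, i')) e)).
    exact: fdeg_bit.
  have -> : (fun z => embed iota (corrupt_input w S h z) i) = fun=> false.
    by apply/funext => z; rewrite embed0.
  exact: fdeg_cst.
by move=> z; rewrite ksum_corrupt.
Qed.

End HardInputs.

Section KSumQueries.
Variables (k a t : nat) (G : finZmodType).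
Local Notation M := {ffun 'I_a -> bool}.
Local Notation Pt := {ffun 'I_k -> M}.
Local Notation I := ('I_k * M)%type.
Local Notation J := (ksum_var k a t).
Local Notation Co := (option I * I)%type.
Local Notation Om := {ffun Co -> G}.
Local Notation DB := {ffun Co -> option G}.
Variables (dec : {ffun 'I_t -> bool} -> G) (enc : G -> {ffun 'I_t -> bool}).
Hypotheses (encK : cancel enc dec) (decK : cancel dec enc).
Variables (tau : Pt -> G) (n : nat) (iota : J -> 'I_n).
Hypotheses (iota_inj : injective iota) (k0 : (0 < k)%N).
Implicit Types (w : Om) (D : DB) (b i : I) (P S : Pt).

Definition sol_co (o : option I) P : seq Co := [seq (o, (j, P j)) | j <- enum 'I_k].

Lemma sol_co_uniq o P : uniq (sol_co o P).
Proof. by rewrite map_inj_uniq ?enum_uniq // => j j' []. Qed.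

Lemma mem_sol_co o P j : (o, (j, P j)) \in sol_co o P.
Proof. by apply/mapP; exists j; rewrite ?mem_enum. Qed.

Lemma size_sol_co o P : size (sol_co o P) = k.
Proof. by rewrite size_map size_enum_ord. Qed.

Definition rbit D c (e : 'I_t) : bool := if D c is Some g then enc g e else false.

Definition var_co (u : J) : seq Co :=
  match u with
  | inl (inl (b, i, e)) => [:: (Some b, i)]
  | inl (inr (b, P, e)) => (None, b) :: sol_co (Some b) P
  | inr _ => [::]
  end.

Definition var_test (u : J) D : bool :=
  match u with
  | inl (inl (b, i, e)) => rbit D (Some b, i) e
  | inl (inr (b, P, e)) => rsol tau (col D (Some b)) P && rbit D (None, b) e
  | inr _ => false
  end.

Lemma rsol_local D o P c x : c \notin sol_co o P ->
  rsol tau (col (upd D c x) o) P = rsol tau (col D o) P.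
Proof.
move=> cl; apply: rsol_ext => j; rewrite /col updE ifN //.
by apply: contraNneq cl => <-; exact: mem_sol_co.
Qed.

Lemma rbit_local D c e c' x : c' != c -> rbit (upd D c' x) c e = rbit D c e.
Proof. by rewrite /rbit updE eq_sym => /negbTE ->. Qed.

Lemma rsol_total D o P : total D -> rsol tau (col D o) P = sol tau (wcol (vals 0 D) o) P.
Proof.
move=> /forallP tD; rewrite /rsol; have -> : [forall j, col D o (j, P j) != None].
  by apply/forallP => j; exact: tD.
by apply: sol_ext => i; rewrite /wcol ffunE.
Qed.

Lemma rbit_total D c e : total D -> rbit D c e = enc (vals 0 D c) e.
Proof. by move=> /forallP/(_ c); rewrite /rbit ffunE; case: (D c). Qed.

Lemma var_co_uniq u : uniq (var_co u).
Proof.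
case: u => [[[[b i] e]|[[b P] e]]|] //=; rewrite sol_co_uniq andbT.
by apply/mapP => -[].
Qed.

Lemma var_test_local u D c x : c \notin var_co u -> var_test u (upd D c x) = var_test u D.
Proof.
case: u => [[[[b i] e]|[[b P] e]]|] //=.
  by rewrite inE; exact: rbit_local.
by rewrite inE negb_or => /andP[h1 h2]; rewrite rsol_local // rbit_local.
Qed.

Lemma var_test_total u D : total D -> var_test u D = blank_input enc tau (vals 0 D) u.
Proof.
move=> tD; case: u => [[[[b i] e]|[[b P] e]]|] //=; first exact: rbit_total.
by rewrite rsol_total // rbit_total.
Qed.

Variable s : nat.
Local Notation q := (#|G|%:R : RR).
Local Notation Good := (fun t' D => good tau s t' D).
(** The first summand accounts for entering or leaving a given recorded solution of a column, one
    value in [q] for each of its [k] symbols; the second for the [s ^ (k - 1)] values that complete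
    a new one. *)
Definition leak_eps : RR :=
  2 * (k%:R * Num.sqrt (2 / q)) + 2 * Num.sqrt (2 * (s ^ k.-1)%:R / q).

Lemma leak_eps_ge0 : 0 <= leak_eps.
Proof. by rewrite addr_ge0 // !mulr_ge0 // sqrtr_ge0. Qed.

Lemma rsol_recorded o P c D : c \in sol_co o P -> rsol tau (col D o) P -> D c != None.
Proof. by case/mapP => j _ -> /andP[/forallP/(_ j)]. Qed.

Lemma card_rsol_le1 o P c D : c \in sol_co o P ->
  (#|[pred v | rsol tau (col (upd D c (Some v)) o) P]| <= 1)%N.
Proof.
case/mapP => j _ ->; apply/fintype.card_le1_eqP => v v'; rewrite !inE.
have E u : \sum_j' odflt 0 (col (upd D (o, (j, P j)) (Some u)) o (j', P j')) =
    u + \sum_(j' | j' != j) odflt 0 (col D o (j', P j')).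
  rewrite (bigD1 j) //= {1}/col upd_same; congr (_ + _); apply: eq_bigr => j' jj.
  by rewrite /col updE; case: eqP => // -[e]; rewrite e eqxx in jj.
move=> /andP[_ /eqP h1] /andP[_ /eqP h2]; move: h1; rewrite -h2 !E.
by move/addIr.
Qed.

(** A column bit reads one coordinate. A table bit reads a secret only if the point is recorded as a
    solution; then the column is active, so its symbols may vary within that event without changing
    the cost. *)
Lemma var_leak t' u h : (t' < s ^ 2)%N -> supp h (Good t') ->
  l2 (res (fun D => ~~ Good t'.+1 D) (Q (var_co u) (var_test u) h)) <= leak_eps * l2 h.
Proof.
move=> ts hG; have hk : 0 <= k%:R * Num.sqrt (2 / q) by rewrite mulr_ge0 ?sqrtr_ge0.
have hs : 0 <= Num.sqrt (2 * (s ^ k.-1)%:R / q) by exact: sqrtr_ge0.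
have h0 := l2_ge0 h.
have gb D : Good t' D -> ~~ ~~ Good t'.+1 D by rewrite negbK; exact: goodS.
case: u => [[[[b i] e]|[[b P] e]]|y].
- have H : l2 (res (fun D => ~~ Good t'.+1 D) (Q [:: (Some b, i)] (rbit^~ (Some b, i) ^~ e) h)) <=
     2 * Num.sqrt (2 * (s ^ k.-1)%:R / q) * l2 h.
    apply: (@leak_one_register _ _ (0 : G) _ _ (Good t')) => //.
      by move=> D x; exact: good_recorded.
    by move=> D x; exact: y_leak_count.
  apply: (le_trans H); apply: ler_wpM2r => //; rewrite /leak_eps; lra.
- have := @leak_two_registers _ _ (0 : G) (None, b) (sol_co (Some b) P)
    (fun D => rsol tau (col D (Some b)) P) (fun D => rbit D (None, b) e)
    (var_test (inl (inr (b, P, e)))) (Good t') (fun D => ~~ Good t'.+1 D) (s ^ k.-1) h.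
  rewrite size_sol_co; apply.
  + by [].
  + by apply/mapP => -[].
  + by move=> D c x cl; apply: rbit_local; apply: contraTneq cl => ->; apply/mapP => -[].
  + by move=> D x; rewrite rsol_local //; apply/mapP => -[].
  + by move=> c D; exact: rsol_recorded.
  + by move=> c D; exact: card_rsol_le1.
  + move=> D D' RD RD' DD' /andP[g1 g2].
    have c1 o : o != Some b -> col D' o = col D o.
      move=> ob; apply/funext => i; rewrite /col DD' //.
      by apply: contra ob => /mapP[j _ [-> _]].
    rewrite /good -(_ : cost tau s D = cost tau s D') ?g1 /=.
      by rewrite /outer c1.
    apply: eq_bigr => b' _; have [->|b'b] := eqVneq b' b.
      have act (D1 : DB) : rsol tau (col D1 (Some b)) P -> active tau D1 b.
        by move=> h1; apply/orP; right; apply/existsP; exists P.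
      by rewrite /cost1 !act.
    have sb : Some b' != Some b by apply: contra b'b => /eqP[->].
    rewrite /cost1 /active /nrec c1 //.
    by have /(congr1 (fun f => f b')) := c1 None isT; rewrite /col => ->.
  + exact: gb.
  + by move=> D x _; exact: good_recorded.
  + by move=> D x RD; exact: s_leak_count ts RD.
  + exact: hG.
- have -> : Q (var_co (inr y)) (var_test (inr y)) h = fun=> 0 by apply/funext => D.
  have -> : res (fun D => ~~ Good t'.+1 D) (fun=> 0) = fun=> 0.
    by apply/funext => D; rewrite /res if_same.
  by rewrite l2_0 mulr_ge0 // leak_eps_ge0.
Qed.

Definition bit_co (i : 'I_n) : seq Co := if [pick u | iota u == i] is Some u then var_co u else [::].
Definition bit_test (i : 'I_n) D : bool :=
  if [pick u | iota u == i] is Some u then var_test u D else false.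

Definition cell_bits S (i : 'I_n) : bool := [exists c, i == iota (inr (S, c))].
Definition test_eps : RR := k%:R * Num.sqrt (2 / q).

(** Good databases contain no outer solution, so testing for a given one succeeds only through its
    [k] symbols taking the single completing value each. *)
Lemma cell_mass T (A : qalg n T) t' : (T <= s ^ 2)%N -> (t' < T)%N ->
  \sum_(w : Om) \sum_(S | sol tau (wcol w None) S) qmass A (blank_bits enc tau iota w) t' (cell_bits S)
    <= (test_eps + 2 * leak_eps * T%:R) ^+ 2 * #|{: Om}|%:R.
Proof.
move=> Ts tT.
apply: (@test_mass _ _ 0 n T A _ bit_co bit_test _ _ _ (fun t' D => Good t' D) (s ^ 2)%N leak_eps
  _ _ _ _ _ Pt cell_bits (sol_co None) (fun S D => rsol tau (col D None) S)) => //.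
- by move=> i; rewrite /bit_co; case: pickP => // u _; exact: var_co_uniq.
- move=> i D c x; rewrite /bit_co /bit_test; case: pickP => // u _; exact: var_test_local.
- move=> i D tD; rewrite /bit_test /blank_bits ffunE; case: pickP => // u _.
  exact: var_test_total.
- exact: leak_eps_ge0.
- exact: good_empty.
- by move=> t1 D; exact: goodS.
- move=> t1 i h ts hG; rewrite /bit_co /bit_test; case: pickP => [u _|_].
    exact: var_leak.
  have -> : Q [::] (fun=> false) h = fun=> 0 by apply/funext => D.
  rewrite (_ : res _ _ = fun=> 0); last by apply/funext => D; rewrite /res if_same.
  by rewrite l2_0 mulr_ge0 ?l2_ge0 // leak_eps_ge0.
- by move=> S S' i /existsP[c /eqP ->] /existsP[c' /eqP/iota_inj[->]].
- by move=> S; exact: sol_co_uniq.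
- by move=> S D c x; exact: rsol_local.
- by move=> S D; exact: rsol_total.
- by rewrite mulr_ge0 // sqrtr_ge0.
move=> t1 S h ts hG; rewrite /test_eps.
have := @res_Fs_le _ _ 0 (sol_co None S) (fun D => rsol tau (col D None) S) 1 h.
have -> : res (fun D => rsol tau (col D None) S) h = fun=> 0.
  apply: (@res_supp _ _ _ (Good t1)) => // D /andP[_]; apply: contra => hS.
  by apply/existsP; exists S.
rewrite size_sol_co mulr1 l2_0 add0r; apply.
  by move=> c D; exact: rsol_recorded.
by move=> c D; exact: card_rsol_le1.
Qed.

Hypothesis n0 : (0 < n)%N.

(** Every solvable input needs square-root masses summing to [1 / 12] on the cell of its first
    solution, and at least half of the inputs are solvable: this gives [1 / 24] on average. *)
Lemma QS_ksum_ge : (2 * #|[pred w : Om | ~~ ok tau w]| <= #|{: Om}|)%N ->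
  (s ^ 2)%:R * (test_eps + 2 * leak_eps * (s ^ 2)%:R) < 1 / 24 ->
  (s ^ 2)%:R <= QS [set: bits n] (ksum_fun dec tau iota).
Proof.
move=> okc small; apply: QS_ge => // T A sep; rewrite ler_nat leqNgt; apply/negP => Ts.
have {}Ts := ltnW Ts.
set m := test_eps + 2 * leak_eps * T%:R.
have te0 : 0 <= test_eps by rewrite mulr_ge0 // sqrtr_ge0.
have le0 := leak_eps_ge0.
have m0 : 0 <= m by rewrite addr_ge0 // !mulr_ge0.
pose f w t' : RR := \sum_(S | sol tau (wcol w None) S) qmass A (blank_bits enc tau iota w) t' (cell_bits S).
have f0 w t' : 0 <= f w t' by apply: sumr_ge0 => S _; exact: qmass_ge0.
have H1 w : ok tau w -> 1 / 12 <= \sum_(u < T) Num.sqrt (f w u).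
  move=> okw; have [S [h [hh hS fS]]] := okP okw.
  apply: le_trans (separates_qmass sep (x := blank_bits enc tau iota w) (y := marked_bits enc tau iota w S h) _ _ _) _.
  - by rewrite finset.in_setT.
  - by rewrite finset.in_setT.
  - by rewrite ksum_blank // ksum_marked.
  apply: ler_sum => u _; apply: ler_wsqrtr; rewrite /f (bigD1 S) //=.
  rewrite -[leLHS]addr0; apply: lerD; last by apply: sumr_ge0 => S' _; exact: qmass_ge0.
  rewrite /qmass big_mkcond [leRHS]big_mkcond; apply: ler_sum => y _.
  case: ifPn => [/blank_marked hc|_]; last by case: ifP => // _; exact: cn2_ge0.
  have [c e] := hc; rewrite ifT //; apply/existsP; exists c; by rewrite e.
have H2 (u : 'I_T) : \sum_(w : Om) Num.sqrt (f w u) <= m * #|{: Om}|%:R.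
  have := CauchySchwarz_sum (fun=> 1) (fun w : Om => Num.sqrt (f w u)).
  under eq_bigr do rewrite mul1r.
  move=> /le_trans; apply.
  have e1 : l2 (fun _ : Om => 1 : RR) = Num.sqrt #|{: Om}|%:R.
    rewrite /l2; congr Num.sqrt; under eq_bigr do rewrite expr1n.
    by rewrite sumr_const.
  have e2 : l2 (fun w : Om => Num.sqrt (f w u)) <= m * Num.sqrt #|{: Om}|%:R.
    apply: l2_le; first by rewrite mulr_ge0 ?sqrtr_ge0.
    rewrite exprMn sqr_sqrtr //; under eq_bigr do rewrite sqr_sqrtr //.
    exact: cell_mass.
  rewrite e1; apply: (@le_trans _ _ (Num.sqrt #|{: Om}|%:R * (m * Num.sqrt #|{: Om}|%:R))).
    by apply: ler_wpM2l; rewrite ?sqrtr_ge0.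
  by rewrite mulrCA -expr2 sqr_sqrtr.
have H3 : (1 / 12) * #|[pred w : Om | ok tau w]|%:R <= T%:R * (m * #|{: Om}|%:R).
  apply: (@le_trans _ _ (\sum_(w : Om) \sum_(u < T) Num.sqrt (f w u))).
    rewrite mulrC mulr_natl -sumr_const big_mkcond; apply: ler_sum => w _.
    rewrite inE; case: ifP => [/H1 //|_].
    by apply: sumr_ge0 => u _; exact: sqrtr_ge0.
  rewrite exchange_big /= -[T in T%:R]card_ord mulr_natl -sumr_const.
  exact: ler_sum.
have Om0 : (0 < #|{: Om}|)%N by apply/card_gt0P; exists [ffun=> 0].
have Om0R : 0 < (#|{: Om}|%:R : RR) by rewrite ltr0n.
have H4 : (#|{: Om}| <= 2 * #|[pred w : Om | ok tau w]|)%N.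
  have := cardC [pred w : Om | ok tau w].
  have -> : #|[predC [pred w : Om | ok tau w]]| = #|[pred w : Om | ~~ ok tau w]|.
    by apply: eq_card => w; rewrite !inE.
  set x := #|[pred w : Om | ok tau w]|; set y := #|[pred w : Om | ~~ ok tau w]| => cC.
  have {}cC : #|{: Om}| = (x + y)%N := esym cC.
  by move: okc; rewrite -/y cC; move: x y {cC}; lia.
have H5 : #|{: Om}|%:R <= 2 * #|[pred w : Om | ok tau w]|%:R :> RR by rewrite -natrM ler_nat.
have H6 : 1 / 24 <= T%:R * m.
  by rewrite -(ler_pM2r Om0R) -mulrA; lra.
have TsR : (T%:R : RR) <= (s ^ 2)%:R by rewrite ler_nat.
have mm : m <= test_eps + 2 * leak_eps * (s ^ 2)%:R.
  by rewrite /m lerD2l; apply: ler_wpM2l => //; rewrite mulr_ge0.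
have : T%:R * m <= (s ^ 2)%:R * (test_eps + 2 * leak_eps * (s ^ 2)%:R) by apply: ler_pM.
lra.
Qed.

End KSumQueries.

(** * Choice of the k-sum parameters *)

Section BinaryVectors.
Variable t : nat.
Definition vdec (f : {ffun 'I_t -> bool}) : 'rV['F_2]_t := \row_e (f e)%:R.
Definition venc (g : 'rV['F_2]_t) : {ffun 'I_t -> bool} := [ffun e => g 0 e != 0].

Lemma F2_bit (x : 'F_2) : (x != 0)%:R = x.
Proof. by case: x => [[|[|m]] hm] //; apply: val_inj. Qed.

Lemma vencK : cancel venc vdec.
Proof. by move=> g; apply/rowP => e; rewrite mxE ffunE F2_bit. Qed.

Lemma vdecK : cancel vdec venc.
Proof. by move=> f; apply/ffunP => e; rewrite ffunE mxE; case: (f e). Qed.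

Lemma card_binary_vectors : #|{: 'rV['F_2]_t}| = (2 ^ t)%N.
Proof. by rewrite card_mx card_Fp // mul1n. Qed.
End BinaryVectors.

(** With [r = 2 ^ j], lets one factor [2 ^ r] absorb each polynomial in [r] that occurs below. *)
Lemma linear_le_exp j : (7 <= j)%N -> (10 * j + 21 <= 2 ^ j)%N.
Proof.
elim: j => // j IH; rewrite leq_eqVlt => /orP[/eqP <- //|j7].
by have := IH j7; rewrite expnS; lia.
Qed.

Lemma sqrt_pow2_le (x y E : nat) : (x + 2 * E <= y)%N ->
  Num.sqrt ((2 ^ x)%:R / (2 ^ y)%:R : RR) <= (2 ^ E)%:R^-1.
Proof.
move=> h; have p2 z : 0 < ((2 ^ z)%:R : RR) by rewrite ltr0n expn_gt0.
apply: (@le_trans _ _ (Num.sqrt ((2 ^ E)%:R^-1 ^+ 2))); last first.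
  by rewrite sqrtr_sqr ger0_norm // invr_ge0 ltW.
apply: ler_wsqrtr.
rewrite exprVn ler_pdivrMr // mulrC ler_pdivlMr ?exprn_gt0 // -natrX -natrM ler_nat.
by rewrite -expnM -expnD leq_exp2l // mulnC.
Qed.

(* Parameters: [m = 2 ^ a] values per coordinate with [a = 2 r^2], sums of
   [k = 32 r^2] symbols from a group of order [2 ^ t], and [2 ^ (a + r)]
   expected solutions. *)
Lemma checked_ksum_family j : (7 <= j)%N -> exists n (g : bits n -> bool),
  [/\ j%:R <= adeg [set: bits n] g,
      adeg [set: bits n] g <= (2 ^ ((2 ^ j) ^ 2 + 2 * 2 ^ j))%:R &
      (2 ^ (4 * (2 ^ j) ^ 2 - 4))%:R <= QS [set: bits n] g].
Proof.
move=> j7; have jexp := linear_le_exp j7.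
have [r rE] : exists r, r = (2 ^ j)%N by exists (2 ^ j)%N.
rewrite -rE in jexp *.
have rhoE : (r ^ 2 = 2 ^ (2 * j))%N by rewrite rE -expnM mulnC.
pose a := (2 * r ^ 2)%N; pose k := (32 * r ^ 2)%N; pose t := (a * k.-1 - r)%N.
have kE : k = (2 ^ (2 * j + 5))%N by rewrite /k rhoE expnD mulnC.
have aE : a = (2 ^ (2 * j + 1))%N by rewrite /a rhoE expnD mulnC.
have rr : (r <= r ^ 2)%N by rewrite -mulnn leq_pmulr //; lia.
have k0 : (0 < k)%N by rewrite kE expn_gt0.
have tE : (t + (a + r) = a * k)%N.
  by rewrite /t -{2}(prednK k0) mulnS addnCA subnK // /k; nia.
have r0 : (0 < r)%N by lia.
have rho0 : (0 < r ^ 2)%N by rewrite expn_gt0 r0.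
have k2 : (1 < k)%N by rewrite /k; lia.
have t0 : (0 < t)%N.
  rewrite /t subn_gt0; apply: (@leq_trans (a * 1)); first by rewrite muln1 /a; lia.
  by rewrite leq_mul2l -ltnS prednK // k2 orbT.
have tak : (t <= a * k)%N by rewrite -tE leq_addr.
pose G : finZmodType := 'rV['F_2]_t.
have qE : #|G| = (2 ^ t)%N by exact: card_binary_vectors.
pose lam := (2 ^ (a + r))%N.
pose Mt : finType := {ffun 'I_a -> bool}.
have ME : #|Mt| = (2 ^ a)%N by rewrite card_ffun card_bool card_ord.
have PtE : #|{: {ffun 'I_k -> Mt}}| = (#|G| * lam)%N.
  by rewrite card_ffun ME card_ord -expnM qE -expnD tE.
have IE : #|{: ('I_k * Mt)%type}| = (k * 2 ^ a)%N by rewrite card_prod card_ord ME.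
have qh : #|G| = (2 * 2 ^ t.-1)%N by rewrite -expnS prednK.
have [tau Htau] := @exists_few_solutions k Mt G _ lam qh (expn_gt0 _ _) PtE.
pose L := (t * (k * 2 ^ a) + 2 * lam)%N.
have HL w : (nsol tau w <= L)%N.
  have E4 : (4 ^ lam = 2 ^ (2 * lam))%N by rewrite expnM.
  by have := Htau w; rewrite qE IE -expnM E4 -expnD leq_exp2l.
pose n := #|{: ksum_var k a t}|.
pose iota : ksum_var k a t -> 'I_n := @enum_rank _.
have iota_inj : injective iota by exact: enum_rank_inj.
have n0 : (0 < n)%N by apply/card_gt0P; exists (inr ([ffun=> [ffun=> false]], None)).
have k2r : (2 * (k + 1) <= 2 ^ r)%N.
  apply: (@leq_trans (2 ^ (2 * j + 7))); last by rewrite leq_exp2l //; lia.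
  by rewrite kE !expnD; have := expn_gt0 2 (2 * j); lia.
have few : (2 * #|[pred w : {ffun (option ('I_k * Mt) * ('I_k * Mt)) -> G} | ~~ ok tau w]| <=
   #|{: {ffun (option ('I_k * Mt) * ('I_k * Mt)) -> G}}|)%N.
  have H := @few_not_ok k a G tau k0 lam PtE.
  have lam0 : (0 < lam)%N by rewrite expn_gt0.
  rewrite -(leq_pmul2r lam0) -mulnA; apply: leq_trans (leq_mul (leqnn 2) H) _.
  rewrite mulnA mulnC leq_mul2l; apply/orP; right.
  rewrite card_option IE /lam expnD mulnS.
  have := expn_gt0 2 a; move: (2 ^ a)%N => x /= x0.
  apply: (@leq_trans (x * (2 * (k + 1)))); last by rewrite leq_mul2l k2r orbT.
  have -> : (x * (2 * (k + 1)) = 2 * (k * x) + 2 * x)%N by ring.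
  by rewrite addnC leq_add2l leq_pmulr.
exists n, (ksum_fun (@vdec t) tau iota); split.
- have [w okw] : exists w : {ffun (option ('I_k * Mt) * ('I_k * Mt)) -> G}, ok tau w.
    apply/existsP; apply: contraT; rewrite negb_exists => /forallP H.
    have Om0 : (0 < #|{: {ffun (option ('I_k * Mt) * ('I_k * Mt)) -> G}}|)%N.
      by apply/card_gt0P; exists [ffun=> 0].
    move: few; rewrite (eq_card (B := predT)) => [|w]; last by rewrite !inE H.
    by rewrite -[X in (_ <= X)%N -> _]mul1n leq_mul2r; case: #|_| Om0.
  apply: (@adeg_ksum_ge k a t G (@vdec t) (@venc t) (@vencK t) (@vdecK t) tau n iota iota_inj k0 t0 w _ okw).
  rewrite IE kE; apply: (@leq_trans (2 ^ (3 * j + 4))); last first.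
    by rewrite -expnD leq_exp2l // rE in jexp *; rewrite aE; have := ltn_expl (2 * j + 1) (ltnSn 1); lia.
  by rewrite expnD (expnM 2 3) mulnC leq_mul2l; apply/orP; right.
(* The square of [2 ^ (r ^ 2 + r)] is [2 ^ (a + 2 r)]. One factor [2 ^ r] comes from [lam] and the
   other absorbs the polynomial factors of the violation count; a last [2 ^ r] will absorb the
   degree of the violations and the error reduction. *)
- apply: (le_trans (@adeg_ksum_le k a t G (@vdec t) tau n iota L (2 ^ (r ^ 2 + r)) HL _)).
    rewrite IE -expnM mulnDl [(r ^ 2 * 2)%N]mulnC -/a expnD expnM /L /lam expnD.
    have := expn_gt0 2 a; move: (2 ^ a)%N => x /= x0.
    have H1 : (t * k <= 2 ^ r)%N.
      apply: (@leq_trans (a * k * k)); first by rewrite leq_mul2r tak orbT.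
      by rewrite aE kE -!expnD leq_exp2l //; lia.
    have H2 : (4 * (k + 2) <= 2 ^ r)%N.
      apply: (@leq_trans (2 ^ (2 * j + 9))); last by rewrite leq_exp2l //; lia.
      by rewrite kE !expnD; have := expn_gt0 2 (2 * j); lia.
    move: (2 ^ r)%N H1 H2 => y H1 H2.
    have -> : (k * x + 2 + k.+1 * (t * (k * x) + 2 * (x * y)) = x * (k + k.+1 * (t * k + 2 * y)) + 2)%N by ring.
    have H3 : (k.+1 * (t * k + 2 * y) <= k.+1 * (3 * y))%N by rewrite leq_mul2l; apply/orP; right; lia.
    have H4 : (4 * (k + 2) * y <= y ^ 2)%N by rewrite -mulnn leq_mul2r H2 orbT.
    have H5 : (k + 2 <= (k + 2) * y)%N by rewrite leq_pmulr //; lia.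
    apply: (@leq_trans (x * (k + k.+1 * (t * k + 2 * y) + 2))).
      by rewrite [leqRHS]mulnDr leq_add2l leq_pmull.
    by rewrite leq_mul2l; apply/orP; right; lia.
  have -> : (r ^ 2 + 2 * r = r ^ 2 + r + r)%N by lia.
  rewrite ler_nat mulnCA [leqRHS]expnD leq_mul2l; apply/orP; right.
  apply: (@leq_trans (2 ^ (10 * j + 20))); last by rewrite leq_exp2l //; lia.
  have tk : (t <= k * a)%N by rewrite mulnC.
  rewrite /viol_deg; apply: (@leq_trans ((k * a + 2) * (k.+2 * (k * a + k * a)).+1)).
    by rewrite leq_mul2l ltnS leq_mul2l leq_add2l tk !orbT.
  have -> : (10 * j + 20 = 2 * j * 5 + (7 + 6 + 7))%N by lia.
  have E7 : (2 ^ 7 = 128)%N by []. have E6 : (2 ^ 6 = 64)%N by [].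
  rewrite /k /a rhoE [leqRHS]expnD [(2 ^ (2 * j * 5))%N]expnM [(2 ^ (7 + 6 + 7))%N]expnD [(2 ^ (7 + 6))%N]expnD E7 E6.
  have := expn_gt0 2 (2 * j); move: (2 ^ (2 * j))%N => z /= z0.
  have -> : (32 * z * (2 * z) = 64 * z ^ 2)%N by ring.
  have -> : (z ^ 5 * (128 * 64 * 128) = 128 * z ^ 2 * (64 * z * (128 * z ^ 2)))%N by ring.
  have z2 : (0 < z ^ 2)%N by rewrite expn_gt0 z0.
  apply: leq_mul; first by lia.
  have -> : (64 * z ^ 2 + 64 * z ^ 2 = 128 * z ^ 2)%N by ring.
  apply: (@leq_ltn_trans (34 * z * (128 * z ^ 2))); first by rewrite leq_mul2r; apply/orP; right; lia.
  by rewrite ltn_mul2r; apply/andP; split; lia.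
have j_le : (2 * j + 6 <= 3 * r)%N by lia.
(* With [s = 2 ^ (a - 2)], a quarter of m, the ratio of [s ^ (k - 1)] to the group order is
   [2 ^ (r - 2 (k - 1))], so leakage amplitudes are of order [2 ^ - E]. *)
pose E := (k.-1 - r)%N.
have rk : (r + 1 <= k.-1)%N by rewrite /k; lia.
have a2 : (2 <= a)%N by rewrite /a; lia.
have EE : (E + r = k.-1)%N by rewrite subnK //; lia.
have tE' : (t = (a - 2) * k.-1 + (2 * E + r))%N.
  have [b aB] : exists b, a = (b + 2)%N by exists (a - 2)%N; rewrite subnK.
  have kB : k = (E + r).+1 by rewrite EE prednK.
  have : (t + (b + 2 + r) = (b + 2) * (E + r).+1)%N by rewrite -aB -kB.
  have -> : (a - 2 = b)%N by rewrite aB addnK.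
  by rewrite -EE; move: (t) (E) => t1 E1; lia.
have e0 : 0 <= (2 ^ E)%:R^-1 :> RR by rewrite invr_ge0.
have h1 : test_eps k G <= k%:R * (2 ^ E)%:R^-1.
  apply: ler_wpM2l => //; rewrite -[2]/(2 ^ 1)%:R qE; apply: sqrt_pow2_le.
  by rewrite tE'; apply: leq_trans (leq_addl _ _); rewrite addnC leq_add2l.
have h2 : Num.sqrt (2 * ((2 ^ (a - 2)) ^ k.-1)%:R / #|G|%:R : RR) <= (2 ^ E)%:R^-1.
  rewrite -[2]/(2 ^ 1)%:R -natrM -expnM -expnD qE; apply: sqrt_pow2_le.
  by rewrite tE' -addnA addnCA leq_add2l addnC leq_add2l.
have k1 : 1 <= (k%:R : RR) by rewrite ler1n.
have h3 : leak_eps k G (2 ^ (a - 2)) <= 4 * (k%:R * (2 ^ E)%:R^-1).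
  by rewrite /leak_eps -/(test_eps k G); nra.
set s2 := ((2 ^ (a - 2)) ^ 2)%N.
have s1 : 1 <= (s2%:R : RR) by rewrite ler1n !expn_gt0.
(* [216 = 9 * 24], from the total amplitude [9 k 2 ^ - E s2] and the threshold [1 / 24]. Here
   [k = 32 r ^ 2] is what makes [2 ^ E] beat [s2 ^ 2 = 2 ^ (8 r ^ 2 - 8)]. *)
have h4 : (216 * k * s2 ^ 2 < 2 ^ E)%N.
  apply: (@leq_ltn_trans (2 ^ (8 + (2 * j + 5) + (a - 2) * 4))).
    have -> : (s2 ^ 2 = 2 ^ ((a - 2) * 4))%N by rewrite /s2 -[LHS]expnM -[LHS]expnM.
    rewrite expnD [(2 ^ (8 + _))%N]expnD -kE leq_mul2r; apply/orP; right.
    by rewrite leq_mul2r orbT.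
  rewrite ltn_exp2l // /E /k /a; move: rr j_le rho0; clear; move: (r ^ 2)%N => R rR jR R0; lia.
have h5 : 216 * k%:R * s2%:R ^+ 2 < (2 ^ E)%:R :> RR by rewrite -natrX -!natrM ltr_nat.
have h6 : 216 * k%:R * s2%:R ^+ 2 * (2 ^ E)%:R^-1 < 1 :> RR.
  by rewrite ltr_pdivrMr ?mul1r // ltr0n expn_gt0.
have ke0 : 0 <= k%:R * (2 ^ E)%:R^-1 :> RR by rewrite mulr_ge0.
apply: (@le_trans _ _ s2%:R).
  rewrite /s2 -expnM ler_nat leq_exp2l // /a; move: rho0; clear; move: (r ^ 2)%N => R R0; lia.
apply: (@QS_ksum_ge k a t G (@vdec t) (@venc t) (@vencK t) tau n iota iota_inj k0 (2 ^ (a - 2)) n0 few).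
rewrite -/s2; apply: (@le_lt_trans _ _ (s2%:R * (9 * (k%:R * (2 ^ E)%:R^-1) * s2%:R))).
  apply: ler_wpM2l => //; nra.
move: h6; rewrite expr2; lra.
Qed.

Lemma QS_adeg_fourth_power_family :
  exists (N : nat -> nat) (G : forall k : nat, bits (N k) -> bool),
     (forall M : RR, exists k0 : nat, forall k : nat, (k0 <= k)%N ->
        M <= adeg [set: bits (N k)] (G k)) /\
     (exists (eps : nat -> RR),
        (forall e : RR, 0 < e -> exists k0 : nat, forall k : nat, (k0 <= k)%N ->
           `|eps k| < e) /\
        (exists k0 : nat, forall k : nat, (k0 <= k)%N ->
           powR (adeg [set: bits (N k)] (G k)) (4 - eps k)
           <= QS [set: bits (N k)] (G k))).
Proof.
pose P j n (g : bits n -> bool) := [/\ j%:R <= adeg [set: bits n] g,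
      adeg [set: bits n] g <= (2 ^ ((2 ^ j) ^ 2 + 2 * 2 ^ j))%:R &
      (2 ^ (4 * (2 ^ j) ^ 2 - 4))%:R <= QS [set: bits n] g].
(* Small indices get a dummy function of no bits; the claims concern large indices only. *)
have H j : exists n (g : bits n -> bool), (7 <= j)%N -> P j n g.
  have [j7|] := leqP 7 j; last by exists 0%N, (fun=> false).
  by have [n [g h]] := checked_ksum_family j7; exists n, g.
pose N j := projT1 (cid (H j)); pose g j := projT1 (cid (projT2 (cid (H j)))).
have gP j : (7 <= j)%N -> P j (N j) (g j) := projT2 (cid (projT2 (cid (H j)))).
exists N, g; split.
  move=> M; exists (maxn 7 (Num.Def.archi_bound `|M|)) => j; rewrite geq_max => /andP[j7 jM].
  have [h _ _] := gP j j7; apply: le_trans h; apply: (@le_trans _ _ (Num.Def.archi_bound `|M|)%:R).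
    by apply: le_trans (ler_norm M) (ltW (archi_boundP (normr_ge0 M))).
  by rewrite ler_nat.
(* The exponent [4 - 12 / r] times [r ^ 2 + 2 r] equals [4 r ^ 2 - 4 r - 24]: the loss [12 r]
   outweighs the [8 r] caused by the factor [2 ^ (2 r)] in the degree. *)
exists (fun j => 12 / (2 ^ j)%:R); split.
  move=> e e0; exists (Num.Def.archi_bound (12 / e)) => j hj.
  have p2 : 0 < ((2 ^ j)%:R : RR) by rewrite ltr0n expn_gt0.
  rewrite ger0_norm ?divr_ge0 // ltr_pdivrMr // mulrC -ltr_pdivrMr //.
  apply: (lt_le_trans (archi_boundP _)); first by rewrite divr_ge0 // ltW.
  by rewrite ler_nat; apply: leq_trans hj (ltnW (ltn_expl _ _)).
exists 7%N => j j7; have [h1 h2 h3] := gP j j7; apply: le_trans h3.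
have r128 : (128 <= 2 ^ j)%N by rewrite -[128%N]/(2 ^ 7)%N leq_exp2l.
move: (2 ^ j)%N r128 h2 => r r128 h2.
have rR : (128 : RR) <= r%:R by rewrite ler_nat.
have r0 : 0 < (r%:R : RR) by lra.
have e4 : 0 <= 4 - 12 / r%:R :> RR.
  by rewrite subr_ge0 ler_pdivrMr //; lra.
apply: (@le_trans _ _ (powR (2 ^ (r ^ 2 + 2 * r))%:R (4 - 12 / r%:R))).
  apply: ge0_ler_powR => //; rewrite nnegrE //.
  by apply: le_trans h1.
rewrite natrX -powR_mulrn // -powRrM natrX -powR_mulrn //.
apply: ler_powR; first by rewrite ler1n.
rewrite natrB; last by nia.
rewrite natrD [(2 * r)%:R]natrM [(4 * _)%:R]natrM natrX.
have -> : (r%:R ^+ 2 + 2%:R * r%:R) * (4 - 12 / r%:R) = 4 * r%:R ^+ 2 - 4 * r%:R - 24 :> RR.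
  by field; rewrite gt_eqF.
lra.
Qed.

Theorem theorem3 :
  (* 1. a family of total functions f_k with Adv(f_k) -> oo and
        QS(f_k) = Omega~(Adv(f_k)^2) *)
  (exists (N : nat -> nat) (F : forall k : nat, bits (N k) -> bool),
     (forall M : RR, exists k0 : nat, forall k : nat, (k0 <= k)%N ->
        M <= Adv [set: bits (N k)] (F k)) /\
     (exists (c : nat) (K : RR) (k0 : nat), 0 < K /\
        forall k : nat, (k0 <= k)%N ->
          K * (Adv [set: bits (N k)] (F k) ^+ 2)
            / (ln (Adv [set: bits (N k)] (F k) ^+ 2)) ^+ c
          <= QS [set: bits (N k)] (F k)))
  /\
  (* 2. a family of total functions g_k with adeg(g_k) -> oo and
        QS(g_k) >= adeg(g_k)^(4 - o(1)) *)
  (exists (N : nat -> nat) (G : forall k : nat, bits (N k) -> bool),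
     (forall M : RR, exists k0 : nat, forall k : nat, (k0 <= k)%N ->
        M <= adeg [set: bits (N k)] (G k)) /\
     (exists (eps : nat -> RR),
        (forall e : RR, 0 < e -> exists k0 : nat, forall k : nat, (k0 <= k)%N ->
           `|eps k| < e) /\
        (exists k0 : nat, forall k : nat, (k0 <= k)%N ->
           powR (adeg [set: bits (N k)] (G k)) (4 - eps k)
           <= QS [set: bits (N k)] (G k))))
  /\
  (* 3. for every n, an n-bit partial function h with
        QS(h) = Omega~(n^(1/3)) and Adv(h) = O(log n) *)
  (exists (c : nat) (K1 K2 : RR) (n0 : nat), 0 < K1 /\
     forall n : nat, (n0 <= n)%N ->
       exists (D : {set bits n}) (h : bits n -> bool),
         K1 * powR (n%:R) (1 / 3) / (ln (n%:R)) ^+ c <= QS D h /\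
         Adv D h <= K2 * ln (n%:R)).
Proof. exact: conj QS_Adv_square_family (conj QS_adeg_fourth_power_family QS_Adv_partial_family). Qed.
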